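(* Let $\mathbb{A}_n^m$, the basis $\{I_k\}_{k=1}^n$, the indices $u_s$, the vectors $e_1=1,e_2,e_3$, the real space $E_3$, the functionals $f_u$, and the straight lines $L_u$ be as described in the context. Let a domain $\Omega\subset\mathbb{R}^3$ be convex in the direction of the straight lines $L_u$ and let $f_u(E_3)=\mathbb{C}$ for all $u=1,2,\ldots,m$. Put $\Omega_\zeta=\{xe_1+ye_2+ze_3:(x,y,z)\in\Omega\}$ and let $D_u=f_u(\Omega_\zeta)\subset\mathbb{C}$ be the domain onto which $\Omega_\zeta$ is mapped by $f_u$. Then every monogenic function $\Phi:\Omega_\zeta\to\mathbb{A}_n^m$ can be expressed in the form $$\Phi(\zeta)=\sum_{u=1}^m I_u\,\frac{1}{2\pi i}\int_{\Gamma_u}F_u(t)(te_1-\zeta)^{-1}\,dt+\sum_{s=m+1}^n I_s\,\frac{1}{2\pi i}\int_{\Gamma_{u_s}}G_s(t)(te_1-\zeta)^{-1}\,dt,$$ where $F_u$ and $G_s$ are certain holomorphic functions in the domains $D_u$ and $D_{u_s}$, respectively, and $\Gamma_q$ is a closed Jordan rectifiable curve in $D_q$ which surrounds the point $\xi_q=f_q(\zeta)$ and contains no points $\xi_\ell=f_\ell(\zeta)$, $\ell,q=1,2,\ldots,m$, $\ell\ne q$.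
   Context: Algebra. Fix $m,n\in\mathbb{N}$, $m\le n$. $\mathbb{A}_n^m$ is an arbitrary $n$-dimensional commutative associative algebra with unit over $\mathbb{C}$, with a basis $\{I_k\}_{k=1}^n$ satisfying: (1) for $r,s\in\{1,\ldots,m\}$: $I_rI_s=0$ if $r\ne s$ and $I_rI_r=I_r$; (2) for $r,s\in\{m+1,\ldots,n\}$: $I_rI_s=\sum_{k=\max\{r,s\}+1}^n\Upsilon_{r,k}^{s}I_k$ with structure constants $\Upsilon_{r,k}^s\in\mathbb{C}$; (3) for each $s\in\{m+1,\ldots,n\}$ there is a unique $u_s\in\{1,\ldots,m\}$ such that for all $r\in\{1,\ldots,m\}$: $I_rI_s=I_s$ if $r=u_s$ and $I_rI_s=0$ if $r\neq u_s$. The unit is $1=\sum_{u=1}^m I_u$. (By a theorem of E. Cartan such a basis exists.) Functionals. For $u=1,\ldots,m$, $f_u:\mathbb{A}_n^m\to\mathbb{C}$ is the linear functional with $f_u(I_u)=1$ and $f_u(I_k)=0$ for $k\ne u$ (it is continuous and multiplicative). Variable. $e_1=1=\sum_{r=1}^mI_r$, $e_2=\sum_{r=1}^na_rI_r$, $e_3=\sum_{r=1}^nb_rI_r$ ($a_r,b_r\in\mathbb{C}$) are linearly independent over $\mathbb{R}$; $E_3=\{\zeta=xe_1+ye_2+ze_3:x,y,z\in\mathbb{R}\}$; $\xi_u=f_u(\zeta)=x+ya_u+zb_u$ for $u=1,\ldots,m$; $f_u(E_3)=\{f_u(\zeta):\zeta\in E_3\}$. Lines. $L_u=\{(x,y,z)\in\mathbb{R}^3: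 x+y\,\mathrm{Re}\,a_u+z\,\mathrm{Re}\,b_u=0,\ y\,\mathrm{Im}\,a_u+z\,\mathrm{Im}\,b_u=0\}$. A domain $\Omega\subset\mathbb{R}^3$ is convex in the direction of a line $L$ if it contains every segment parallel to $L$ whose endpoints lie in $\Omega$. Monogenic functions. A continuous function $\Phi:\Omega_\zeta\to\mathbb{A}_n^m$ is monogenic in $\Omega_\zeta$ if for every $\zeta\in\Omega_\zeta$ there is an element $\Phi'(\zeta)\in\mathbb{A}_n^m$ (the Gateaux derivative) such that $\lim_{\varepsilon\to0+0}(\Phi(\zeta+\varepsilon h)-\Phi(\zeta))\varepsilon^{-1}=h\Phi'(\zeta)$ for all $h\in E_3$. *)

(* Defs.v *)
From HB Require Import structures.
From mathcomp Require Import all_boot all_order all_algebra all_field.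
From mathcomp Require Import all_classical all_reals all_analysis.
From mathcomp Require Export complex.

Set Implicit Arguments.
Unset Strict Implicit.
Unset Printing Implicit Defensive.

Import Order.TTheory GRing.Theory Num.Theory.
Import numFieldNormedType.Exports.

Local Open Scope classical_set_scope.
Local Open Scope ring_scope.
Local Open Scope complex_scope.

(* The topology of the modulus; [R[i]^o] carries it in the library, [R[i]]
   itself does not. *)
HB.instance Definition _ (R : realType) :=
  PseudoPointedMetric.copy R[i] R[i]^o.

Section CurvesInC.
Variable R : realType.
Implicit Types (g : R -> R[i]) (f : R[i] -> R[i]) (D : set R[i]).

Definition twopii : R[i] := (2 * pi)%:C * 'i%C.

(* [P.1] lists the division points after 0 and [P.2] has one tag per cell. *)
Definition tagged_partition (P : seq R * seq R) : Prop :=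
  [/\ itv_partition 0 1 P.1, size P.2 = size P.1 &
      forall i, (i < size P.1)%N ->
        nth 1 (0 :: P.1) i <= nth 1 P.2 i <= nth 1 (0 :: P.1) i.+1].

Definition mesh_lt (d : R) (P : seq R * seq R) : Prop :=
  forall i, (i < size P.1)%N ->
    nth 1 (0 :: P.1) i.+1 - nth 1 (0 :: P.1) i < d.

Definition mesh_filter : set_system (seq R * seq R) :=
  filter_from [set d : R | 0 < d]
    (fun d => [set P | tagged_partition P /\ mesh_lt d P]).

Definition stieltjes_sum g f (P : seq R * seq R) : R[i] :=
  \sum_(0 <= i < size P.1) f (g (nth 1 P.2 i)) *
    (g (nth 1 (0 :: P.1) i.+1) - g (nth 1 (0 :: P.1) i)).

(* Curves are merely rectifiable, hence a Stieltjes integral rather than the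
   integral of [f (g t) * g' t]. *)
Definition contour_integral g f : R[i] :=
  lim (stieltjes_sum g f P @[P --> mesh_filter]).

Definition rectifiable g : Prop := exists M : R[i], forall s : seq R,
  itv_partition 0 1 s ->
  \sum_(0 <= i < size s) `|g (nth 1 (0 :: s) i.+1) - g (nth 1 (0 :: s) i)| <= M.

Definition closed_jordan g : Prop :=
  [/\ {within `[0, 1], continuous g}, g 0 = g 1 &
      {in `[0, 1[ &, injective g}].

Definition trace g : set R[i] := g @` `[0, 1].

(* The union of the bounded components of the complement of the curve. *)
Definition inside g : set R[i] :=
  [set w | ~ trace g w /\
    bounded_set (connected_component (~` trace g) w : set R[i]^o)].

Definition positively_oriented g : Prop := forall w, inside g w ->
  contour_integral g (fun t => (t - w)^-1) = twopii.

(* [g] is a closed Jordan rectifiable curve in [D]; it is traversed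
   counterclockwise, which the factor [twopii^-1] of Cauchy's formula
   presupposes.  Since [D] may have holes, "in [D]" has to be required of the
   region bounded by the curve as well, or Cauchy's formula would fail. *)
Definition admissible_contour D g : Prop :=
  [/\ closed_jordan g, rectifiable g, positively_oriented g,
      trace g `<=` D & inside g `<=` D].

Definition holomorphic_on D f : Prop :=
  forall z, D z -> derivable (f : R[i]^o -> R[i]^o) z 1.

End CurvesInC.

Section Space.
Variable R : realType.
Implicit Types Omega L : set 'rV[R]_3.

Definition domain Omega : Prop :=
  [/\ open Omega, connected Omega & Omega !=set0].

(* The point (x, y, z) is the row vector with entries 0, 1, 2. *)
Definition line (au bu : R[i]) : set 'rV[R]_3 :=
  [set p | p 0 0 + p 0 1 * complex.Re au + p 0 2 * complex.Re bu = 0 /\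
           p 0 1 * complex.Im au + p 0 2 * complex.Im bu = 0].

(* [L] is a line through the origin, i.e. the set of its direction vectors. *)
Definition convex_in_direction Omega L : Prop :=
  forall p q, Omega p -> Omega q -> L (q - p) ->
  forall t : R, 0 <= t <= 1 -> Omega ((1 - t) *: p + t *: q).

End Space.

Section Algebra.
Variables (R : realType) (A : falgType R[i]) (n : nat).
Implicit Types (I : n.-tuple A) (a b : 'I_n -> R[i]).

(* Indices are shifted to start from 0: those below [m] belong to the
   idempotents, the others to the nilpotent elements.  [Y r s k] is the
   structure constant Upsilon_{r,k}^s, and only the values of [us] at indices
   [s >= m] matter; [us s] is unique because [tnth I s != 0]. *)
Definition cartan_basis (m : nat) I (Y : 'I_n -> 'I_n -> 'I_n -> R[i])
    (us : 'I_n -> 'I_n) : Prop :=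
  [/\ basis_of fullv I,
      forall r s : 'I_n, (r < m)%N -> (s < m)%N ->
        tnth I r * tnth I s = if r == s then tnth I r else 0,
      forall r s : 'I_n, (m <= r)%N -> (m <= s)%N ->
        tnth I r * tnth I s =
          \sum_(k < n | (maxn r s < k)%N) Y r s k *: tnth I k,
      forall s : 'I_n, (m <= s)%N ->
        (us s < m)%N /\
        forall r : 'I_n, (r < m)%N ->
          tnth I r * tnth I s = if r == us s then tnth I s else 0
    & 1 = \sum_(u < n | (u < m)%N) tnth I u].

Definition coords I (v : A) : 'rV[R[i]]_n := \row_k coord I k v.

(* [A] with the topology of C^n, transported along the coordinates. *)
Definition alg_top I : topologicalType := initial_topology (coords I).

Definition lincomb I a : A := \sum_(r < n) a r *: tnth I r.

(* x e_1 + y e_2 + z e_3, with e_1 = 1, e_2 = lincomb I a, e_3 = lincomb I b. *)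
Definition zeta I a b (p : 'rV[R]_3) : A :=
  (p 0 0)%:C *: 1 + (p 0 1)%:C *: lincomb I a + (p 0 2)%:C *: lincomb I b.

Definition E3 I a b : set A := range (zeta I a b).

Definition lin_indep I a b : Prop :=
  forall p : 'rV[R]_3, zeta I a b p = 0 -> p = 0.

(* Only the values of [Phi] on [D] matter when [D] is open in E_3. *)
Definition monogenic I a b (D : set A) (Phi : A -> A) : Prop :=
  {within (D : set (alg_top I)), continuous (Phi : alg_top I -> alg_top I)} /\
  forall x, D x -> exists dPhi : A, forall h, E3 I a b h ->
    ((eps^-1)%:C *: (Phi (x + eps%:C *: h) - Phi x) : alg_top I)
      @[eps --> (0 : R)^'+] --> (h * dPhi : alg_top I).

Definition alg_contour_integral I (g : R -> R[i]) (Psi : R[i] -> A) : A :=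
  \sum_(k < n) contour_integral g (fun t => coord I k (Psi t)) *: tnth I k.

(* (2 pi i)^-1 times the integral over [g] of [H(t) (t e_1 - x)^-1 dt]. *)
Definition cauchy_term I (g : R -> R[i]) (H : R[i] -> R[i]) (x : A) : A :=
  (twopii R)^-1 *: alg_contour_integral I g (fun t => H t *: (t *: 1 - x)^-1).

End Algebra.

(* Main.v *)
(* Multiplication is triangular in the basis [I]. Hence, if the coordinates below
   [k] of a monogenic function vanish, its [k]-th coordinate has derivative
   [xi_q(h) c] in every direction [h], where [q] is [k] or [u_k]. By convexity
   it is constant along [L_q], so it is [H (xi_q)] for a function [H] on [D_q],
   which is continuous and Gateaux differentiable over C and therefore
   holomorphic. Subtracting the monogenic function
     I_k * \sum_j H^(j)(xi_q) / j! * (zeta - xi_q)^j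
   makes the [k]-th coordinate vanish too, and iteration over [k] expresses [Phi]
   as the sum of these functions. They are the asserted Cauchy integrals, since
     I_k * (t - zeta)^-1 = \sum_j (t - xi_q)^-(j+1) * I_k * (zeta - xi_q)^j.

   The holomorphy of [H] is of Looman-Menchoff type. Let K be the set of the
   points without local primitive. By Baire's theorem, on a portion of K and for
   all directions in a cone, the difference quotients are uniformly bounded.
   This bounds the integrals over the squares Q with sides in that cone by a
   constant times the area of Q; an extremal argument on the quotients then
   makes these integrals vanish, so there is a local primitive on that portion
   after all. *)
Require Import Defs.
From HB Require Import structures.
From mathcomp Require Import all_boot all_order all_algebra all_field.
From mathcomp Require Import all_classical all_reals all_analysis.
From mathcomp Require Import ring lra zify.

Set Implicit Arguments.
Unset Strict Implicit.
Unset Printing Implicit Defensive.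

Import Order.TTheory GRing.Theory Num.Theory.
Import numFieldNormedType.Exports.

Local Open Scope classical_set_scope.
Local Open Scope ring_scope.
Local Open Scope complex_scope.

(** * The real modulus of a complex number *)

(** A monogenic function has its derivative along each direction separately, from one side, and
    nothing is known about uniformity in the direction. So Goursat's argument does not apply to [H],
    and a Looman-Menchoff type argument is forced. A slope bound at a point of K controls the values
    only in the cone issuing from it. Hence the integrals are taken over parallelograms whose sides
    span such a cone; the part of a parallelogram that lies in no cone with vertex in K is free of K
    and is cut off along a staircase. The contours of the statement are arbitrary rectifiable Jordan
    curves. Integrals along them are limits of Stieltjes sums, estimated through a dominating
    function, and Cauchy's formula comes from Dixon's proof, which asks only that the winding number
    vanish off D_q. That follows without the Jordan curve theorem: the winding number is constant on
    each component of the complement and 0 far away, so a point where it is not 0 lies inside the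
    curve, hence in D_q. The functions F_u and G_s come from one family indexed by all basis
    elements. *)

Section Modulus.
Variable R : realType.
Implicit Types (x y z : R[i]).

(** The norm of [R[i]] takes complex values, whose order is partial; estimates are carried out with
    this real copy, in a total order. *)
Definition nm (z : R[i]) : R := complex.Re `|z|.

Lemma normE z : `|z| = (nm z)%:C.
Proof. by rewrite /nm RRe_real // normr_real. Qed.

Lemma nm_ge0 z : 0 <= nm z.
Proof. by have := normr_ge0 z; rewrite normE ler0c. Qed.

Lemma nm0 : nm 0 = 0. Proof. by rewrite /nm normr0. Qed.
Lemma nm1 : nm 1 = 1. Proof. by rewrite /nm normr1. Qed.
Lemma nmN z : nm (- z) = nm z. Proof. by rewrite /nm normrN. Qed.
Lemma nmB x y : nm (x - y) = nm (y - x). Proof. by rewrite /nm distrC. Qed.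
Lemma nmD x y : nm (x + y) <= nm x + nm y.
Proof. by rewrite -lecR rmorphD /= -!normE ler_normD. Qed.
Lemma nmM x y : nm (x * y) = nm x * nm y.
Proof. by apply: complexI; rewrite rmorphM /= -!normE normrM. Qed.
Lemma nmX x n : nm (x ^+ n) = nm x ^+ n.
Proof. by elim: n => [|n IH]; rewrite ?expr0 ?nm1 // !exprS nmM IH. Qed.
Lemma nmV x : nm x^-1 = (nm x)^-1.
Proof. by apply: complexI; rewrite fmorphV /= -!normE normfV. Qed.
Lemma nm_eq0 x : (nm x == 0) = (x == 0).
Proof. by rewrite -[RHS]normr_eq0 normE; apply/eqP/eqP => [->|/complexI]. Qed.
Lemma nm_gt0 x : (0 < nm x) = (x != 0).
Proof. by rewrite lt_neqAle nm_ge0 andbT eq_sym nm_eq0. Qed.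
Lemma nm_real (a : R) : nm a%:C = `|a|.
Proof. by rewrite /nm normc_def /= expr0n addr0 sqrtr_sqr. Qed.
Lemma nmi : nm 'i%C = 1.
Proof. by rewrite /nm normc_def /= expr0n add0r expr1n sqrtr1. Qed.
Lemma nm_nat n : nm n%:R = n%:R.
Proof. by rewrite -(rmorph_nat (real_complex R)) nm_real normr_nat. Qed.
Lemma nm_sum (I : Type) (r : seq I) (P : pred I) (F : I -> R[i]) :
  nm (\sum_(i <- r | P i) F i) <= \sum_(i <- r | P i) nm (F i).
Proof.
elim/big_rec2: _ => [|i y x _ IH]; first by rewrite nm0.
exact: le_trans (nmD _ _) (lerD _ _).
Qed.
Lemma nm_triangle z x y : nm (x - y) <= nm (x - z) + nm (z - y).
Proof. by rewrite (_ : x - y = (x - z) + (z - y)) ?nmD //; ring. Qed.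
Lemma nm_geB x y : nm x - nm y <= nm (x - y).
Proof. by rewrite lerBlDr -{1}(subrK y x) nmD. Qed.
Lemma nm_le_Re z : `|complex.Re z| <= nm z.
Proof.
rewrite /nm normc_def /= -sqrtr_sqr ler_wsqrtr // lerDl sqr_ge0 //.
Qed.
Lemma nm_le_Im z : `|complex.Im z| <= nm z.
Proof. by rewrite /nm normc_def /= -sqrtr_sqr ler_wsqrtr // lerDr sqr_ge0. Qed.
Lemma nm_le_ReIm z : nm z <= `|complex.Re z| + `|complex.Im z|.
Proof.
rewrite {1}(complexE z) (le_trans (nmD _ _)) // nmM nmi mul1r !nm_real //.
Qed.
Lemma nm_eqP z : (forall e : R, 0 < e -> nm z <= e) -> z = 0.
Proof.
move=> H; apply/eqP; rewrite -nm_eq0 eq_le nm_ge0 andbT.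
by apply/ler_addgt0Pr => e e0; rewrite add0r H.
Qed.

Lemma gt0_complex (e : R[i]) : 0 < e -> 0 < complex.Re e /\ e = (complex.Re e)%:C.
Proof. by rewrite ltcE /= => /andP[/eqP ie re]; split => //; rewrite {1}(complexE e) ie mulr0 addr0. Qed.

Lemma nbhs_nmP z (A : set R[i]) :
  nbhs z A <-> exists2 r : R, 0 < r & forall w, nm (w - z) < r -> A w.
Proof.
split=> [/nbhs_ballP [e /gt0_complex[e0 ->] H]|[r r0 H]].
  exists (complex.Re e) => // w wz; apply: H.
  by change (`|z - w| < (complex.Re e)%:C); rewrite distrC normE ltcR.
apply/nbhs_ballP; exists r%:C; first by rewrite /= ltcR.
by move=> w; change (`|z - w| < r%:C -> A w); rewrite distrC normE ltcR; exact: H.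
Qed.

Lemma cvg_nmP (T : Type) (F : set_system T) (FF : Filter F) (f : T -> R[i]) (l : R[i]) :
  f x @[x --> F] --> l <-> forall e : R, 0 < e -> \forall x \near F, nm (f x - l) < e.
Proof.
split=> [fl e e0|H].
  have : nbhs l [set w | nm (w - l) < e] by apply/nbhs_nmP; exists e.
  by move=> /fl.
move=> A /nbhs_nmP [r r0 rA]; have := H r r0; apply: filterS => x; exact: rA.
Qed.

Lemma derivable_nmP (f : R[i] -> R[i]) z d :
  (forall e : R, 0 < e -> exists2 r : R, 0 < r & forall w, nm (w - z) < r ->
    nm (f w - f z - d * (w - z)) <= e * nm (w - z)) ->
  derivable (f : R[i]^o -> R[i]^o) z 1.
Proof.
move=> H; apply/cvg_ex; exists d.
apply/(@cvg_nmP _ 0^' _ _ d) => e e0.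
have e20 : 0 < e / 2 by rewrite divr_gt0.
have [r r0 Hr] := H _ e20.
apply/nbhs_nmP; exists r => // h; rewrite subr0 => hr h0 /=.
have := Hr (h + z); rewrite addrK => /(_ hr) Hh.
rewrite (_ : h *: 1 = h); last exact: mulr1.
have -> : h^-1 *: (f (h + z) - f z) - d = h^-1 * (f (h + z) - f z - d * h).
  by rewrite [RHS]mulrBr (mulrCA h^-1 d) mulVf // mulr1.
rewrite nmM nmV mulrC ltr_pdivrMr ?nm_gt0 // (le_lt_trans Hh) // ltr_pM2r ?nm_gt0 //.
lra.
Qed.

Lemma cvg_nm_unique (T : Type) (F : set_system T) (FF : ProperFilter F)
   (f : T -> R[i]) (l : R[i]) : f x @[x --> F] --> l -> lim (f x @[x --> F]) = l.
Proof. by move=> fl; apply/(@cvg_lim R[i]^o) => //; exact: norm_hausdorff. Qed.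

End Modulus.

(** * Compactness of segments and completeness, with explicit radii *)

Section Compactness.
Variable R : realType.

(** Nearly all compactness arguments take this form. [P r x] is typically a statement about all
    points within [r] of [x], hence antitone in [r]; the near-covering property of the segment,
    applied to the filter of small positive radii, turns local radii into a common one. *)
Lemma segment_uniform (a b : R) (P : R -> R -> Prop) :
  (forall x, a <= x <= b -> exists2 r, 0 < r &
     forall y, a <= y <= b -> `|y - x| < r -> P r y) ->
  (forall d d' x, d' <= d -> P d x -> P d' x) ->
  exists2 r, 0 < r & forall x, a <= x <= b -> P r x.
Proof.
move=> loc anti.
have itvE z : `[a, b]%classic z = (a <= z <= b) by rewrite /= in_itv.
have /compact_near_coveringP/near_covering_withinP nc := @segment_compact R a b.
have H : forall x, `[a, b]%classic x ->
    \forall x' \near x & i \near (0 : R)^'+, `[a, b]%classic x' -> P i x'.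
  move=> x; rewrite itvE => /loc [r r0 Hr].
  exists (ball x r, [set i | 0 < i < r]) => /=.
    split; first exact: nbhsx_ballx.
    by exists r => //= y /=; rewrite sub0r normrN => yr y0; rewrite y0 /= (le_lt_trans _ yr) // ler_norm.
  move=> [y i] /= [xy /andP[i0 ir]] yab.
  apply: (anti r); first exact: ltW.
  by apply: Hr; [rewrite -itvE|rewrite distrC].
have [d d0 Hd] := nc _ (0 : R)^'+ P _ H.
exists (d / 2); first by rewrite divr_gt0.
move=> x xab; have := Hd (d / 2) => /=; apply.
- by rewrite sub0r normrN gtr0_norm ?divr_gt0 // ltr_pdivrMr // mulr_natr mulr2n ltrDl.
- by rewrite divr_gt0.
- by move: xab; rewrite /= ?in_itv.
Qed.

(** Two applications of [segment_uniform]: for fixed [x] the second segment yields a radius valid on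
    a whole strip around [x], and the first segment is covered by such strips. *)
Lemma segment2_uniform (a b c d : R) (P : R -> R -> R -> Prop) :
  (forall x y, a <= x <= b -> c <= y <= d -> exists2 r, 0 < r &
     forall x' y', a <= x' <= b -> c <= y' <= d -> `|x' - x| < r -> `|y' - y| < r -> P r x' y') ->
  (forall r r' x y, r' <= r -> P r x y -> P r' x y) ->
  exists2 r, 0 < r & forall x y, a <= x <= b -> c <= y <= d -> P r x y.
Proof.
move=> loc anti.
have := @segment_uniform a b (fun r x => forall y, c <= y <= d -> P r x y).
case=> [x xab|r r' x rr H y yc|r r0 H]; last by exists r => // x y xab; exact: H.
  have := @segment_uniform c d
    (fun r y => forall x', a <= x' <= b -> `|x' - x| < r -> P r x' y).
  case=> [y ycd|r r' y rr H x' x'ab xx|r r0 H].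
  - have [r r0 H] := loc x y xab ycd; exists r => // y' y'cd yy x' x'ab xx.
    exact: H.
  - by apply: (anti _ _ _ _ rr); apply: H => //; exact: lt_le_trans rr.
  by exists r => // x' x'ab xx y ycd; apply: H.
exact: anti rr (H _ yc).
Qed.

Lemma cauchy_real (u : nat -> R) :
  (forall e : R, 0 < e -> exists N, forall m n, (N <= m)%N -> (N <= n)%N -> `|u m - u n| <= e) ->
  exists l : R, forall e : R, 0 < e -> exists N, forall n, (N <= n)%N -> `|u n - l| <= e.
Proof.
move=> H.
have : cauchy (u @ \oo).
  apply/cauchy_ballP => e e0.
  have e20 : 0 < e / 2 by rewrite divr_gt0.
  have [N HN] := H _ e20.
  exists (u @` [set n | (N <= n)%N], u @` [set n | (N <= n)%N]) => /=.
    by split; exists N => // n /= Nn; exists n.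
  move=> [x y] /= [[m Nm <-] [n Nn <-]].
  rewrite /ball /= (le_lt_trans (HN _ _ Nm Nn)) // ltr_pdivrMr // mulr_natr mulr2n ltrDl //.
move=> /cauchy_cvgP /cvg_ex [l ul].
exists l => e e0.
move/cvgrPdist_le : ul => /(_ _ e0) [N _ HN].
by exists N => n Nn; rewrite distrC; apply: HN.
Qed.

Lemma cauchy_complex (u : nat -> R[i]) :
  (forall e : R, 0 < e -> exists N, forall m n, (N <= m)%N -> (N <= n)%N -> nm (u m - u n) <= e) ->
  exists l : R[i], forall e : R, 0 < e -> exists N, forall n, (N <= n)%N -> nm (u n - l) <= e.
Proof.
move=> H.
have ReB (x y : R[i]) : complex.Re x - complex.Re y = complex.Re (x - y).
  by case: x y => [? ?] [? ?].
have ImB (x y : R[i]) : complex.Im x - complex.Im y = complex.Im (x - y).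
  by case: x y => [? ?] [? ?].
have [e e0|x Hx] := @cauchy_real (fun n => complex.Re (u n)).
  have [N HN] := H _ e0; exists N => m n Nm Nn.
  by rewrite ReB (le_trans (nm_le_Re _)) // HN.
have [e e0|y Hy] := @cauchy_real (fun n => complex.Im (u n)).
  have [N HN] := H _ e0; exists N => m n Nm Nn.
  by rewrite ImB (le_trans (nm_le_Im _)) // HN.
exists (x +i* y) => e e0.
have e20 : 0 < e / 2 by rewrite divr_gt0.
have [N HN] := Hx _ e20; have [M HM] := Hy _ e20.
exists (maxn N M) => n; rewrite geq_max => /andP[Nn Mn].
rewrite (le_trans (nm_le_ReIm _)) // -ReB -ImB /= [leRHS]splitr lerD //.
  exact: HN.
exact: HM.
Qed.

End Compactness.

(** * Stieltjes integrals along rectifiable curves *)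

Section Stieltjes.
Variable R : realType.
Implicit Types (g : R -> R[i]) (f : R[i] -> R[i]) (v : R -> R).

(** The function [v] stands for arc length. It only has to majorize the increments, so that sums
    over a partition telescope to [v 1 - v 0]; for a circle a multiple of the parameter will do. *)
Definition dominated g v :=
  forall s t, 0 <= s -> s <= t -> t <= 1 -> nm (g t - g s) <= v t - v s.

(** [contour_integral] is a [lim] and carries information only once convergence is known; this
    predicate records convergence and value together. *)
Definition isint g f (L : R[i]) := forall e : R, 0 < e -> exists2 d, 0 < d &
  forall P, tagged_partition P -> mesh_lt d P -> nm (stieltjes_sum g f P - L) <= e.

(** The default 1 of [nth] is also the right end of the interval, so the bounds hold at every
    index. *)
Lemma tagged_partitionP (P : seq R * seq R) : tagged_partition P ->
  [/\ forall i, (i < size P.1)%N -> nth 1 (0 :: P.1) i <= nth 1 (0 :: P.1) i.+1,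
      forall i, 0 <= nth 1 (0 :: P.1) i <= 1,
      nth 1 (0 :: P.1) (size P.1) = 1 & (0 < size P.1)%N].
Proof.
move=> [part _ _]; have [pth /eqP lst] := part.
have n1 : nth 1 (0 :: P.1) (size P.1) = 1 by rewrite -[size _]/(size (0 :: P.1)).-1 nth_last.
split => //.
- by move=> i iP; move/(pathP 1): pth => /(_ i iP) /ltW.
- move=> i; have [iP|iP] := ltnP i (size P.1).+1.
    by rewrite itv_partition_nth_ge // itv_partition_nth_le.
  by rewrite nth_default // ler01 lexx.
by case: P.1 lst => //= /eqP; rewrite eq_sym oner_eq0.
Qed.

Definition uniform_partition (n : nat) : seq R * seq R :=
  ([seq k.+1%:R / n%:R | k <- iota 0 n], [seq k%:R / n%:R | k <- iota 0 n]).

Lemma nth_uniform_partition n i : (0 < n)%N -> (i <= n)%N ->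
  nth 1 (0 :: (uniform_partition n).1) i = i%:R / n%:R :> R.
Proof.
move=> n0; case: i => [|i] iN; first by rewrite mul0r.
by rewrite /= (nth_map 0%N) ?size_iota // nth_iota.
Qed.

Lemma nth_uniform_tag n i : (i < n)%N ->
  nth 1 (uniform_partition n).2 i = i%:R / n%:R :> R.
Proof. by move=> iN; rewrite /= (nth_map 0%N) ?size_iota // nth_iota. Qed.

Lemma uniform_partitionP n : (0 < n)%N -> tagged_partition (uniform_partition n).
Proof.
move=> n0; have n0R : 0 < n%:R :> R by rewrite ltr0n.
split.
- split.
    apply/(pathP 1) => i; rewrite size_map size_iota => iN.
    have := nth_uniform_partition n0 (ltnW iN) => ->.
    rewrite (nth_map 0%N) ?size_iota // nth_iota //.
    by rewrite ltr_pM2r ?invr_gt0 // ltr_nat.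
  rewrite -nth_last /= size_map size_iota.
  case: n n0 n0R => // n _ nR; rewrite (nth_map 0%N) ?size_iota // nth_iota //=.
  by rewrite add0n divff // gt_eqF.
- by rewrite !size_map.
move=> i; rewrite size_map size_iota => iN.
rewrite !nth_uniform_partition //; last exact: ltnW.
by rewrite nth_uniform_tag // lexx ler_pM2r ?invr_gt0 // ler_nat leqnSn.
Qed.

Lemma uniform_partition_mesh (d : R) n : 0 < d -> d^-1 < n%:R -> mesh_lt d (uniform_partition n).
Proof.
move=> d0 dn i; rewrite size_map size_iota => iN.
have n0 : (0 < n)%N by apply: leq_ltn_trans iN.
rewrite !nth_uniform_partition // ?(ltnW iN) // -mulrBl -natrB // subSnn mul1r.
by rewrite invf_plt // posrE ltr0n.
Qed.

Lemma exists_partition (d : R) : 0 < d -> exists2 P, tagged_partition P & mesh_lt d P.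
Proof.
move=> d0; have := archi_boundP (ltW (_ : 0 < d^-1)); rewrite invr_gt0 => /(_ d0) H.
exists (uniform_partition (Num.bound d^-1)); last exact: uniform_partition_mesh.
apply: uniform_partitionP; rewrite -(ltr0n R) (lt_trans _ H) // invr_gt0 //.
Qed.

Lemma mesh_filter_proper : ProperFilter (@mesh_filter R).
Proof.
apply: filter_from_proper.
  apply: filter_from_filter; first by exists 1 => /=.
  move=> d e /= d0 e0; exists (Num.min d e); first by rewrite /= lt_min d0.
  move=> P [tP mP]; split; split => // i iP; have := mP i iP; rewrite lt_min => /andP[] //.
move=> d /= d0; have [P tP mP] := exists_partition d0; by exists P.
Qed.

Lemma isint_contour g f L : isint g f L -> contour_integral g f = L.
Proof.
move=> H; apply: cvg_nm_unique; first exact: mesh_filter_proper.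
have FP := mesh_filter_proper.
apply/cvg_nmP => e e0.
have e20 : 0 < e / 2 by rewrite divr_gt0.
have [d d0 Hd] := H _ e20; exists d => // P [tP mP].
rewrite /= (le_lt_trans (Hd _ tP mP)) // ltr_pdivrMr // mulr_natr mulr2n ltrDl //.
Qed.

Lemma stieltjes_sumD g f1 f2 P :
  stieltjes_sum g (fun z => f1 z + f2 z) P = stieltjes_sum g f1 P + stieltjes_sum g f2 P.
Proof. by rewrite /stieltjes_sum -big_split /=; apply: eq_bigr => i _; rewrite mulrDl. Qed.

Lemma stieltjes_sumZ g c f P :
  stieltjes_sum g (fun z => c * f z) P = c * stieltjes_sum g f P.
Proof. by rewrite /stieltjes_sum big_distrr /=; apply: eq_bigr => i _; rewrite mulrA. Qed.

Lemma isintD g f1 f2 L1 L2 : isint g f1 L1 -> isint g f2 L2 ->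
  isint g (fun z => f1 z + f2 z) (L1 + L2).
Proof.
move=> H1 H2 e e0.
have e20 : 0 < e / 2 by rewrite divr_gt0.
have [d1 d10 Hd1] := H1 _ e20; have [d2 d20 Hd2] := H2 _ e20.
exists (Num.min d1 d2); first by rewrite lt_min d10.
move=> P tP mP; rewrite stieltjes_sumD opprD addrACA (le_trans (nmD _ _)) // [leRHS]splitr lerD //.
  by apply: Hd1 => // i iP; have := mP i iP; rewrite lt_min => /andP[].
by apply: Hd2 => // i iP; have := mP i iP; rewrite lt_min => /andP[].
Qed.

Lemma isintZ g c f L : isint g f L -> isint g (fun z => c * f z) (c * L).
Proof.
move=> H e e0.
have c0 : 0 < nm c + 1 by rewrite ltr_wpDl ?nm_ge0.
have [d d0 Hd] := H (e / (nm c + 1)) (divr_gt0 e0 c0).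
exists d => // P tP mP; rewrite stieltjes_sumZ -mulrBr nmM.
apply: le_trans (_ : (nm c + 1) * (e / (nm c + 1)) <= _).
  by apply: ler_pM; rewrite ?nm_ge0 ?lerDl // Hd.
by rewrite mulrCA divff ?mulr1 // gt_eqF.
Qed.

Lemma isint0 g : isint g (fun=> 0) 0.
Proof.
move=> e e0; exists 1 => // P _ _; rewrite /stieltjes_sum big1 ?subrr ?nm0 ?ltW //.
by move=> i _; rewrite mul0r.
Qed.

Lemma isint_sum g (J : Type) (r : seq J) (f : J -> R[i] -> R[i]) (L : J -> R[i]) :
  (forall j, isint g (f j) (L j)) ->
  isint g (fun z => \sum_(j <- r) f j z) (\sum_(j <- r) L j).
Proof.
move=> H; elim: r => [|j r IH].
  rewrite big_nil (_ : (fun z => _) = fun=> 0); first exact: isint0.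
  by apply/funext => z; rewrite big_nil.
rewrite big_cons (_ : (fun z => _) = fun z => f j z + \sum_(j <- r) f j z).
  exact: isintD.
by apply/funext => z; rewrite big_cons.
Qed.

Lemma eq_isint g f1 f2 L : (forall t, 0 <= t <= 1 -> f1 (g t) = f2 (g t)) ->
  isint g f1 L -> isint g f2 L.
Proof.
move=> f12 H e e0; have [d d0 Hd] := H _ e0; exists d => // P tP mP.
have := Hd P tP mP; rewrite /stieltjes_sum.
have [X01 X1 _ _] := tagged_partitionP tP.
have [_ sP tag] := tP.
under eq_big_nat => i /andP[_ iP].
  rewrite f12; first over.
  have /andP[a b] := tag i iP; have /andP[c d'] := X1 i; have /andP[e' f'] := X1 i.+1.
  by rewrite (le_trans c a) (le_trans b f').
by [].
Qed.

Lemma isint_unique g f L1 L2 : isint g f L1 -> isint g f L2 -> L1 = L2.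
Proof. by move=> /isint_contour <- /isint_contour <-. Qed.

Lemma dominated_sum (P : seq R * seq R) v : tagged_partition P ->
  \sum_(0 <= i < size P.1) (v (nth 1 (0 :: P.1) i.+1) - v (nth 1 (0 :: P.1) i)) = v 1 - v 0.
Proof. by move=> /tagged_partitionP[_ _ n1 n0]; rewrite telescope_sumr // n1. Qed.

Lemma stieltjes_sum_le g f v (B : R) P : dominated g v -> tagged_partition P ->
  (forall t, 0 <= t <= 1 -> nm (f (g t)) <= B) ->
  nm (stieltjes_sum g f P) <= B * (v 1 - v 0).
Proof.
move=> gv tP fB.
rewrite /stieltjes_sum (le_trans (nm_sum _ _ _)) // -(dominated_sum v tP) big_distrr /=.
have [X01 X1 _ _] := tagged_partitionP tP.
have [_ sP tag] := tP.
rewrite big_nat [leRHS]big_nat; apply: ler_sum => i /andP[_ iP].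
have /andP[a b] := tag i iP; have /andP[c d'] := X1 i; have /andP[e' f'] := X1 i.+1.
rewrite nmM ler_pM ?nm_ge0 //; last by apply: gv => //; exact: X01.
by apply: fB; rewrite (le_trans c a) (le_trans b f').
Qed.

Lemma isint_le g f v L (B : R) : dominated g v -> isint g f L ->
  (forall t, 0 <= t <= 1 -> nm (f (g t)) <= B) -> nm L <= B * (v 1 - v 0).
Proof.
move=> gv H fB; apply/ler_addgt0Pr => e e0.
have [d d0 Hd] := H _ e0; have [P tP mP] := exists_partition d0.
have {Hd} := Hd P tP mP => H1.
have -> : L = stieltjes_sum g f P - (stieltjes_sum g f P - L) by rewrite subKr.
by rewrite (le_trans (nmD _ _)) // nmN lerD // stieltjes_sum_le.
Qed.

(** Summation over the cells telescopes [psi]. The errors are measured against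
    [v b - v a + (b - a)], whose sum [v 1 - v 0 + 1] is positive even if [v] is constant. *)
Lemma isint_primitive g f v (psi : R -> R[i]) : dominated g v ->
  (forall e : R, 0 < e -> exists2 d, 0 < d & forall a t b, 0 <= a -> a <= t -> t <= b -> b <= 1 ->
     b - a < d -> nm (f (g t) * (g b - g a) - (psi b - psi a)) <= e * (v b - v a + (b - a))) ->
  isint g f (psi 1 - psi 0).
Proof.
move=> gv H e e0.
have V0 : 0 <= v 1 - v 0 by apply: le_trans (gv 0 1 _ _ _); rewrite ?nm_ge0.
have V1 : 0 < v 1 - v 0 + 1 by rewrite ltr_wpDl.
pose K := v 1 - v 0 + 1.
have [d d0 Hd] := H (e / K) (divr_gt0 e0 V1).
exists d => // P tP mP.
have [X01 X1 n1 n0] := tagged_partitionP tP.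
have [_ sP tag] := tP.
have -> : psi 1 - psi 0 = \sum_(0 <= i < size P.1)
    (psi (nth 1 (0 :: P.1) i.+1) - psi (nth 1 (0 :: P.1) i)).
  by rewrite telescope_sumr // n1.
rewrite /stieltjes_sum -sumrB (le_trans (nm_sum _ _ _)) //.
have KE : K = \sum_(0 <= i < size P.1)
    (v (nth 1 (0 :: P.1) i.+1) - v (nth 1 (0 :: P.1) i) +
     (nth 1 (0 :: P.1) i.+1 - nth 1 (0 :: P.1) i)).
  by rewrite big_split /= dominated_sum // (dominated_sum id) // subr0.
have -> : e = e / K * K by rewrite mulfVK // gt_eqF.
rewrite {2}KE big_distrr /= big_nat [leRHS]big_nat; apply: ler_sum => i /andP[_ iP].
have /andP[a b] := tag i iP; have /andP[c d'] := X1 i; have /andP[e' f'] := X1 i.+1.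
exact: (Hd _ _ _ c a b f' (mP i iP)).
Qed.

End Stieltjes.

(** * Existence of integrals of continuous functions along rectifiable curves *)

Section Existence.
Variable R : realType.
Implicit Types (g : R -> R[i]) (f : R[i] -> R[i]) (v : R -> R).

(** The projection onto [[a, b]]. The part of an interval that lies in a cell runs between the
    projections of its endpoints; in this way the common refinement of two partitions becomes a
    double sum, without merging lists. *)
Let clamp (a b t : R) := Num.max a (Num.min t b).

Let clamp_mono (a b s t : R) : s <= t -> clamp a b s <= clamp a b t.
Proof.
rewrite /clamp => st; rewrite ge_max le_max lexx /= le_max; apply/orP; right.
by rewrite le_min !ge_min st lexx orbT.
Qed.

Let clamp_ge (a b t : R) : a <= clamp a b t.
Proof. by rewrite /clamp le_max lexx. Qed.

Let clamp_le (a b t : R) : a <= b -> clamp a b t <= b.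
Proof. by move=> ab; rewrite /clamp ge_max ab ge_min lexx orbT. Qed.

Let clamp_low (a b t : R) : a <= b -> t <= a -> clamp a b t = a.
Proof. by move=> ab ta; apply/max_idPl; rewrite ge_min ta. Qed.

Let clamp_high (a b t : R) : a <= b -> b <= t -> clamp a b t = b.
Proof. by move=> ab bt; rewrite /clamp (min_idPr bt); apply/max_idPr. Qed.

Let clamp_split (V : zmodType) (h : R -> V) (X : nat -> R) n t :
  (forall i, (i < n)%N -> X i <= X i.+1) -> X 0%N <= t -> t <= X n ->
  \sum_(0 <= j < n) (h (clamp (X j) (X j.+1) t) - h (X j)) = h t - h (X 0%N).
Proof.
move=> mX t0 tn.
suff H k : (k <= n)%N ->
   \sum_(0 <= j < k) (h (clamp (X j) (X j.+1) t) - h (X j)) = h (Num.min t (X k)) - h (X 0%N).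
  by rewrite H // (min_idPl tn).
elim: k => [|k IH] kn; first by rewrite big_nil (min_idPr t0) subrr.
rewrite big_nat_recr //= IH; last exact: ltnW.
have := mX k kn; case: (leP t (X k)) => tk Xk.
  by rewrite (clamp_low Xk tk) (subrr (h (X k))) addr0 (min_idPl (le_trans tk Xk)).
have -> : clamp (X k) (X k.+1) t = Num.min t (X k.+1).
  by apply/max_idPr; rewrite le_min Xk (ltW tk).
by rewrite [RHS]addrC [LHS]addrC addrA subrK addrC.
Qed.

(** Both sums are expanded over the pairs of a cell of [P] and a cell of [Q]. A pair without overlap
    contributes nothing; for an overlapping pair the two tags are less than [d + d] apart, and the
    increments of [v] over all pairs add up to [v 1 - v 0]. *)
Lemma stieltjes_sum_close g f v (e d : R) P Q : dominated g v ->
  (forall s t, 0 <= s <= 1 -> 0 <= t <= 1 -> `|s - t| < d + d -> nm (f (g s) - f (g t)) <= e) ->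
  tagged_partition P -> tagged_partition Q -> mesh_lt d P -> mesh_lt d Q ->
  nm (stieltjes_sum g f P - stieltjes_sum g f Q) <= e * (v 1 - v 0).
Proof.
move=> gv fe tP tQ mP mQ.
have [X01 X1 Xn n0] := tagged_partitionP tP; have [_ sP tagP] := tP.
have [Y01 Y1 Yn m0] := tagged_partitionP tQ; have [_ sQ tagQ] := tQ.
set X := nth 1 (0 :: P.1) in X01 X1 Xn tagP mP.
set Y := nth 1 (0 :: Q.1) in Y01 Y1 Yn tagQ mQ.
set n := size P.1 in X01 Xn tagP mP n0 sP; set m := size Q.1 in Y01 Yn tagQ mQ m0 sQ.
pose c j t := clamp (Y j) (Y j.+1) t.
have rowE (V : zmodType) (h : R -> V) i : (i < n)%N ->
    \sum_(0 <= j < m) (h (c j (X i.+1)) - h (c j (X i))) = h (X i.+1) - h (X i).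
  move=> iN.
  have E t : 0 <= t <= 1 -> \sum_(0 <= j < m) (h (c j t) - h (Y j)) = h t - h (Y 0%N).
    by case/andP=> t0 t1; apply: clamp_split => //; rewrite Yn.
  have -> : h (X i.+1) - h (X i) = (h (X i.+1) - h (Y 0%N)) - (h (X i) - h (Y 0%N)).
    by rewrite opprB addrA subrK.
  rewrite -!E ?X1 // -sumrB; apply: eq_bigr => j _.
  by rewrite opprB addrA subrK.
have colE (V : zmodType) (h : R -> V) j : (j < m)%N ->
    \sum_(0 <= i < n) (h (c j (X i.+1)) - h (c j (X i))) = h (Y j.+1) - h (Y j).
  move=> jm; rewrite (telescope_sumr (fun i => h (c j (X i)))) // Xn.
  have /andP[Yj0 Yj1] := Y1 j; have /andP[Yj0' Yj1'] := Y1 j.+1.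
  by rewrite /c (clamp_high (Y01 _ jm) Yj1') (clamp_low (Y01 _ jm)).
have -> : stieltjes_sum g f P = \sum_(0 <= i < n) \sum_(0 <= j < m)
    f (g (nth 1 P.2 i)) * (g (c j (X i.+1)) - g (c j (X i))).
  by apply: eq_big_nat => i iN; rewrite -big_distrr /= rowE.
have -> : stieltjes_sum g f Q = \sum_(0 <= i < n) \sum_(0 <= j < m)
    f (g (nth 1 Q.2 j)) * (g (c j (X i.+1)) - g (c j (X i))).
  rewrite exchange_big /=.
  by apply: eq_big_nat => j jm; rewrite -big_distrr /= colE.
rewrite -sumrB (le_trans (nm_sum _ _ _)) //.
have -> : v 1 - v 0 = \sum_(0 <= i < n) \sum_(0 <= j < m) (v (c j (X i.+1)) - v (c j (X i))).
  by rewrite -(dominated_sum v tP); apply: eq_big_nat => i iN; rewrite rowE.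
rewrite big_distrr /= big_nat [leRHS]big_nat; apply: ler_sum => i /andP[_ iN].
rewrite -sumrB (le_trans (nm_sum _ _ _)) // big_distrr /= big_nat [leRHS]big_nat.
apply: ler_sum => j /andP[_ jm].
have /andP[a1 b1] := tagP i iN; have /andP[Xi0 Xi1] := X1 i; have /andP[Xi0' Xi1'] := X1 i.+1.
have /andP[a2 b2] := tagQ j jm; have /andP[Yj0 Yj1] := Y1 j; have /andP[Yj0' Yj1'] := Y1 j.+1.
have cv : nm (g (c j (X i.+1)) - g (c j (X i))) <= v (c j (X i.+1)) - v (c j (X i)).
  apply: gv; first exact: le_trans (clamp_ge _ _ _).
    by apply: clamp_mono; exact: X01.
  by apply: le_trans Yj1'; apply: clamp_le; exact: Y01.
rewrite -mulrBl nmM.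
(* Equal projections make the increment of [g] vanish; distinct ones force [X i < Y j.+1] and
   [Y j < X i.+1], that is, a genuine overlap. *)
have [E|NE] := eqVneq (c j (X i.+1)) (c j (X i)).
  by rewrite E !subrr nm0 !mulr0.
apply: ler_pM; rewrite ?nm_ge0 //; apply: fe.
- by rewrite (le_trans Xi0 a1) (le_trans b1 Xi1').
- by rewrite (le_trans Yj0 a2) (le_trans b2 Yj1').
have h1 : X i < Y j.+1.
  rewrite ltNge; apply: contra NE => h; rewrite /c !(clamp_high (Y01 _ jm)) //.
  exact: le_trans h (X01 _ iN).
have h2 : Y j < X i.+1.
  rewrite ltNge; apply: contra NE => h; rewrite /c !(clamp_low (Y01 _ jm)) //.
  exact: le_trans (X01 _ iN) h.
have := mP i iN; have := mQ j jm; rewrite -/X -/Y => q1 q2.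
rewrite ltr_norml; apply/andP; split; lra.
Qed.

(** The sums over uniform partitions form a Cauchy sequence, and [stieltjes_sum_close] carries its
    limit over to all fine partitions. *)
Lemma isint_exists g f v : dominated g v ->
  (forall e : R, 0 < e -> exists2 d, 0 < d & forall s t, 0 <= s <= 1 -> 0 <= t <= 1 ->
    `|s - t| < d -> nm (f (g s) - f (g t)) <= e) ->
  exists L, isint g f L.
Proof.
move=> gv fc.
have V0 : 0 <= v 1 - v 0 by apply: le_trans (gv 0 1 _ _ _); rewrite ?nm_ge0.
have V1 : 0 < v 1 - v 0 + 1 by rewrite ltr_wpDl.
have C (e : R) : 0 < e -> exists2 d, 0 < d & forall P Q,
   tagged_partition P -> tagged_partition Q -> mesh_lt d P -> mesh_lt d Q ->
   nm (stieltjes_sum g f P - stieltjes_sum g f Q) <= e.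
  move=> e0; have [d d0 Hd] := fc _ (divr_gt0 e0 V1).
  exists (d / 2); first by rewrite divr_gt0.
  move=> P Q tP tQ mP mQ.
  apply: (le_trans (@stieltjes_sum_close g f v (e / (v 1 - v 0 + 1)) (d / 2) P Q gv _ tP tQ mP mQ)).
    by move=> s t s1 t1 st; apply: Hd => //; rewrite [d]splitr.
  rewrite mulrAC ler_pdivrMr // ler_pM2l // lerDl //.
have [e e0|L HL] := @cauchy_complex R (fun n => stieltjes_sum g f (@uniform_partition R n.+1)).
  have [d d0 Hd] := C _ e0; exists (Num.bound d^-1) => m n mN nN.
  have dN := archi_boundP (ltW (_ : 0 < d^-1)); rewrite invr_gt0 in dN; have {}dN := dN d0.
  by apply: Hd; try exact: uniform_partitionP; apply: uniform_partition_mesh => //;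
     apply: lt_le_trans dN _; rewrite ler_nat leqW.
exists L => e e0.
have e20 : 0 < e / 2 by rewrite divr_gt0.
have [d d0 Hd] := C _ e20; exists d => // P tP mP.
have [N HN] := HL _ e20.
have dN := archi_boundP (ltW (_ : 0 < d^-1)); rewrite invr_gt0 in dN; have {}dN := dN d0.
pose k := maxn N (Num.bound d^-1).
rewrite (le_trans (nm_triangle (stieltjes_sum g f (uniform_partition R k.+1)) _ _)) // [leRHS]splitr lerD //.
  apply: Hd => //; first exact: uniform_partitionP.
  by apply: uniform_partition_mesh => //; apply: lt_le_trans dN _; rewrite ler_nat leqW // leq_maxr.
by apply: HN; rewrite leq_maxl.
Qed.

(** [v t] is the sum of the total variations of the real and the imaginary part on [[0, t]]. It may
    exceed the arc length, but [dominated] asks for an upper bound only. *)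
Lemma rectifiable_dominated g : rectifiable g -> exists v, dominated g v.
Proof.
case=> M HM.
have bv (h : R[i] -> R) : (forall x y : R[i], h x - h y = h (x - y)) ->
    (forall z, `|h z| <= nm z) -> exists v : R -> R,
    forall s t, 0 <= s -> s <= t -> t <= 1 -> `|h (g t) - h (g s)| <= v t - v s.
  move=> hB hle.
  have BV01 : bounded_variation 0 1 (h \o g).
    exists (complex.Re M) => _ [s part <-].
    have := HM s part; rewrite lecE => /andP[_]; apply: le_trans.
    rewrite /variation.
    under [X in _ <= complex.Re X]eq_bigr do rewrite normE.
    rewrite -rmorph_sum /=.
    by apply: ler_sum => i _; rewrite hB hle.
  have fin t : 0 <= t -> t <= 1 -> total_variation 0 t (h \o g) \is a fin_num.
    move=> t0 t1; move/bounded_variationP : BV01 => /(_ ler01).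
    rewrite (total_variationD _ t0 t1) fin_numD => /andP[] //.
  exists (fun t => fine (total_variation 0 t (h \o g))) => s t s0 st t1.
  have s1 := le_trans st t1; have t0 := le_trans s0 st.
  have ft := fin _ t0 t1; have fs := fin _ s0 s1.
  rewrite -lee_fin EFinB !fineK // (total_variationD _ s0 st) addeAC subee // add0e.
  exact: total_variation_ge.
have [//||v1 H1] := bv (@complex.Re R); [by move=> [? ?] [? ?]|exact: nm_le_Re|].
have [//||v2 H2] := bv (@complex.Im R); [by move=> [? ?] [? ?]|exact: nm_le_Im|].
exists (fun t => v1 t + v2 t) => s t s0 st t1.
rewrite opprD addrACA (le_trans (nm_le_ReIm _)) // lerD //.
  by rewrite (_ : complex.Re _ = complex.Re (g t) - complex.Re (g s)) ?H1 //; case: (g t) (g s) => [? ?] [? ?].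
by rewrite (_ : complex.Im _ = complex.Im (g t) - complex.Im (g s)) ?H2 //; case: (g t) (g s) => [? ?] [? ?].
Qed.

End Existence.

(** * Strict derivatives *)

Section StrictDerivative.
Variable R : realType.
Implicit Types (f : R[i] -> R[i]) (x y z d : R[i]).

(* The strict derivative. If it exists at every point of an open set, then it
   is continuous there, so that Cauchy's theorem needs no Goursat argument. *)
Definition sder f z d := forall e : R, 0 < e -> exists2 r : R, 0 < r &
  forall x y, nm (x - z) < r -> nm (y - z) < r ->
    nm (f y - f x - d * (y - x)) <= e * nm (y - x).

Definition cont_at f z := forall e : R, 0 < e -> exists2 r : R, 0 < r &
  forall x, nm (x - z) < r -> nm (f x - f z) <= e.

Lemma sder_derivable f z d : sder f z d -> derivable (f : R[i]^o -> R[i]^o) z 1.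
Proof.
move=> H; apply: (@derivable_nmP _ f z d) => e e0; have [r r0 Hr] := H e e0.
by exists r => // w wz; apply: Hr; rewrite ?subrr ?nm0.
Qed.

Lemma sder_lipschitz f z d : sder f z d -> exists2 r : R, 0 < r &
  forall x y, nm (x - z) < r -> nm (y - z) < r -> nm (f y - f x) <= (nm d + 1) * nm (y - x).
Proof.
move=> H; have [r r0 Hr] := H 1 ltr01; exists r => // x y xz yz.
have -> : f y - f x = d * (y - x) + (f y - f x - d * (y - x)) by ring.
by rewrite (le_trans (nmD _ _)) // nmM mulrDl lerD // Hr.
Qed.

Lemma sder_cont f z d : sder f z d -> cont_at f z.
Proof.
move=> /sder_lipschitz [r r0 Hr] e e0.
have c0 : 0 < nm d + 1 by rewrite ltr_wpDl ?nm_ge0.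
exists (Num.min r (e / (nm d + 1))); first by rewrite lt_min r0 divr_gt0.
move=> x; rewrite lt_min => /andP[xr xe].
rewrite (le_trans (Hr _ _ _ xr)) ?subrr ?nm0 //.
by rewrite mulrC -ler_pdivlMr // ltW.
Qed.

Lemma nm_gt0_near (x : R[i]) (r : R) : 0 < r -> exists2 h : R[i], 0 < nm h & nm h < r.
Proof.
move=> r0; exists (r / 2)%:C; rewrite nm_real gtr0_norm ?divr_gt0 //.
by rewrite ltr_pdivrMr // mulr_natr mulr2n ltrDl.
Qed.

(** This is the gain over an ordinary derivative: the derivatives at [x] and at [z] both approximate
    the increment of [f] over one small step [h] from [x], so they differ by at most [e]. *)
Lemma sder_near f z d : sder f z d -> forall e : R, 0 < e -> exists2 r : R, 0 < r &
  forall x, nm (x - z) < r -> forall d', sder f x d' -> nm (d' - d) <= e.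
Proof.
move=> H e e0; have e20 : 0 < e / 2 by rewrite divr_gt0.
have [r r0 Hr] := H _ e20; exists r => // x xz d' H'.
have [r' r'0 Hr'] := H' _ e20.
have rx : 0 < Num.min r' (r - nm (x - z)) by rewrite lt_min r'0 subr_gt0.
have [h h0] := nm_gt0_near x rx; rewrite lt_min => /andP[hr' hr].
have H1 := Hr x (x + h) xz; have H2 := Hr' x (x + h).
rewrite subrr nm0 [x + h - x]addrC addKr in H2; have {}H2 := H2 r'0 hr'.
rewrite [x + h - x]addrC addKr in H1.
have {}H1 : nm (f (x + h) - f x - d * h) <= e / 2 * nm h.
  apply: H1; have := nmD (x - z) h; rewrite (_ : x - z + h = x + h - z); [lra|by ring].
suff : nm ((d' - d) * h) <= e * nm h by rewrite nmM ler_pM2r.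
have -> : (d' - d) * h = (f (x + h) - f x - d * h) - (f (x + h) - f x - d' * h) by ring.
rewrite (le_trans (nmD _ _)) // nmN (le_trans (lerD H1 H2)) //.
by rewrite -mulrDl -splitr.
Qed.

Lemma sder_unique f z d d' : sder f z d -> sder f z d' -> d = d'.
Proof.
move=> H H'; apply/eqP; rewrite -subr_eq0; apply/eqP; apply: nm_eqP => e e0.
by have [r r0 Hr] := sder_near H' e0; apply: (Hr z) => //; rewrite subrr nm0.
Qed.

Lemma sder_cst c z : sder (fun=> c) z 0.
Proof. by move=> e e0; exists 1 => // x y _ _; rewrite subrr mul0r subr0 nm0 mulr_ge0 ?nm_ge0 // ltW. Qed.

Lemma sder_id z : sder id z 1.
Proof. by move=> e e0; exists 1 => // x y _ _; rewrite mul1r subrr nm0 mulr_ge0 ?nm_ge0 // ltW. Qed.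

Lemma sderD f1 f2 z d1 d2 : sder f1 z d1 -> sder f2 z d2 ->
  sder (fun x => f1 x + f2 x) z (d1 + d2).
Proof.
move=> H1 H2 e e0; have e20 : 0 < e / 2 by rewrite divr_gt0.
have [r1 r10 Hr1] := H1 _ e20; have [r2 r20 Hr2] := H2 _ e20.
exists (Num.min r1 r2); first by rewrite lt_min r10.
move=> x y; rewrite !lt_min => /andP[x1 x2] /andP[y1 y2].
have -> : f1 y + f2 y - (f1 x + f2 x) - (d1 + d2) * (y - x) =
  (f1 y - f1 x - d1 * (y - x)) + (f2 y - f2 x - d2 * (y - x)) by ring.
rewrite (le_trans (nmD _ _)) // [e]splitr mulrDl lerD //; [exact: Hr1|exact: Hr2].
Qed.

Lemma sderM f1 f2 z d1 d2 : sder f1 z d1 -> sder f2 z d2 ->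
  sder (fun x => f1 x * f2 x) z (d1 * f2 z + f1 z * d2).
Proof.
move=> H1 H2 e e0.
pose M := nm (f1 z) + nm (f2 z) + nm d1 + nm d2 + 1.
have M1 : 1 <= M by rewrite lerDr !addr_ge0 ?nm_ge0.
have M0 : 0 < M by rewrite (lt_le_trans ltr01).
have [n1 n2 n3 n4] : [/\ nm (f1 z) <= M, nm (f2 z) <= M, nm d1 <= M & nm d2 <= M].
  have := nm_ge0 (f1 z); have := nm_ge0 (f2 z); have := nm_ge0 d1; have := nm_ge0 d2.
  by rewrite /M => *; split; lra.
(* The difference of the products splits into six terms, each to be at most [e / 6] times the step;
   [e' <= 1] serves the terms in which two small factors meet. *)
pose e' := Num.min 1 (e / (6 * M)).
have e'0 : 0 < e' by rewrite lt_min ltr01 divr_gt0 // mulr_gt0.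
have [r1 r10 Hr1] := H1 _ e'0; have [r2 r20 Hr2] := H2 _ e'0.
have [q1 q10 Hq1] := sder_cont H1 e'0; have [q2 q20 Hq2] := sder_cont H2 e'0.
exists (Num.min (Num.min r1 r2) (Num.min q1 q2)); first by rewrite !lt_min r10 r20 q10.
move=> x y; rewrite !lt_min => /andP[/andP[x1 x2] /andP[x3 x4]] /andP[/andP[y1 y2] /andP[y3 y4]].
set h := nm (y - x).
have h0 : 0 <= h by exact: nm_ge0.
have -> : f1 y * f2 y - f1 x * f2 x - (d1 * f2 z + f1 z * d2) * (y - x) =
  (f1 y - f1 x - d1 * (y - x)) * f2 z + (f1 y - f1 x - d1 * (y - x)) * (f2 y - f2 z)
  + d1 * (f2 y - f2 z) * (y - x)
  + (f1 x - f1 z) * (f2 y - f2 x - d2 * (y - x)) + f1 z * (f2 y - f2 x - d2 * (y - x))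
  + (f1 x - f1 z) * d2 * (y - x) by ring.
have A1 := Hr1 x y x1 y1; have A2 := Hr2 x y x2 y2.
have B1 := Hq1 x x3; have B2 := Hq2 y y4.
have e'1 : e' <= 1 by rewrite ge_min lexx.
have e'M : e' * M <= e / 6.
  have -> : e / 6 = e / (6 * M) * M by field; rewrite gt_eqF.
  by rewrite ler_pM2r // ge_min lexx orbT.
have e's : 0 <= e' by exact: ltW.
have t1 : nm ((f1 y - f1 x - d1 * (y - x)) * f2 z) <= e / 6 * h.
  rewrite nmM (le_trans (ler_pM _ _ A1 n2)) ?nm_ge0 // -/h mulrAC ler_wpM2r //.
have t2 : nm ((f1 y - f1 x - d1 * (y - x)) * (f2 y - f2 z)) <= e / 6 * h.
  rewrite nmM (le_trans (ler_pM _ _ A1 B2)) ?nm_ge0 // -/h mulrAC ler_wpM2r //.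
  rewrite (le_trans _ e'M) // ler_wpM2l // (le_trans e'1) //.
have t3 : nm (d1 * (f2 y - f2 z) * (y - x)) <= e / 6 * h.
  rewrite !nmM -/h ler_wpM2r // (le_trans (ler_pM _ _ n3 B2)) ?nm_ge0 // mulrC //.
have t4 : nm ((f1 x - f1 z) * (f2 y - f2 x - d2 * (y - x))) <= e / 6 * h.
  rewrite nmM (le_trans (ler_pM _ _ B1 A2)) ?nm_ge0 // -/h mulrA ler_wpM2r //.
  rewrite (le_trans _ e'M) // ler_wpM2l // (le_trans e'1) //.
have t5 : nm (f1 z * (f2 y - f2 x - d2 * (y - x))) <= e / 6 * h.
  rewrite nmM (le_trans (ler_pM _ _ n1 A2)) ?nm_ge0 // -/h mulrA ler_wpM2r // mulrC //.
have t6 : nm ((f1 x - f1 z) * d2 * (y - x)) <= e / 6 * h.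
  rewrite !nmM -/h ler_wpM2r // (le_trans (ler_pM _ _ B1 n4)) ?nm_ge0 //.
have -> : e * h = e / 6 * h + e / 6 * h + e / 6 * h + e / 6 * h + e / 6 * h + e / 6 * h by field.
by do 5 (apply: (le_trans (nmD _ _)); apply: lerD => //).
Qed.

Lemma sderV z : z != 0 -> sder (fun x => x^-1) z (- z ^- 2).
Proof.
move=> z0 e e0; have nz : 0 < nm z by rewrite nm_gt0.
(* The first bound keeps the denominator [x * y * z ^+ 2] above a quarter of [nm z ^+ 4]; the second
   bounds the numerator by [e * nm z ^+ 4] times 1/10 * 3/2 + 1/10 = 1/4. *)
pose r := Num.min (nm z / 2) (e * nm z ^+ 3 / 10).
have r0 : 0 < r by rewrite lt_min !divr_gt0 // mulr_gt0 // exprn_gt0.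
exists r => // x y; rewrite !lt_min => /andP[x1 x2] /andP[y1 y2].
have half w : nm (w - z) < nm z / 2 -> nm z / 2 <= nm w.
  move=> wz; have := nm_geB z w; rewrite nmB; lra.
have X := half _ x1; have Y := half _ y1.
have nx : 0 < nm x by lra. 
have ny : 0 < nm y by lra.
have x0 : x != 0 by rewrite -nm_gt0.
have y0 : y != 0 by rewrite -nm_gt0.
have -> : y^-1 - x^-1 - - z ^- 2 * (y - x) =
   ((x - z) * y + z * (y - z)) / (x * y * z ^+ 2) * (y - x).
  by field; rewrite x0 y0 z0.
rewrite nmM ler_wpM2r ?nm_ge0 // nmM nmV (nmM (x * y)) nmX (nmM x) ler_pdivrMr ?mulr_gt0 ?exprn_gt0 //.
rewrite (le_trans (nmD _ _)) // !nmM.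
have yz : nm y <= nm z * (3 / 2) by have := nm_geB y z; lra.
set A := nm (x - z) in x1 x2 *; set B := nm (y - z) in y1 y2 *.
have A0 : 0 <= A by exact: nm_ge0.
have B0 : 0 <= B by exact: nm_ge0.
apply: (@le_trans _ _ (e * nm z ^+ 3 / 10 * (nm z * (3 / 2)) + nm z * (e * nm z ^+ 3 / 10))).
  by apply: lerD; apply: ler_pM => //; lra.
apply: (@le_trans _ _ (e * ((nm z / 2) * (nm z / 2) * nm z ^+ 2))).
  have -> : e * nm z ^+ 3 / 10 * (nm z * (3 / 2)) + nm z * (e * nm z ^+ 3 / 10) = (e * nm z ^+ 4) / 4 by field.
  by have -> : e * ((nm z / 2) * (nm z / 2) * nm z ^+ 2) = (e * nm z ^+ 4) / 4 by field.
rewrite ler_pM2l // ler_pM2r ?exprn_gt0 // ler_pM //; lra.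
Qed.

Lemma sder_comp f1 f2 z d1 d2 : sder f1 z d1 -> sder f2 (f1 z) d2 ->
  sder (fun x => f2 (f1 x)) z (d2 * d1).
Proof.
move=> H1 H2 e e0; have e20 : 0 < e / 2 by rewrite divr_gt0.
have c1 : 0 < nm d1 + 1 by rewrite ltr_wpDl ?nm_ge0.
have c2 : 0 < nm d2 + 1 by rewrite ltr_wpDl ?nm_ge0.
have [r2 r20 Hr2] := H2 (e / 2 / (nm d1 + 1)) (divr_gt0 e20 c1).
have [r1 r10 Hr1] := H1 (e / 2 / (nm d2 + 1)) (divr_gt0 e20 c2).
have [q q0 Hq] := sder_lipschitz H1.
have r220 : 0 < r2 / 2 by rewrite divr_gt0.
have [p p0 Hp] := sder_cont H1 r220.
exists (Num.min (Num.min r1 q) p); first by rewrite !lt_min r10 q0.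
move=> x y; rewrite !lt_min => /andP[/andP[x1 x2] x3] /andP[/andP[y1 y2] y3].
have -> : f2 (f1 y) - f2 (f1 x) - d2 * d1 * (y - x) =
  (f2 (f1 y) - f2 (f1 x) - d2 * (f1 y - f1 x)) + d2 * (f1 y - f1 x - d1 * (y - x)) by ring.
rewrite (le_trans (nmD _ _)) // [e]splitr mulrDl lerD //.
  rewrite (le_trans (Hr2 _ _ _ _)) //.
  - by rewrite (le_lt_trans (Hp _ x3)) // ltr_pdivrMr // mulr_natr mulr2n ltrDl.
  - by rewrite (le_lt_trans (Hp _ y3)) // ltr_pdivrMr // mulr_natr mulr2n ltrDl.
  rewrite -mulrA ler_pM2l ?divr_gt0 // mulrC ler_pdivrMr // mulrC.
  exact: Hq.
rewrite nmM; have := Hr1 x y x1 y1.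
set t := nm _ => ht; have t0 : 0 <= t by exact: nm_ge0.
apply: (@le_trans _ _ ((nm d2 + 1) * t)); first by rewrite ler_wpM2r // lerDl.
by rewrite mulrC -ler_pdivlMr // mulrAC.
Qed.

Lemma sder_eq f1 f2 z d (r : R) : 0 < r -> (forall x, nm (x - z) < r -> f1 x = f2 x) ->
  sder f1 z d -> sder f2 z d.
Proof.
move=> r0 E H e e0; have [q q0 Hq] := H _ e0; exists (Num.min r q); first by rewrite lt_min r0.
move=> x y; rewrite !lt_min => /andP[x1 x2] /andP[y1 y2]; rewrite -!E //; exact: Hq.
Qed.

Lemma sderZ c f z d : sder f z d -> sder (fun x => c * f x) z (c * d).
Proof.
move=> H; have := sderM (sder_cst c z) H; rewrite mul0r add0r; exact.
Qed.

Lemma sderB f1 f2 z d1 d2 : sder f1 z d1 -> sder f2 z d2 ->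
  sder (fun x => f1 x - f2 x) z (d1 - d2).
Proof.
move=> H1 H2; have := sderD H1 (sderZ (-1) H2); rewrite mulN1r.
by under [X in sder X _ _]eq_fun do rewrite mulN1r.
Qed.

End StrictDerivative.

(** * Mean value inequality for right derivatives *)

Section ZeroDerivative.
Variable R : realType.

(** Let [m] be the supremum of the parameters up to which the estimate holds with constant [B + e].
    By continuity the estimate holds up to [m], and the right derivative at [m] carries it further
    unless [m = 1]. Right increments are the ones that monogenic functions provide. *)
Lemma right_mean_value (J : R -> R[i]) (B : R) : 0 <= B ->
  (forall s, 0 <= s <= 1 -> forall e : R, 0 < e -> exists2 r, 0 < r &
     forall t, 0 <= t <= 1 -> `|t - s| < r -> nm (J t - J s) <= e) ->
  (forall s, 0 <= s < 1 -> forall e : R, 0 < e -> exists2 r, 0 < r &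
     forall t, s <= t -> t < s + r -> t <= 1 -> nm (J t - J s) <= (B + e) * (t - s)) ->
  nm (J 1 - J 0) <= B.
Proof.
move=> B0 cJ dJ; apply/ler_addgt0Pr => e e0.
have Be : 0 <= B + e by rewrite addr_ge0 // ltW.
pose S := [set s : R | 0 <= s <= 1 /\ forall t, 0 <= t <= s -> nm (J t - J 0) <= (B + e) * t].
have S0 : S 0.
  split=> [|t]; first by rewrite lexx ler01.
  by move=> /le_anti <-; rewrite subrr nm0 mulr0.
have ubS : ubound S 1 by move=> s [/andP[]].
have hS : has_sup S by split; [exists 0|exists 1].
pose m := sup S.
have m0 : 0 <= m by apply: ub_le_sup => //; exists 1.
have m1 : m <= 1 by apply: ge_sup => //; exists 0.
have below t : 0 <= t -> t < m -> nm (J t - J 0) <= (B + e) * t.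
  move=> t0 tm; have [s [_ Hs] ts] := sup_gt (ex_intro _ 0 S0) tm.
  by apply: Hs; rewrite t0 ltW.
have Hm : nm (J m - J 0) <= (B + e) * m.
  have [->|mn0] := eqVneq m 0; first by rewrite subrr nm0 mulr0.
  have mp : 0 < m by rewrite lt_neqAle eq_sym mn0.
  apply/ler_addgt0Pr => d d0.
  have [r r0 Hr] := cJ m (introT andP (conj m0 m1)) d d0.
  pose t := Num.max 0 (m - r / 2).
  have t0 : 0 <= t by rewrite le_max lexx.
  have tm : t < m by rewrite gt_max mp; lra.
  have tr : `|t - m| < r.
    rewrite ltr_norml; apply/andP; split; last by lra.
    have : m - r / 2 <= t by rewrite le_max lexx orbT.
    lra.
  have A := below t t0 tm.
  have C := Hr t; rewrite t0 (le_trans (ltW tm) m1) nmB in C; have {}C := C isT tr.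
  rewrite (le_trans (nm_triangle (J t) _ _)) // addrC lerD // (le_trans A) // ler_wpM2l // ltW //.
have Sm : S m.
  split=> [|t /andP[t0]]; first by rewrite m0 m1.
  rewrite le_eqVlt => /orP[/eqP -> //|]; exact: below.
suff : m = 1 by move=> m1E; rewrite m1E mulr1 in Hm.
apply/eqP; rewrite eq_le m1 leNgt; apply/negP => mlt1.
have [r r0 Hr] := dJ m (introT andP (conj m0 mlt1)) e e0.
pose q := Num.min 1 (m + r / 2).
have mq : m < q by rewrite lt_min mlt1; lra.
have qr : q < m + r by rewrite gt_min; apply/orP; right; lra.
have q1 : q <= 1 by rewrite ge_min lexx.
have : q <= m; last by rewrite leNgt mq.
apply: ub_le_sup; first by exists 1.
split=> [|t /andP[t0 tq]]; first by rewrite q1 (le_trans m0 (ltW mq)).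
have [tm|mt] := leP t m; first by apply: Sm.2; rewrite t0.
rewrite (le_trans (nm_triangle (J m) _ _)) //.
have -> : (B + e) * t = (B + e) * (t - m) + (B + e) * m by ring.
apply: lerD => //; apply: Hr; first exact: ltW.
  exact: le_lt_trans tq qr.
exact: le_trans tq q1.
Qed.

Lemma right_derivative0_cst (J : R -> R[i]) :
  (forall s, 0 <= s <= 1 -> forall e : R, 0 < e -> exists2 r, 0 < r &
     forall t, 0 <= t <= 1 -> `|t - s| < r -> nm (J t - J s) <= e) ->
  (forall s, 0 <= s < 1 -> forall e : R, 0 < e -> exists2 r, 0 < r &
     forall t, s <= t -> t < s + r -> t <= 1 -> nm (J t - J s) <= e * (t - s)) ->
  J 1 = J 0.
Proof.
move=> cJ dJ; apply/eqP; rewrite -subr_eq0 -nm_eq0 eq_le nm_ge0 andbT.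
apply: right_mean_value => // s s1 e e0; have [r r0 Hr] := dJ s s1 e e0.
by exists r => // t *; rewrite add0r; exact: Hr.
Qed.

End ZeroDerivative.

(** * Integrals along curves: primitives, continuity, exchange of order *)

Section Curves.
Variable R : realType.
Implicit Types (g : R -> R[i]) (f : R[i] -> R[i]) (v : R -> R).

Definition curve g v := (forall e : R, 0 < e -> exists2 d, 0 < d &
   forall s t, 0 <= s <= 1 -> 0 <= t <= 1 -> `|s - t| < d -> nm (g s - g t) <= e) /\
  dominated g v.

(** Continuity relative to the trace suits densities, whose values off the curve do not enter the
    integrals. *)
Definition cont_trace g f := forall t, 0 <= t <= 1 -> forall e : R, 0 < e ->
  exists2 d : R, 0 < d & forall s, 0 <= s <= 1 -> nm (g s - g t) < d ->
    nm (f (g s) - f (g t)) <= e.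

Lemma cont_trace_unif g v f : curve g v -> cont_trace g f ->
  forall e : R, 0 < e -> exists2 d, 0 < d & forall s t, 0 <= s <= 1 -> 0 <= t <= 1 ->
    `|s - t| < d -> nm (f (g s) - f (g t)) <= e.
Proof.
move=> [cg gv] cf e e0.
have [t t01|d d' t dd H s s01 st|r r0 Hr] := @segment_uniform R 0 1
  (fun d t => forall s, 0 <= s <= 1 -> `|s - t| < d -> nm (f (g s) - f (g t)) <= e).
- have e20 : 0 < e / 2 by rewrite divr_gt0.
  have [d d0 Hd] := cf t t01 _ e20.
  have d20 : 0 < d / 2 by rewrite divr_gt0.
  have [q q0 Hq] := cg _ d20.
  exists (q / 2); first by rewrite divr_gt0.
  have dd : d / 2 < d by lra.
  move=> y y01 yt s s01 sy.
  rewrite (le_trans (nm_triangle (f (g t)) _ _)) // [e]splitr lerD //.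
    apply: Hd => //; rewrite (le_lt_trans (Hq _ _ _ _ _)) //.
    by have := ler_distD y s t; lra.
  rewrite nmB; apply: Hd => //; rewrite (le_lt_trans (Hq _ _ _ _ _)) //; lra.
- by apply: H => //; apply: lt_le_trans dd.
by exists r => // s t s01 t01; apply: Hr.
Qed.

Lemma isintP g v f : curve g v -> cont_trace g f -> isint g f (contour_integral g f).
Proof.
move=> cg cf; have [L HL] := isint_exists cg.2 (cont_trace_unif cg cf).
by rewrite (isint_contour HL).
Qed.

Lemma cont_at_trace g f : (forall t, 0 <= t <= 1 -> cont_at f (g t)) -> cont_trace g f.
Proof.
move=> H t t01 e e0; have [r r0 Hr] := H t t01 e e0.
by exists r => // s _; exact: Hr.
Qed.

Lemma cont_traceM g f1 f2 : cont_trace g f1 -> cont_trace g f2 ->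
  cont_trace g (fun w => f1 w * f2 w).
Proof.
move=> H1 H2 t t01 e e0.
pose M := nm (f1 (g t)) + nm (f2 (g t)) + 1.
have M1 : 1 <= M by rewrite lerDr addr_ge0 ?nm_ge0.
have M0 : 0 < M by rewrite (lt_le_trans ltr01).
pose d := Num.min 1 (e / (3 * M)).
have d0 : 0 < d by rewrite lt_min ltr01 divr_gt0 // mulr_gt0.
have dM : d * M <= e / 3.
  have -> : e / 3 = e / (3 * M) * M by field; rewrite gt_eqF.
  by rewrite ler_pM2r // ge_min lexx orbT.
have d1 : d <= 1 by rewrite ge_min lexx.
have [r1 r10 Hr1] := H1 t t01 d d0; have [r2 r20 Hr2] := H2 t t01 d d0.
exists (Num.min r1 r2); first by rewrite lt_min r10.
move=> s s01; rewrite lt_min => /andP[s1 s2].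
have A1 := Hr1 s s01 s1; have A2 := Hr2 s s01 s2.
have -> : f1 (g s) * f2 (g s) - f1 (g t) * f2 (g t) =
  (f1 (g s) - f1 (g t)) * (f2 (g s) - f2 (g t)) +
  (f1 (g s) - f1 (g t)) * f2 (g t) + f1 (g t) * (f2 (g s) - f2 (g t)) by ring.
have n1 : nm (f1 (g t)) <= M by have := nm_ge0 (f2 (g t)); rewrite /M; lra.
have n2 : nm (f2 (g t)) <= M by have := nm_ge0 (f1 (g t)); rewrite /M; lra.
have -> : e = e / 3 + e / 3 + e / 3 by field.
apply: (le_trans (nmD _ _)); apply: lerD; first (apply: (le_trans (nmD _ _)); apply: lerD); rewrite nmM.
- rewrite (le_trans (ler_pM _ _ A1 A2)) ?nm_ge0 // (le_trans _ dM) // ler_wpM2l // ?(ltW d0) // (le_trans d1) //.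
- by rewrite (le_trans (ler_pM _ _ A1 n2)) ?nm_ge0.
- by rewrite (le_trans (ler_pM _ _ n1 A2)) ?nm_ge0 // mulrC.
Qed.

(** Near a point of the curve, strict differentiability compares increments of [P] with [f (g t)],
    and [sder_near] allows the tag to move; compactness makes this uniform, and [isint_primitive]
    sums it up. *)
Lemma isint_sder g v P f : curve g v -> (forall t, 0 <= t <= 1 -> sder P (g t) (f (g t))) ->
  isint g f (P (g 1) - P (g 0)).
Proof.
move=> [cg gv] H; apply: (@isint_primitive _ g f v (P \o g)) => // e e0.
have [t t01|d d' t dd K a b a01 b01 ta tb|r r0 Hr] := @segment_uniform R 0 1
  (fun d t => forall a b, 0 <= a <= 1 -> 0 <= b <= 1 -> `|a - t| < d -> `|b - t| < d ->
     nm (f (g t) * (g b - g a) - (P (g b) - P (g a))) <= e * nm (g b - g a)).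
- have e20 : 0 < e / 2 by rewrite divr_gt0.
  have [r r0 Hr] := H t t01 _ e20.
  have [p p0 Hp] := sder_near (H t t01) e20.
  pose d := Num.min r p / 2.
  have mp : 0 < Num.min r p by rewrite lt_min r0.
  have d0 : 0 < d by rewrite divr_gt0.
  have [dr dp] : d < r /\ d < p.
    have : d < Num.min r p by rewrite /d; lra.
    by rewrite lt_min => /andP[].
  have [q q0 Hq] := cg _ d0.
  exists (q / 2); first by rewrite divr_gt0.
  move=> y y01 yt a b a01 b01 ay By.
  have at' : nm (g a - g t) <= d by apply: Hq => //; have := ler_distD y a t; lra.
  have bt' : nm (g b - g t) <= d by apply: Hq => //; have := ler_distD y b t; lra.
  have yt' : nm (g y - g t) <= d by apply: Hq => //; lra.
  have -> : f (g y) * (g b - g a) - (P (g b) - P (g a)) = (f (g y) - f (g t)) * (g b - g a)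
    - (P (g b) - P (g a) - f (g t) * (g b - g a)) by ring.
  rewrite (le_trans (nmD _ _)) // nmN nmM [e]splitr mulrDl lerD //.
    by rewrite ler_wpM2r ?nm_ge0 //; apply: (Hp (g y)); [exact: le_lt_trans dp|exact: H].
  by apply: Hr; [exact: le_lt_trans at' dr|exact: le_lt_trans bt' dr].
- by apply: K => //; apply: lt_le_trans dd.
exists r => // a t b a0 at' tb b1 ba.
have t01 : 0 <= t <= 1 by rewrite (le_trans a0 at') (le_trans tb b1).
apply: le_trans (Hr t t01 a b _ _ _ _) _.
- by rewrite a0 (le_trans at' (le_trans tb b1)).
- by rewrite (le_trans a0 (le_trans at' tb)) b1.
- by rewrite ltr_norml; lra.
- by rewrite ltr_norml; lra.
rewrite ler_pM2l // (le_trans (gv a b a0 (le_trans at' tb) b1)) // lerDl; lra.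
Qed.

Lemma curve_variation_ge0 g v : dominated g v -> 0 <= v 1 - v 0.
Proof. by move=> gv; apply: le_trans (gv 0 1 _ _ _); rewrite ?nm_ge0. Qed.

Lemma isint_close g v f L (e d : R) P : 0 < d -> dominated g v ->
  (forall s t, 0 <= s <= 1 -> 0 <= t <= 1 -> `|s - t| < d + d -> nm (f (g s) - f (g t)) <= e) ->
  isint g f L -> tagged_partition P -> mesh_lt d P ->
  nm (stieltjes_sum g f P - L) <= e * (v 1 - v 0).
Proof.
move=> d0 gv fe HL tP mP; apply/ler_addgt0Pr => b b0.
have [c c0 Hc] := HL b b0.
have m0 : 0 < Num.min c d by rewrite lt_min c0.
have [Q tQ mQ] := exists_partition m0.
rewrite (le_trans (nm_triangle (stieltjes_sum g f Q) _ _)) // lerD //.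
  apply: (stieltjes_sum_close gv fe tP tQ mP) => i iQ.
  by have := mQ i iQ; rewrite lt_min => /andP[].
by apply: Hc => // i iQ; have := mQ i iQ; rewrite lt_min => /andP[].
Qed.

(** For finite sums the order is exchanged trivially. The double sum [D] differs from each iterated
    integral by an inner and an outer error, four in all, each at most [e / 4]; this fixes the
    tolerance [e / (4 * (U * V + 1))] for the kernel. *)
Lemma isint_fubini g v h u (K : R[i] -> R[i] -> R[i]) (A B : R[i] -> R[i]) L M :
  curve g v -> curve h u ->
  (forall e : R, 0 < e -> exists2 d, 0 < d & forall s s' t t',
     0 <= s <= 1 -> 0 <= s' <= 1 -> 0 <= t <= 1 -> 0 <= t' <= 1 ->
     `|s - s'| < d -> `|t - t'| < d -> nm (K (g s) (h t) - K (g s') (h t')) <= e) ->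
  (forall s, 0 <= s <= 1 -> isint h (K (g s)) (A (g s))) ->
  (forall t, 0 <= t <= 1 -> isint g (K ^~ (h t)) (B (h t))) ->
  isint g A L -> isint h B M -> L = M.
Proof.
move=> [cg gv] [ch hu] cK HA HB HL HM.
have V0 := curve_variation_ge0 gv; have U0 := curve_variation_ge0 hu.
set V := v 1 - v 0 in V0; set U := u 1 - u 0 in U0.
apply/eqP; rewrite -subr_eq0; apply/eqP; apply: nm_eqP => e e0.
have VU : 0 < 4 * (U * V + 1) by rewrite mulr_gt0 // ltr_wpDl // mulr_ge0.
have e40 : 0 < e / 4 by rewrite divr_gt0.
have [d d0 Hd] := cK _ (divr_gt0 e0 VU).
have d20 : 0 < d / 2 by rewrite divr_gt0.
have [p p0 Hp] := HL _ e40; have [q q0 Hq] := HM _ e40.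
have pd : 0 < Num.min p (d / 2) by rewrite lt_min p0.
have qd : 0 < Num.min q (d / 2) by rewrite lt_min q0.
have [P tP mP] := exists_partition pd; have [Q tQ mQ] := exists_partition qd.
have [mP1 mP2] : mesh_lt p P /\ mesh_lt (d / 2) P.
  by split=> i iP; have := mP i iP; rewrite lt_min => /andP[].
have [mQ1 mQ2] : mesh_lt q Q /\ mesh_lt (d / 2) Q.
  by split=> i iQ; have := mQ i iQ; rewrite lt_min => /andP[].
have inner1 s : 0 <= s <= 1 ->
    nm (stieltjes_sum h (K (g s)) Q - A (g s)) <= e / (4 * (U * V + 1)) * U.
  move=> s01; apply: (@isint_close h u _ _ _ (d / 2) _ d20 hu _ (HA s s01) tQ mQ2).
  by move=> t t' t0 t1 tt; apply: Hd => //; [rewrite subrr normr0|rewrite [d]splitr].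
have inner2 t : 0 <= t <= 1 ->
    nm (stieltjes_sum g (K ^~ (h t)) P - B (h t)) <= e / (4 * (U * V + 1)) * V.
  move=> t01; apply: (@isint_close g v _ _ _ (d / 2) _ d20 gv _ (HB t t01) tP mP2).
  by move=> s s' t0 t1 tt; apply: Hd => //; [rewrite [d]splitr|rewrite subrr normr0].
have small : e / (4 * (U * V + 1)) * U * V <= e / 4.
  have UV1 : 0 < U * V + 1 by rewrite ltr_wpDl // mulr_ge0.
  have -> : e / (4 * (U * V + 1)) * U * V = e / 4 * (U * V / (U * V + 1)).
    by field; rewrite gt_eqF.
  by rewrite ler_piMr ?(ltW e40) // ler_pdivrMr // mul1r lerDl.
pose D := stieltjes_sum g (fun z => stieltjes_sum h (K z) Q) P.
have DE : D = stieltjes_sum h (fun w => stieltjes_sum g (K ^~ w) P) Q.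
  rewrite /D /stieltjes_sum; under eq_bigr do rewrite big_distrl /=.
  rewrite exchange_big /=; apply: eq_bigr => j _; rewrite big_distrl /=.
  by apply: eq_bigr => i _; rewrite mulrAC.
have sub (k : R -> R[i]) (f1 f2 : R[i] -> R[i]) X : stieltjes_sum k f1 X - stieltjes_sum k f2 X =
    stieltjes_sum k (fun z => f1 z - f2 z) X.
  by rewrite -sumrB; apply: eq_bigr => i _; rewrite mulrBl.
have D1 : nm (D - stieltjes_sum g A P) <= e / 4.
  rewrite /D sub (le_trans (stieltjes_sum_le gv tP inner1)) // -/V; lra.
have D2 : nm (D - stieltjes_sum h B Q) <= e / 4.
  rewrite DE sub (le_trans (stieltjes_sum_le hu tQ inner2)) // -/U mulrAC; lra.
have E1 := Hp P tP mP1; have E2 := Hq Q tQ mQ1.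
have -> : L - M = (D - stieltjes_sum h B Q) + (stieltjes_sum h B Q - M)
   - ((D - stieltjes_sum g A P) + (stieltjes_sum g A P - L)) by ring.
rewrite (le_trans (nmD _ _)) // nmN.
have := nmD (D - stieltjes_sum h B Q) (stieltjes_sum h B Q - M).
have := nmD (D - stieltjes_sum g A P) (stieltjes_sum g A P - L).
lra.
Qed.

End Curves.

(** * Cauchy transforms and winding numbers *)

Section CauchyTransform.
Variable R : realType.
Implicit Types (g : R -> R[i]) (f rho : R[i] -> R[i]) (v : R -> R).

(** With [rho = 1] and [k = 1] this is [twopii] times the winding number of [g] about [z]; raising
    [k] amounts to differentiation in [z], up to a factor. *)
Definition cauchy_transform g rho k (z : R[i]) : R[i] :=
  contour_integral g (fun w => rho w * (w - z)^-1 ^+ k).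

(** Meant for [a = (w - y)^-1], [b = (w - x)^-1] and [h = y - x]: first and second order Taylor
    estimates of the kernel, uniform in [w]. The crude factor [k ^ 2] survives the induction because
    [k ^ 2 + k.+1 <= k.+1 ^ 2]. *)
Lemma powV_estimates (a b h : R[i]) (A : R) k : 0 <= A ->
  nm a <= A -> nm b <= A -> a - b = h * a * b ->
  nm (a ^+ k - b ^+ k) <= k%:R * A ^+ k.+1 * nm h /\
  nm (a ^+ k - b ^+ k - k%:R * b ^+ k.+1 * h) <= (k ^ 2)%:R * A ^+ k.+2 * nm h ^+ 2.
Proof.
move=> A0 aA bA ab.
have Xb n (c : R[i]) : nm c <= A -> nm (c ^+ n) <= A ^+ n.
  by move=> cA; rewrite nmX lerXn2r ?nnegrE ?nm_ge0.
elim: k => [|k [IH1 IH2]]; first by rewrite !expr0 subrr !mul0r subr0 nm0.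
have An n : 0 <= A ^+ n by rewrite exprn_ge0.
have h0 := nm_ge0 h.
have hab : nm (a - b) <= A ^+ 2 * nm h.
  rewrite ab !nmM expr2 -mulrA mulrC ler_wpM2r // ler_pM ?nm_ge0 //.
split.
  have -> : a ^+ k.+1 - b ^+ k.+1 = a * (a ^+ k - b ^+ k) + (a - b) * b ^+ k by rewrite !exprS; ring.
  rewrite (le_trans (nmD _ _)) // !nmM.
  have -> : k.+1%:R * A ^+ k.+2 * nm h = A * (k%:R * A ^+ k.+1 * nm h) + A ^+ 2 * nm h * A ^+ k.
    by rewrite -natr1 !exprS; ring.
  rewrite lerD // ler_pM ?nm_ge0 //; exact: Xb.
have -> : a ^+ k.+1 - b ^+ k.+1 - k.+1%:R * b ^+ k.+2 * h =
   a * (a ^+ k - b ^+ k - k%:R * b ^+ k.+1 * h) + k.+1%:R * (h ^+ 2 * (a * b ^+ k.+2)).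
  have -> : a ^+ k.+1 - b ^+ k.+1 - k.+1%:R * b ^+ k.+2 * h =
     a * (a ^+ k - b ^+ k - k%:R * b ^+ k.+1 * h) + k.+1%:R * (h ^+ 2 * (a * b ^+ k.+2))
     + (b ^+ k + k.+1%:R * h * b ^+ k.+1) * (a - b - h * a * b).
    by rewrite -natr1 !exprS; ring.
  by rewrite ab subrr mulr0 addr0.
rewrite (le_trans (nmD _ _)) // (nmM a (_ - _)) (nmM k.+1%:R) nm_nat (nmM (h ^+ 2)) nmX (nmM a).
apply: (@le_trans _ _ (A * ((k ^ 2)%:R * A ^+ k.+2 * nm h ^+ 2) +
   k.+1%:R * (nm h ^+ 2 * (A * A ^+ k.+2)))).
  apply: lerD; first by rewrite ler_pM ?nm_ge0.
  by rewrite ler_wpM2l // ler_wpM2l ?exprn_ge0 // ler_pM ?nm_ge0 //; exact: Xb.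
have -> : A * ((k ^ 2)%:R * A ^+ k.+2 * nm h ^+ 2) + k.+1%:R * (nm h ^+ 2 * (A * A ^+ k.+2)) =
  (k ^ 2 + k.+1)%:R * (A ^+ k.+3 * nm h ^+ 2) by rewrite natrD !exprS; ring.
rewrite -[leRHS]mulrA ler_wpM2r ?ler_nat; [by []|by rewrite mulr_ge0 ?exprn_ge0|by lia].
Qed.

Lemma trace_dist g v z : curve g v -> (forall t, 0 <= t <= 1 -> g t != z) ->
  exists2 d : R, 0 < d & forall t, 0 <= t <= 1 -> d <= nm (g t - z).
Proof.
move=> [cg _] gz.
have [t t01|d d' t dd|r r0 Hr] := @segment_uniform R 0 1 (fun d t => d <= nm (g t - z)).
- have n0 : 0 < nm (g t - z) / 2 by rewrite divr_gt0 // nm_gt0 subr_eq0 gz.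
  have [d d0 Hd] := cg _ n0.
  exists (Num.min d (nm (g t - z) / 2)); first by rewrite lt_min d0.
  move=> s s01; rewrite lt_min => /andP[sd _].
  have := Hd s t s01 t01 sd; have := nm_triangle (g s) (g t) z.
  rewrite (nmB (g t) (g s)) => A B; rewrite ge_min; apply/orP; right; lra.
- exact: le_trans.
by exists r.
Qed.

Lemma trace_bounded g v f : curve g v -> cont_trace g f ->
  exists2 M : R, 0 < M & forall t, 0 <= t <= 1 -> nm (f (g t)) <= M.
Proof.
move=> cg cf; have cu := cont_trace_unif cg cf.
(* [segment_uniform] provides a small radius, whereas a large bound is wanted; the bound is
   therefore encoded as the inverse of the radius. *)
have [t t01|d d' t dd H s s0|r r0 Hr] := @segment_uniform R 0 1 (fun d t => forall s, 0 < s -> s <= d -> nm (f (g t)) <= s^-1).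
- have [d d0 Hd] := cu 1 ltr01.
  have n0 : 0 < nm (f (g t)) + 1 by rewrite ltr_wpDl ?nm_ge0.
  exists (Num.min d (nm (f (g t)) + 1)^-1); first by rewrite lt_min d0 invr_gt0.
  move=> s s01; rewrite lt_min => /andP[sd _] x x0; rewrite le_min => /andP[_ xx].
  have := Hd s t s01 t01 sd; have := nm_triangle (f (g t)) (f (g s)) 0.
  rewrite !subr0 => A B.
  apply: (@le_trans _ _ (nm (f (g t)) + 1)); first lra.
  by rewrite -[leLHS]invrK lef_pV2 ?posrE ?invr_gt0.
- by move=> sd; apply: H => //; exact: le_trans dd.
exists r^-1; first by rewrite invr_gt0.
by move=> t t01; apply: Hr.
Qed.

Lemma cont_trace_kernel g k z : (forall t, 0 <= t <= 1 -> g t != z) ->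
  cont_trace g (fun w => (w - z)^-1 ^+ k).
Proof.
move=> gz; elim: k => [|k IH].
  by move=> t _ e e0; exists 1 => // s _ _; rewrite !expr0 subrr nm0 ltW.
have -> : (fun w : R[i] => (w - z)^-1 ^+ k.+1) = (fun w => (w - z)^-1 * (w - z)^-1 ^+ k).
  by apply/funext => w; rewrite exprS.
apply: cont_traceM IH; apply: cont_at_trace => t t01.
apply: sder_cont; apply: (@sder_comp _ (fun w => w - z) (fun w => w^-1)).
  exact: sderB (sder_id _) (sder_cst _ _).
by apply: sderV; rewrite subr_eq0 gz.
Qed.

Lemma isint_cauchy_transform g v rho k z : curve g v -> cont_trace g rho ->
  (forall t, 0 <= t <= 1 -> g t != z) ->
  isint g (fun w => rho w * (w - z)^-1 ^+ k) (cauchy_transform g rho k z).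
Proof. by move=> cg cr gz; apply: (isintP cg); apply: cont_traceM => //; exact: cont_trace_kernel. Qed.

(** Differentiation under the integral sign. The second order estimate at a variable base point [x],
    with the Lipschitz continuity of the next transform, gives the strict derivative at [z] and not
    merely the ordinary one. *)
Lemma cauchy_transform_sder g v rho k z : curve g v -> cont_trace g rho ->
  (forall t, 0 <= t <= 1 -> g t != z) ->
  sder (cauchy_transform g rho k) z (k%:R * cauchy_transform g rho k.+1 z).
Proof.
move=> cg cr gz.
have [d d0 Hd] := trace_dist cg gz.
have [M M0 HM] := trace_bounded cg cr.
(* Points within [d / 2] of [z] keep at least the distance [d / 2] from the trace, so [A] bounds the
   kernel for all of them. *)
pose A : R := 2 / d.
have A0 : 0 < A by rewrite divr_gt0.
have far x : nm (x - z) < d / 2 -> forall t, 0 <= t <= 1 -> d / 2 <= nm (g t - x).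
  move=> xz t t01; have := Hd t t01; have := nm_triangle x (g t) z; lra.
have farn x : nm (x - z) < d / 2 -> forall t, 0 <= t <= 1 -> g t != x.
  by move=> xz t t01; rewrite -subr_eq0 -nm_gt0 (lt_le_trans _ (far x xz t t01)) // divr_gt0.
have inv_le x t : nm (x - z) < d / 2 -> 0 <= t <= 1 -> nm (g t - x)^-1 <= A.
  move=> xz t01; have f := far x xz t t01.
  rewrite nmV -[A]invrK lef_pV2 ?posrE ?invr_gt0 //; first by rewrite /A invf_div.
  by rewrite nm_gt0 subr_eq0 farn.
have diffk x y t : nm (x - z) < d / 2 -> nm (y - z) < d / 2 -> 0 <= t <= 1 ->
   (g t - y)^-1 - (g t - x)^-1 = (y - x) * (g t - y)^-1 * (g t - x)^-1.
  move=> xz yz t01; field.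
  by rewrite !subr_eq0 (farn x) // (farn y).
have zz : nm (z - z) < d / 2 by rewrite subrr nm0 divr_gt0.
have V0 := curve_variation_ge0 cg.2; set V := v 1 - v 0 in V0.
have est1 n x : nm (x - z) < d / 2 ->
   nm (cauchy_transform g rho n x - cauchy_transform g rho n z) <=
   M * (n%:R * A ^+ n.+1 * nm (x - z)) * V.
  move=> xz.
  have I1 := isint_cauchy_transform n cg cr (farn x xz).
  have I2 := isint_cauchy_transform n cg cr (farn z zz).
  have := isintD I1 (isintZ (-1) I2); rewrite mulN1r => I.
  apply: (isint_le cg.2 I) => t t01.
  rewrite mulN1r -mulrBr nmM ler_pM ?nm_ge0 ?HM //.
  by have [] := @powV_estimates _ _ (x - z) A n (ltW A0) (inv_le x t xz t01) (inv_le z t zz t01) (diffk _ _ _ zz xz t01).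
have est2 n x y : nm (x - z) < d / 2 -> nm (y - z) < d / 2 ->
   nm (cauchy_transform g rho n y - cauchy_transform g rho n x
       - n%:R * cauchy_transform g rho n.+1 x * (y - x)) <=
   M * ((n ^ 2)%:R * A ^+ n.+2 * nm (y - x) ^+ 2) * V.
  move=> xz yz.
  have I1 := isint_cauchy_transform n cg cr (farn y yz).
  have I2 := isint_cauchy_transform n cg cr (farn x xz).
  have I3 := isint_cauchy_transform n.+1 cg cr (farn x xz).
  have := isintD (isintD I1 (isintZ (-1) I2)) (isintZ (- (n%:R * (y - x))) I3) => I.
  have alg (p q r s c : R[i]) : p - q - s * r * c = p + -1 * q + - (s * c) * r by ring.
  rewrite alg.
  apply: (isint_le cg.2 I) => t t01.
  have [_] := @powV_estimates _ _ (y - x) A n (ltW A0) (inv_le y t yz t01) (inv_le x t xz t01) (diffk _ _ _ xz yz t01).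
  set a := (g t - y)^-1; set b := (g t - x)^-1 => E.
  have -> : rho (g t) * a ^+ n + -1 * (rho (g t) * b ^+ n) + - (n%:R * (y - x)) * (rho (g t) * b ^+ n.+1)
    = rho (g t) * (a ^+ n - b ^+ n - n%:R * b ^+ n.+1 * (y - x)) by ring.
  by rewrite nmM ler_pM ?nm_ge0 ?HM.
move=> e e0.
pose C1 := M * ((k ^ 2)%:R * A ^+ k.+2) * V.
pose C2 := k%:R * (M * (k.+1%:R * A ^+ k.+2) * V).
have C10 : 0 <= C1 by apply: mulr_ge0 => //; apply: mulr_ge0; [exact: ltW|rewrite mulr_ge0 ?exprn_ge0 // ltW].
have C20 : 0 <= C2.
  by apply: mulr_ge0 => //; apply: mulr_ge0 => //; apply: mulr_ge0; [exact: ltW|rewrite mulr_ge0 ?exprn_ge0 // ltW].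
have C0 : 0 < C1 + C1 + C2 + 1 by rewrite ltr_wpDl // !addr_ge0.
exists (Num.min (d / 2) (e / (C1 + C1 + C2 + 1))); first by rewrite lt_min !divr_gt0.
move=> x y; rewrite !lt_min => /andP[x1 x2] /andP[y1 y2].
have alg (p q r s t c : R[i]) : p - q - s * r * c = (p - q - s * t * c) + s * (t - r) * c by ring.
rewrite (alg _ _ _ _ (cauchy_transform g rho k.+1 x)).
rewrite (le_trans (nmD _ _)) // !nmM nm_nat.
have h0 := nm_ge0 (y - x); set h := nm (y - x) in h0 *.
have hx : h <= nm (x - z) + nm (y - z).
  by rewrite /h (le_trans (nm_triangle z y x)) // addrC (nmB z).
apply: (@le_trans _ _ (C1 * (h * h) + C2 * nm (x - z) * h)).
  apply: lerD.
    apply: (le_trans (est2 k x y x1 y1)); rewrite -/h /C1 expr2.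
    by rewrite le_eqVlt; apply/orP; left; apply/eqP; ring.
  rewrite ler_wpM2r // /C2 -[leRHS]mulrA ler_wpM2l //.
  apply: (le_trans (est1 _ _ x1)).
  by rewrite le_eqVlt; apply/orP; left; apply/eqP; ring.
rewrite mulrA -mulrDl ler_wpM2r //.
set q := e / _ in x2 y2.
have q0 : 0 < q by rewrite divr_gt0.
have -> : e = (C1 + C1 + C2 + 1) * q by rewrite /q mulrC divfK // gt_eqF.
have hq : h <= q + q by lra.
apply: (@le_trans _ _ (C1 * (q + q) + C2 * q)); last first.
  rewrite -subr_ge0; have -> : (C1 + C1 + C2 + 1) * q - (C1 * (q + q) + C2 * q) = q by ring.
  exact: ltW.
by apply: lerD; rewrite ler_wpM2l // ltW.
Qed.

Lemma isint_sder_closed g v P f : curve g v -> g 0 = g 1 ->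
  (forall t, 0 <= t <= 1 -> sder P (g t) (f (g t))) -> isint g f 0.
Proof. by move=> cg g01 H; have := isint_sder cg H; rewrite g01 subrr. Qed.

Lemma derivative0_cst (J : R -> R[i]) :
  (forall s, 0 <= s <= 1 -> forall e : R, 0 < e -> exists2 r, 0 < r &
     forall t, 0 <= t <= 1 -> `|t - s| < r -> nm (J t - J s) <= e * `|t - s|) ->
  J 1 = J 0.
Proof.
move=> H; apply: right_derivative0_cst => s.
  move=> s01 e e0; have [r r0 Hr] := H s s01 e e0.
  exists (Num.min r 1); first by rewrite lt_min r0 ltr01.
  move=> t t01; rewrite lt_min => /andP[tr t1].
  by rewrite (le_trans (Hr t t01 tr)) // ler_piMr // ltW.
move=> /andP[s0 s1] e e0; have [r r0 Hr] := H s (introT andP (conj s0 (ltW s1))) e e0.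
exists r => // t st tr t1.
have ts : `|t - s| = t - s by rewrite ger0_norm // subr_ge0.
rewrite -ts; apply: Hr; first by rewrite (le_trans s0 st).
by rewrite ts; lra.
Qed.

(** The derivative in the centre is the integral of [(w - z)^-1 ^+ 2], which has the primitive
    [- (w - z)^-1] along the closed curve and so vanishes. *)
Lemma winding_segment g v (p q : R[i]) : curve g v -> g 0 = g 1 ->
  (forall s t : R, 0 <= s <= 1 -> 0 <= t <= 1 -> g t != p + s%:C * (q - p)) ->
  cauchy_transform g (fun=> 1) 1 q = cauchy_transform g (fun=> 1) 1 p.
Proof.
move=> cg g01 off.
have c1 : cont_trace g (fun=> 1) by move=> t _ e e0; exists 1 => // s _ _; rewrite subrr nm0 ltW.
have := @derivative0_cst (fun s => cauchy_transform g (fun=> 1) 1 (p + s%:C * (q - p))).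
rewrite (_ : p + 1%:C * (q - p) = q); last by rewrite rmorph1; ring.
rewrite (_ : p + 0%:C * (q - p) = p); last by rewrite rmorph0; ring.
apply => s s01 e e0.
set z := p + _.
have offz t : 0 <= t <= 1 -> g t != z by move=> t01; exact: off.
have D := cauchy_transform_sder 1 cg c1 offz.
have C2 : cauchy_transform g (fun=> 1) 2 z = 0.
  apply: isint_contour; apply: (@isint_sder_closed _ _ (fun w => - (w - z)^-1) _ cg g01) => t t01.
  have := @sder_comp _ (fun w => w - z) (fun w => w^-1) (g t) _ _ (sderB (sder_id _) (sder_cst _ _)) (sderV _).
  rewrite subr_eq0 => /(_ (offz t t01)) /(sderZ (-1)).
  rewrite mul1r subr0 mulr1 mulN1r opprK exprVn.
  by under [X in sder X _ _]eq_fun do rewrite mulN1r.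
rewrite C2 mulr0 in D.
have n0 : 0 < nm (q - p) + 1 by rewrite ltr_wpDl ?nm_ge0.
have [r r0 Hr] := D _ (divr_gt0 e0 n0).
exists (r / (nm (q - p) + 1)); first by rewrite divr_gt0.
move=> t t01 ts.
have dz : nm (p + t%:C * (q - p) - z) = `|t - s| * nm (q - p).
  by rewrite /z (_ : _ - _ = (t - s)%:C * (q - p)) ?nmM ?nm_real // rmorphB /=; ring.
have := Hr z (p + t%:C * (q - p)); rewrite subrr nm0 mul0r subr0 dz => /(_ r0).
rewrite ltr_pdivlMr // in ts.
have lt1 : `|t - s| * nm (q - p) < r.
  by apply: le_lt_trans ts; rewrite ler_wpM2l // lerDl.
move=> /(_ lt1) H; rewrite (le_trans H) //.
have -> : e / (nm (q - p) + 1) * (`|t - s| * nm (q - p)) =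
  e * `|t - s| * (nm (q - p) / (nm (q - p) + 1)) by field; rewrite gt_eqF.
rewrite ler_piMr ?mulr_ge0 ?(ltW e0) // ler_pdivrMr // mul1r lerDl //.
Qed.

End CauchyTransform.

(** * Circles and Cauchy's formula for a disc *)

Section Circle.
Variable R : realType.

Definition cis (x : R) : R[i] := cos x +i* sin x.

Lemma cisD x y : cis (x + y) = cis x * cis y.
Proof. by rewrite /cis cosD sinD; apply/eqP; rewrite eq_complex /= eqxx /= addrC. Qed.

Lemma cis0 : cis 0 = 1. Proof. by rewrite /cis cos0 sin0. Qed.

Lemma nm_cis x : nm (cis x) = 1.
Proof. by rewrite /nm normc_def /= cos2Dsin2 sqrtr1. Qed.

Lemma cis_neq0 x : cis x != 0.
Proof. by rewrite -nm_gt0 nm_cis. Qed.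

Lemma lipschitz_of_derivative (f df : R -> R) : (forall x : R, is_derive x (1 : R) f (df x)) ->
  (forall x, `|df x| <= 1) -> forall x y, `|f x - f y| <= `|x - y|.
Proof.
move=> D b x y.
wlog xy : x y / x <= y.
  by move=> H; have [/H //|/ltW /H] := leP x y; rewrite distrC => /le_trans; apply; rewrite distrC.
have [|c _ E] := @MVT_segment R f df x y xy (fun z _ => D z).
  apply: continuous_subspaceT => z; apply: differentiable_continuous.
  by apply/derivable1_diffP; have [] := D z.
by rewrite distrC E normrM distrC ler_piMl.
Qed.

Lemma cis_lipschitz x y : nm (cis x - cis y) <= 2 * `|x - y|.
Proof.
rewrite (le_trans (nm_le_ReIm _)) // /= mulr_natl mulr2n lerD //.
  apply: (@lipschitz_of_derivative _ (fun x => - sin x)) => z.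
  by rewrite normrN ler_norml sin_geN1 sin_le1.
apply: (@lipschitz_of_derivative _ cos) => z.
by rewrite ler_norml cos_geN1 cos_le1.
Qed.

Lemma cis_derivative0 (e : R) : 0 < e -> exists2 d, 0 < d &
  forall h, `|h| < d -> nm (cis h - 1 - 'i * h%:C) <= e * `|h|.
Proof.
move=> e0; have e20 : 0 < e / 2 by rewrite divr_gt0.
have D (f : R -> R) (a : R) : is_derive (0 : R) (1 : R) f a -> exists2 d, 0 < d &
    forall h, `|h| < d -> `|f h - f 0 - a * h| <= e / 2 * `|h|.
  move=> /is_derive1_caratheodory [k [fE /cvgrPdist_le /(_ _ e20) [d d0 Hd] k0]].
  exists d => // h hd; rewrite fE subr0 -mulrBl normrM ler_wpM2r // distrC.
  by rewrite -k0; apply: Hd; rewrite /= sub0r normrN.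
have [d1 d10 H1] := D cos _ (is_derive_cos 0); have [d2 d20 H2] := D sin _ (is_derive_sin 0).
exists (Num.min d1 d2); first by rewrite lt_min d10.
move=> h; rewrite lt_min => /andP[h1 h2].
have -> : cis h - 1 - 'i * h%:C = (cos h - 1) +i* (sin h - h).
  by apply/eqP; rewrite eq_complex /=; apply/andP; split; apply/eqP; ring.
rewrite (le_trans (nm_le_ReIm _)) //= [e]splitr mulrDl lerD //.
  by have := H1 h h1; rewrite cos0 sin0 oppr0 mul0r subr0.
by have := H2 h h2; rewrite cos0 sin0 mul1r subr0.
Qed.

Definition circle (c : R[i]) (r t : R) : R[i] := c + r%:C * cis (2 * pi * t).

Lemma circle_dist c r t : 0 < r -> nm (circle c r t - c) = r.
Proof. by move=> r0; rewrite /circle addrC addKr nmM nm_cis mulr1 nm_real gtr0_norm. Qed.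

Lemma circle_closed c r : circle c r 0 = circle c r 1.
Proof. by rewrite /circle mulr0 mulr1 cis0 /cis mulr_natl cos2pi -[in sin _](add0r (pi *+ 2)) sinD2pi sin0. Qed.

Lemma circle_lipschitz c r s t : 0 < r -> nm (circle c r s - circle c r t) <= 4 * pi * r * `|s - t|.
Proof.
move=> r0; have -> : circle c r s - circle c r t = r%:C * (cis (2 * pi * s) - cis (2 * pi * t)).
  by rewrite /circle; ring.
rewrite nmM nm_real gtr0_norm //.
have := cis_lipschitz (2 * pi * s) (2 * pi * t).
rewrite -mulrBr normrM (gtr0_norm (_ : 0 < 2 * pi)) ?mulr_gt0 ?pi_gt0 // => H.
rewrite (le_trans (ler_wpM2l (ltW r0) H)) //.
by rewrite le_eqVlt; apply/orP; left; apply/eqP; ring.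
Qed.

(** The constant is twice the true length, since [cis_lipschitz] adds the bounds for cosine and
    sine. *)
Lemma circle_curve c r : 0 < r -> curve (circle c r) (fun t => 4 * pi * r * t).
Proof.
move=> r0; have C0 : 0 < 4 * pi * r by rewrite !mulr_gt0 // pi_gt0.
split=> [e e0|s t s0 st t1].
  exists (e / (4 * pi * r)); first by rewrite divr_gt0.
  move=> s t _ _ st; rewrite (le_trans (circle_lipschitz _ _ _ r0)) //.
  by rewrite mulrC -ler_pdivlMr // ltW.
by rewrite (le_trans (circle_lipschitz _ _ _ r0)) // -mulrBr ger0_norm // subr_ge0.
Qed.

Lemma circle_off c r z t : 0 < r -> nm (z - c) < r -> circle c r t != z.
Proof.
move=> r0 zr; apply/eqP => E; have := circle_dist c t r0.
by rewrite E => zc; rewrite zc ltxx in zr.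
Qed.

(** By the addition law the quotient of [g b - g a] by [g t - c] is [cis (2 * pi * (b - t)) - cis (2
    * pi * (a - t))], and the derivative of [cis] at 0 compares it with [twopii R] times [b - a]. *)
Lemma circle_winding_center c r : 0 < r ->
  isint (circle c r) (fun w => 1 * (w - c)^-1 ^+ 1) (twopii R).
Proof.
move=> r0; have [_ gv] := circle_curve c r0.
have p0 : 0 < 2 * pi :> R by rewrite mulr_gt0 // pi_gt0.
have := @isint_primitive R (circle c r) (fun w => 1 * (w - c)^-1 ^+ 1) _ (fun t => twopii R * t%:C) gv.
rewrite rmorph1 rmorph0 mulr1 mulr0 subr0; apply => e e0.
have [d d0 Hd] := cis_derivative0 (divr_gt0 e0 p0).
exists (d / (2 * pi)); first by rewrite divr_gt0.
move=> a t b a0 at' tb b1; rewrite ltr_pdivlMr // => ab.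
have rC : r%:C != 0 by rewrite -nm_gt0 nm_real normr_gt0 gt_eqF.
have -> : 1 * (circle c r t - c)^-1 ^+ 1 * (circle c r b - circle c r a) =
    cis (2 * pi * (b - t)) - cis (2 * pi * (a - t)).
  have E x : cis (2 * pi * x) = cis (2 * pi * (x - t)) * cis (2 * pi * t).
    by rewrite -cisD -mulrDr subrK.
  have -> : circle c r t - c = r%:C * cis (2 * pi * t) by rewrite /circle; ring.
  have -> : circle c r b - circle c r a = r%:C * (cis (2 * pi * b) - cis (2 * pi * a)).
    by rewrite /circle; ring.
  rewrite (E a) (E b) expr1.
  by field; rewrite rC cis_neq0.
have -> : cis (2 * pi * (b - t)) - cis (2 * pi * (a - t)) - (twopii R * b%:C - twopii R * a%:C) =
  (cis (2 * pi * (b - t)) - 1 - 'i * (2 * pi * (b - t))%:C) -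
  (cis (2 * pi * (a - t)) - 1 - 'i * (2 * pi * (a - t))%:C).
  have lin x : (2 * pi * (x - t))%:C = (2 * pi)%:C * (x%:C - t%:C) by rewrite rmorphM rmorphB.
  have alg (X Y P Q A B T : R[i]) : X - Y - (P * Q * B - P * Q * A) =
    (X - 1 - Q * (P * (B - T))) - (Y - 1 - Q * (P * (A - T))) by ring.
  by rewrite !lin; exact: alg.
have nb : `|2 * pi * (b - t)| = 2 * pi * (b - t).
  by rewrite ger0_norm // mulr_ge0 ?(ltW p0) // subr_ge0.
have na : `|2 * pi * (a - t)| = 2 * pi * (t - a).
  by rewrite normrM (gtr0_norm p0) distrC ger0_norm // subr_ge0.
have Hb : `|2 * pi * (b - t)| < d.
  rewrite nb (le_lt_trans _ ab) // mulrC ler_pM2r //; lra.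
have Ha : `|2 * pi * (a - t)| < d.
  rewrite na (le_lt_trans _ ab) // mulrC ler_pM2r //; lra.
rewrite (le_trans (nmD _ _)) // nmN (le_trans (lerD (Hd _ Hb) (Hd _ Ha))) // nb na.
have -> : e / (2 * pi) * (2 * pi * (b - t)) + e / (2 * pi) * (2 * pi * (t - a)) = e * (b - a).
  by rewrite -!mulrDr mulrA divfK ?gt_eqF //; congr (_ * _); ring.
rewrite ler_pM2l // lerDr -mulrBr mulr_ge0 ?mulr_ge0 ?(ltW r0) ?pi_ge0 //; lra.
Qed.

Lemma cont_trace_cst (g : R -> R[i]) (c : R[i]) : cont_trace g (fun=> c).
Proof. by move=> t _ e e0; exists 1 => // s _ _; rewrite subrr nm0 ltW. Qed.

Lemma twopii_neq0 : twopii R != 0.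
Proof.
rewrite -nm_gt0 /twopii nmM nmi mulr1 nm_real normr_gt0 gt_eqF // mulr_gt0 // pi_gt0 //.
Qed.

Lemma nm_segment_ball (c p q : R[i]) (r s : R) : nm (p - c) < r -> nm (q - c) < r -> 0 <= s <= 1 ->
  nm (p + s%:C * (q - p) - c) < r.
Proof.
move=> pr qr /andP[s0 s1].
have -> : p + s%:C * (q - p) - c = (1 - s)%:C * (p - c) + s%:C * (q - c).
  by rewrite rmorphB rmorph1; ring.
rewrite (le_lt_trans (nmD _ _)) // !nmM !nm_real !ger0_norm ?subr_ge0 //.
have [s00|sn] := eqVneq s 0; first by rewrite s00 subr0 mul1r mul0r addr0.
have sp : 0 < s by rewrite lt_neqAle eq_sym sn.
have -> : r = (1 - s) * r + s * r by ring.
by rewrite ler_ltD // ?ltr_pM2l // ler_wpM2l ?subr_ge0 // ltW.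
Qed.

Lemma circle_winding c r z : 0 < r -> nm (z - c) < r ->
  cauchy_transform (circle c r) (fun=> 1) 1 z = twopii R.
Proof.
move=> r0 zr; rewrite -(isint_contour (circle_winding_center c r0)).
apply: (winding_segment (circle_curve c r0) (circle_closed c r)) => s t s01 _.
by apply: circle_off => //; apply: nm_segment_ball => //; rewrite subrr nm0.
Qed.

(** The argument of [f] is contracted to [z] by [w -> z + s (w - z)]. For [s = 1] the integral is
    the transform of [f], for [s = 0] it is [f z] times that of 1. Its derivative in [s] is the
    integral of [f'] at the contracted point, which vanishes because that integrand has a primitive
    on the closed circle. *)
Lemma cauchy_formula_circle (f f' : R[i] -> R[i]) c (r q : R) z : 0 < r -> r < q ->
  (forall w, nm (w - c) < q -> sder f w (f' w)) -> nm (z - c) < r ->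
  cauchy_transform (circle c r) f 1 z = twopii R * f z.
Proof.
move=> r0 rq D zr; have cc := circle_curve c r0.
set g := circle c r in cc *; set v := (fun t => _) in cc.
have zq : nm (z - c) < q by exact: lt_trans rq.
have gq t : nm (g t - c) < q by rewrite circle_dist.
have off t : g t != z by exact: circle_off.
have ballq s t : 0 <= s <= 1 -> nm (z + s%:C * (g t - z) - c) < q.
  by move=> s01; apply: nm_segment_ball.
have Daff s t : 0 <= s <= 1 ->
    sder (fun w => f (z + s%:C * (w - z))) (g t) (f' (z + s%:C * (g t - z)) * s%:C).
  move=> s01; apply: (@sder_comp _ (fun w => z + s%:C * (w - z)) f); last exact/D/ballq.
  have := sderD (sder_cst z (g t)) (sderZ s%:C (sderB (sder_id (g t)) (sder_cst z (g t)))).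
  by rewrite subr0 mulr1 add0r.
pose k s w := f (z + s%:C * (w - z)) * (w - z)^-1 ^+ 1.
pose J s := contour_integral g (k s).
have IJ s : 0 <= s <= 1 -> isint g (k s) (J s).
  move=> s01; apply: (isintP cc); apply: cont_traceM.
    by apply: cont_at_trace => t _; apply: sder_cont (Daff s t s01).
  by apply: cont_trace_kernel => t _; exact: off.
have I0 s : 0 <= s <= 1 -> isint g (fun w => f' (z + s%:C * (w - z))) 0.
  (* The primitive [s^-1 f (z + s (w - z))] breaks down at [s = 0], where the integrand is
     constant. *)
  move=> s01; have [->|sn0] := eqVneq s 0.
    apply: (isint_sder_closed (P := fun w => f' z * w) cc (circle_closed c r)) => t _.
    by rewrite rmorph0 mul0r addr0 -[X in sder _ _ X]mulr1; exact: sderZ (sder_id _).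
  have sC : s%:C != 0 by rewrite -nm_gt0 nm_real normr_gt0.
  apply: (isint_sder_closed (P := fun w => s%:C^-1 * f (z + s%:C * (w - z))) cc (circle_closed c r)) => t _.
  have := sderZ (s%:C^-1) (Daff s t s01).
  by rewrite mulrCA mulVf // mulr1.
have V0 := curve_variation_ge0 cc.2; set V := v 1 - v 0 in V0.
have -> : cauchy_transform g f 1 z = J 1.
  congr contour_integral; apply/funext => w; rewrite /k rmorph1 mul1r; congr (f _ * _); ring.
have -> : twopii R * f z = J 0.
  rewrite -(circle_winding r0 zr) mulrC; apply: esym.
  apply: isint_contour; have := isintZ (f z) (isint_cauchy_transform 1 cc (@cont_trace_cst g 1) (fun t _ => off t)).
  by apply: eq_isint => t _; rewrite /k rmorph0 mul0r addr0 mul1r.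
apply: derivative0_cst => s s01 e e0.
have V1 : 0 < V + 1 by rewrite ltr_wpDl.
have e20 : 0 < e / (V + 1) / 2 by rewrite !divr_gt0.
have r20 : 0 < r + r by rewrite addr_gt0.
have gz t : nm (g t - z) < r + r.
  have := nm_triangle c (g t) z; rewrite circle_dist // (nmB c); lra.
have [||d d0 Hd] := @segment_uniform R 0 1 (fun d x => forall t, 0 <= t <= 1 -> `|t - s| < d ->
  nm (f (z + t%:C * (g x - z)) - f (z + s%:C * (g x - z)) - f' (z + s%:C * (g x - z)) * ((t - s)%:C * (g x - z)))
   <= e / (V + 1) * (`|t - s| * nm (g x - z))).
- move=> x x01; have Dx := D _ (ballq s x s01).
  have [a a0 Ha] := Dx _ e20; have [b b0 Hb] := sder_near Dx e20.
  pose m := Num.min a b.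
  have m0 : 0 < m by rewrite lt_min a0.
  have m20 : 0 < m / 2 by rewrite divr_gt0.
  have [y y0 Hy] := cc.1 _ m20.
  exists (Num.min y (m / 2 / (r + r))); first by rewrite lt_min y0 divr_gt0.
  move=> x' x'01; rewrite lt_min => /andP[x'x _] t t01; rewrite lt_min => /andP[_ ts].
  rewrite ltr_pdivlMr // in ts.
  have near1 : nm (z + s%:C * (g x' - z) - (z + s%:C * (g x - z))) <= m / 2.
    have -> : z + s%:C * (g x' - z) - (z + s%:C * (g x - z)) = s%:C * (g x' - g x) by ring.
    rewrite nmM nm_real; case/andP: (s01) => s0 s1; rewrite ger0_norm //.
    by rewrite (le_trans _ (Hy _ _ x'01 x01 x'x)) // ler_piMl ?nm_ge0.
  have step : z + t%:C * (g x' - z) - (z + s%:C * (g x' - z)) = (t - s)%:C * (g x' - z).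
    by rewrite rmorphB /=; ring.
  have near2 : nm (z + t%:C * (g x' - z) - (z + s%:C * (g x - z))) < m.
    rewrite (le_lt_trans (nm_triangle (z + s%:C * (g x' - z)) _ _)) // step nmM nm_real.
    have : `|t - s| * nm (g x' - z) < m / 2.
      by apply: le_lt_trans ts; rewrite ler_wpM2l // ltW.
    by move: near1; lra.
  have near1' : nm (z + s%:C * (g x' - z) - (z + s%:C * (g x - z))) < m by lra.
  rewrite -step.
  set X := z + s%:C * (g x' - z) in step near1' *.
  set X2 := z + t%:C * (g x' - z) in step near2 *.
  set X0 := z + s%:C * (g x - z) in near1' near2 Dx Ha Hb *.
  have -> : f X2 - f X - f' X * (X2 - X) = (f X2 - f X - f' X0 * (X2 - X)) - (f' X - f' X0) * (X2 - X) by ring.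
  rewrite (le_trans (nmD _ _)) // nmN [X in _ <= X * _]splitr [leRHS]mulrDl.
  have nX : nm (X2 - X) = `|t - s| * nm (g x' - z) by rewrite step nmM nm_real.
  move: near1' near2; rewrite !lt_min => /andP[n1 n2] /andP[n3 n4].
  rewrite lerD // -nX; first exact: Ha.
  rewrite nmM ler_wpM2r ?nm_ge0 //; apply: Hb n2 _ _.
  by apply: D; apply: ballq.
- by move=> d d' x dd H t t01 ts; apply: H => //; exact: lt_le_trans dd.
exists d => // t t01 ts.
have I := isintD (isintD (IJ t t01) (isintZ (-1) (IJ s s01))) (isintZ (- (t - s)%:C) (I0 s s01)).
have -> : J t - J s = J t + -1 * J s + - (t - s)%:C * 0 by rewrite mulr0 addr0 mulN1r.
apply: (@le_trans _ _ (e / (V + 1) * `|t - s| * V)).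
  apply: (isint_le cc.2 I) => x x01; rewrite /k !expr1.
  have nz : g x - z != 0 by rewrite subr_eq0.
  have nzp : 0 < nm (g x - z) by rewrite nm_gt0.
  have := Hd x x01 t t01 ts.
  set a := f _; set b := f _; set u := f' _ => H.
  have -> : a * (g x - z)^-1 + -1 * (b * (g x - z)^-1) + - (t - s)%:C * u =
     (a - b - u * ((t - s)%:C * (g x - z))) / (g x - z) by field.
  rewrite nmM nmV ler_pdivrMr //; apply: (le_trans H); rewrite mulrA //.
have -> : e / (V + 1) * `|t - s| * V = e * `|t - s| * (V / (V + 1)) by field; rewrite gt_eqF.
by rewrite ler_piMr ?mulr_ge0 ?(ltW e0) // ler_pdivrMr // mul1r lerDl.
Qed.

End Circle.

(** * Holomorphic functions and Taylor coefficients *)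

Section Holomorphic.
Variable R : realType.
Implicit Types (D : set R[i]) (f : R[i] -> R[i]) (g : R -> R[i]).

Definition hol D f := forall z, D z -> exists2 r : R, 0 < r &
  forall w, nm (w - z) < r -> exists d, sder f w d.

Definition derivative f z : R[i] := xget 0 [set d | sder f z d].

Lemma derivativeE f z d : sder f z d -> derivative f z = d.
Proof. by move=> H; rewrite /derivative; case: xgetP => [y _ /= Hy|/(_ d)]; [exact: sder_unique Hy H|]. Qed.

Lemma derivativeP f z d : sder f z d -> sder f z (derivative f z).
Proof. by move=> H; rewrite (derivativeE H). Qed.

Lemma hol_derivative D f z : hol D f -> D z -> sder f z (derivative f z).
Proof. by move=> H /H[r r0 Hr]; have [|d /derivativeP] := Hr z; rewrite ?subrr ?nm0. Qed.

(** A local Cauchy integral with an arbitrary density. Taylor coefficients and divided differences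
    are obtained from it by changing the exponent or the density alone. *)
Definition represents g rho z (d : R) f := [/\ 0 < d, cont_trace g rho,
  forall w t, nm (w - z) < d -> 0 <= t <= 1 -> g t != w &
  forall w, nm (w - z) < d -> f w = cauchy_transform g rho 1 w].

Lemma represents_sder g v rho z d f k : curve g v -> represents g rho z d f ->
  forall w, nm (w - z) < d ->
    sder (cauchy_transform g rho k) w (k%:R * cauchy_transform g rho k.+1 w).
Proof. by move=> cg [d0 cr off _] w wz; apply: (cauchy_transform_sder _ cg cr) => t t01; exact: off. Qed.

Lemma ball_inner (z w : R[i]) (r : R) : nm (w - z) < r ->
  0 < r - nm (w - z) /\ forall x, nm (x - w) < r - nm (w - z) -> nm (x - z) < r.
Proof.
move=> wz; split; first by rewrite subr_gt0.
by move=> x; have := nm_triangle w x z; lra.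
Qed.

Lemma represents_sder1 g v rho z d f : curve g v -> represents g rho z d f ->
  forall w, nm (w - z) < d -> sder f w (cauchy_transform g rho 2 w).
Proof.
move=> cg rep w wz; have [d0 cr off E] := rep.
have := represents_sder 1 cg rep wz; rewrite mul1r.
have [r0 Hr] := ball_inner wz.
by apply: (sder_eq r0) => x xw; rewrite E //; apply: Hr.
Qed.

(** Cauchy's formula on the circle of half the radius, with density [f] divided by [twopii R]. *)
Lemma sder_representable f z (r : R) : 0 < r ->
  (forall w, nm (w - z) < r -> exists d, sder f w d) ->
  exists g rho d, (exists v, curve g v) /\ represents g rho z d f.
Proof.
move=> r0 Hr.
have D w : nm (w - z) < r -> sder f w (derivative f w) by move=> /Hr [d /derivativeP].
pose q := r / 2.
have q0 : 0 < q by rewrite divr_gt0.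
have qr : q < r by rewrite /q; lra.
have cc := circle_curve z q0.
have off w t : nm (w - z) < q -> 0 <= t <= 1 -> circle z q t != w.
  by move=> wz _; exact: circle_off.
have cf : cont_trace (circle z q) f.
  by apply: cont_at_trace => t _; apply: sder_cont (D _ _); rewrite circle_dist.
exists (circle z q), (fun w => (twopii R)^-1 * f w), q; split; first by exists (fun t => 4 * pi * q * t).
split => //; first exact: cont_traceM (@cont_trace_cst _ _ _) cf.
move=> w wz; apply: esym; apply: isint_contour.
have := isintZ (twopii R)^-1 (isint_cauchy_transform 1 cc cf (fun t t01 => off w t wz t01)).
rewrite (cauchy_formula_circle q0 qr D wz) mulrA mulVf ?twopii_neq0 // mul1r.
by apply: eq_isint => t _; rewrite mulrA.
Qed.

Lemma hol_representable D f z : hol D f -> D z ->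
  exists g rho d, (exists v, curve g v) /\ represents g rho z d f.
Proof. by move=> H /H [r r0 Hr]; exact: sder_representable Hr. Qed.

Lemma sder_derivative_hol f z (r : R) : 0 < r ->
  (forall w, nm (w - z) < r -> exists d, sder f w d) ->
  exists2 q : R, 0 < q & forall w, nm (w - z) < q -> exists d, sder (derivative f) w d.
Proof.
move=> r0 Hr; have [g [rho [d [[v cg] rep]]]] := sder_representable r0 Hr.
exists d; first by case: rep.
move=> w wz; exists (2 * cauchy_transform g rho 3 w).
have [s0 Hs] := ball_inner wz.
apply: (sder_eq s0 _ (represents_sder 2 cg rep wz)) => x xw.
by rewrite (derivativeE (represents_sder1 cg rep (Hs x xw))).
Qed.

(** The passage from local primitives to holomorphy, as in Morera's theorem: near [z], [f] is the
    derivative of [P], and derivatives are again strictly differentiable by the integral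
    representation. *)
Lemma hol_of_primitive f P z (r : R) : 0 < r ->
  (forall w, nm (w - z) < r -> sder P w (f w)) ->
  exists2 q : R, 0 < q & forall w, nm (w - z) < q -> exists d, sder f w d.
Proof.
move=> r0 H.
have [|q q0 Hq] := @sder_derivative_hol P z r r0.
  by move=> w /H; exists (f w).
exists (Num.min q r); first by rewrite lt_min q0.
move=> w; rewrite lt_min => /andP[wq wr]; have [d Hd] := Hq w wq; exists d.
have [s0 Hs] := ball_inner wr.
apply: (sder_eq s0 _ Hd) => x xw.
by rewrite (derivativeE (H x (Hs x xw))).
Qed.

(* The [k]-th Taylor coefficient, as a function of the centre. *)
Fixpoint coefficient f k : R[i] -> R[i] :=
  if k is k'.+1 then fun z => (k'.+1%:R)^-1 * derivative (coefficient f k') z else f.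

Lemma represents_coefficient g v rho z d f : curve g v -> represents g rho z d f ->
  forall k w, nm (w - z) < d -> coefficient f k w = cauchy_transform g rho k.+1 w.
Proof.
move=> cg rep; have [d0 cr off E] := rep.
elim=> [|k IH] w wz /=; first exact: E.
have [s0 Hs] := ball_inner wz.
have := represents_sder k.+1 cg rep wz.
move=> /(sder_eq s0) => /(_ (coefficient f k)) H.
rewrite (derivativeE (H _)) ?mulrA ?mulVf ?mul1r ?pnatr_eq0 //.
by move=> x xw; rewrite IH //; apply: Hs.
Qed.

Lemma coefficient_sder D f k z : hol D f -> D z ->
  sder (coefficient f k) z (k.+1%:R * coefficient f k.+1 z).
Proof.
move=> hf Dz; have [g [rho [d [[v cg] rep]]]] := hol_representable hf Dz.
have [d0 _ _ _] := rep.
have zz : nm (z - z) < d by rewrite subrr nm0.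
have := represents_sder k.+1 cg rep zz.
rewrite (represents_coefficient cg rep k.+1 zz).
by apply: (sder_eq d0) => x xz; rewrite (represents_coefficient cg rep).
Qed.

Definition divided_difference f (xi z : R[i]) : R[i] :=
  if z == xi then derivative f xi else (f z - f xi) / (z - xi).

(** Removal of the singularity by partial fractions: the difference of the kernels at [w] and [xi],
    divided by [w - xi], is their product. At [w = xi] this is the kernel of the derivative. *)
Lemma represents_divided_difference g v rho xi d f : curve g v -> represents g rho xi d f ->
  represents g (fun w => rho w * (w - xi)^-1) xi d (divided_difference f xi).
Proof.
move=> cg rep; have [d0 cr off E] := rep.
have zz : nm (xi - xi) < d by rewrite subrr nm0.
have offxi t : 0 <= t <= 1 -> g t != xi by exact: off.
split => //.
  apply: cont_traceM => //; have := @cont_trace_kernel _ g 1 xi offxi.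
  by under eq_fun do rewrite expr1.
move=> w wz; rewrite /divided_difference; case: eqP => [->|/eqP wxi].
  rewrite (derivativeE (represents_sder1 cg rep zz)).
  by congr contour_integral; apply/funext => x; rewrite expr1 expr2 mulrA.
have offw t : 0 <= t <= 1 -> g t != w by move=> t01; exact: off.
apply: esym; apply: isint_contour.
have I1 := isint_cauchy_transform 1 cg cr offw.
have I2 := isint_cauchy_transform 1 cg cr offxi.
have := isintZ (w - xi)^-1 (isintD I1 (isintZ (-1) I2)).
rewrite -!E // mulN1r mulrC; apply: eq_isint => t t01; rewrite !expr1.
by field; rewrite !subr_eq0 offw // offxi // wxi.
Qed.

Lemma sder_divided_difference f xi z : z != xi -> (exists d, sder f z d) ->
  exists d, sder (divided_difference f xi) z d.
Proof.
move=> zxi [d Hd].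
have n0 : 0 < nm (z - xi) by rewrite nm_gt0 subr_eq0.
have K : sder (fun x => (f x - f xi) * (x - xi)^-1) z
   ((d - 0) * (z - xi)^-1 + (f z - f xi) * (- (z - xi) ^- 2 * (1 - 0))).
  apply: sderM; first exact: sderB Hd (sder_cst _ _).
  apply: (@sder_comp _ (fun x => x - xi) (fun x => x^-1)).
    exact: sderB (sder_id _) (sder_cst _ _).
  by apply: sderV; rewrite subr_eq0.
eexists; apply: (sder_eq n0 _ K) => x xz; rewrite /divided_difference.
case: eqP => // xE; move: xz; rewrite xE nmB ltxx //.
Qed.

Lemma divided_difference_hol D f xi : hol D f -> D xi -> hol D (divided_difference f xi).
Proof.
move=> hf Dxi z Dz; have [->|zxi] := eqVneq z xi.
  have [g [rho [d [[v cg] rep]]]] := hol_representable hf Dxi.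
  have rep' := represents_divided_difference cg rep.
  exists d; first by case: rep.
  by move=> w wz; exists (cauchy_transform g (fun w => rho w * (w - xi)^-1) 2 w); apply: (represents_sder1 cg rep').
have [r r0 Hr] := hf z Dz.
have n0 : 0 < nm (z - xi) by rewrite nm_gt0 subr_eq0.
exists (Num.min r (nm (z - xi))); first by rewrite lt_min r0.
move=> w; rewrite lt_min => /andP[wr wx]; apply: sder_divided_difference; last exact: Hr.
by apply/eqP => E; rewrite E nmB ltxx in wx.
Qed.

Fixpoint iterated_difference f xi k : R[i] -> R[i] :=
  if k is k'.+1 then divided_difference (iterated_difference f xi k') xi else f.

(** Each division multiplies the density by [(w - xi)^-1]. After [k] divisions the transform with
    exponent 1 at [xi] has become the one with exponent [k.+1], which is the Taylor coefficient. *)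
Lemma iterated_difference_coefficient D f xi k : hol D f -> D xi ->
  iterated_difference f xi k xi = coefficient f k xi.
Proof.
move=> hf Dxi; have [g [rho [d [[v cg] rep]]]] := hol_representable hf Dxi.
have [d0 cr off _] := rep.
have zz : nm (xi - xi) < d by rewrite subrr nm0.
rewrite (represents_coefficient cg rep k zz).
suff H : represents g (fun w => rho w * (w - xi)^-1 ^+ k) xi d (iterated_difference f xi k).
  have [_ _ _ ->] := H => //; congr contour_integral; apply/funext => w.
  by rewrite expr1 exprSr mulrA.
elim: k => [|k IH] /=.
  by have -> : (fun w : R[i] => rho w * (w - xi)^-1 ^+ 0) = rho by apply/funext => w; rewrite expr0 mulr1.
have := represents_divided_difference cg IH.
by congr represents; apply/funext => w; rewrite exprSr mulrA.
Qed.

End Holomorphic.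

(** * Cauchy's formula for admissible contours *)

Section Dixon.
Variable R : realType.
Implicit Types (D : set R[i]) (f : R[i] -> R[i]) (g : R -> R[i]).

Definition eopen D := forall z, D z -> exists2 r : R, 0 < r & forall w, nm (w - z) < r -> D w.

Lemma prod_close (A B : R[i]) (e : R) : 0 < e -> exists2 d : R, 0 < d &
  forall a b, nm (a - A) <= d -> nm (b - B) <= d -> nm (a * b - A * B) <= e.
Proof.
move=> e0; pose M := nm A + nm B + 1.
have M1 : 1 <= M by rewrite lerDr addr_ge0 ?nm_ge0.
have M0 : 0 < M by rewrite (lt_le_trans ltr01).
pose d := Num.min 1 (e / (3 * M)).
have d0 : 0 < d by rewrite lt_min ltr01 divr_gt0 // mulr_gt0.
have dM : d * M <= e / 3.
  have -> : e / 3 = e / (3 * M) * M by field; rewrite gt_eqF.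
  by rewrite ler_pM2r // ge_min lexx orbT.
have d1 : d <= 1 by rewrite ge_min lexx.
exists d => // a b aA bB.
have -> : a * b - A * B = (a - A) * (b - B) + (a - A) * B + A * (b - B) by ring.
have n1 : nm A <= M by have := nm_ge0 B; rewrite /M; lra.
have n2 : nm B <= M by have := nm_ge0 A; rewrite /M; lra.
have -> : e = e / 3 + e / 3 + e / 3 by field.
apply: (le_trans (nmD _ _)); apply: lerD; first (apply: (le_trans (nmD _ _)); apply: lerD); rewrite nmM.
- rewrite (le_trans (ler_pM _ _ aA bB)) ?nm_ge0 // (le_trans _ dM) // ler_wpM2l // ?(ltW d0) // (le_trans d1) //.
- by rewrite (le_trans (ler_pM _ _ aA n2)) ?nm_ge0.
- by rewrite (le_trans (ler_pM _ _ n1 bB)) ?nm_ge0 // mulrC.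
Qed.

Lemma divided_differenceC f x y : divided_difference f x y = divided_difference f y x.
Proof.
rewrite /divided_difference eq_sym; case: eqP => [-> //|_].
by rewrite -[f y - f x]opprB -[y - x]opprB invrN mulrNN.
Qed.

(** At a diagonal point this is strict differentiability together with continuity of the derivative;
    elsewhere it concerns a quotient of continuous functions. It makes [isint_fubini] applicable in
    Dixon's argument. *)
Lemma divided_difference_cont D f a b : hol D f -> D a -> D b ->
  forall e : R, 0 < e -> exists2 r : R, 0 < r & forall x y,
    nm (x - a) < r -> nm (y - b) < r ->
    nm (divided_difference f x y - divided_difference f a b) <= e.
Proof.
move=> hf Da Db e e0; have [E|ab] := eqVneq a b.
  subst b; have Ha := hol_derivative hf Da.
  have [r r0 Hr] := Ha _ e0; have [q q0 Hq] := sder_near Ha e0.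
  have [p p0 Hp] := hf a Da.
  exists (Num.min (Num.min r q) p); first by rewrite !lt_min r0 q0.
  move=> x y; rewrite !lt_min => /andP[/andP[x1 x2] x3] /andP[/andP[y1 y2] y3].
  rewrite /divided_difference eqxx; case: eqP => [E|/eqP yx].
    by have [d Hd] := Hp x x3; apply: Hq x2 _ (derivativeP Hd).
  have n0 : 0 < nm (y - x) by rewrite nm_gt0 subr_eq0.
  have -> : (f y - f x) / (y - x) - derivative f a = (f y - f x - derivative f a * (y - x)) / (y - x).
    by field; rewrite subr_eq0.
  by rewrite nmM nmV ler_pdivrMr //; apply: Hr.
have n0 : 0 < nm (b - a) by rewrite nm_gt0 subr_eq0 eq_sym.
have [d d0 Hd] := prod_close (f b - f a) (b - a)^-1 e0.
have V : sder (fun x => x^-1) (b - a) (- (b - a) ^- 2) by apply: sderV; rewrite -nm_gt0.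
have [p p0 Hp] := sder_cont V d0.
have d20 : 0 < d / 2 by rewrite divr_gt0.
have [q q0 Hq] := sder_cont (hol_derivative hf Da) d20.
have [r r0 Hr] := sder_cont (hol_derivative hf Db) d20.
exists (Num.min (Num.min q r) (Num.min (p / 2) (nm (b - a) / 2))).
  by rewrite !lt_min q0 r0 !divr_gt0.
move=> x y; rewrite !lt_min => /andP[/andP[x1 x2] /andP[x3 x4]] /andP[/andP[y1 y2] /andP[y3 y4]].
have nyx : nm (y - x - (b - a)) <= nm (y - b) + nm (x - a).
  by rewrite (_ : y - x - (b - a) = (y - b) - (x - a)) -?[nm (x - a)]nmN ?nmD //; ring.
have yx : (y == x) = false.
  apply/eqP => E; subst y; move: nyx; rewrite subrr sub0r nmN; lra.
have ba : (b == a) = false by rewrite eq_sym (negPf ab).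
rewrite /divided_difference yx ba; apply: Hd; last by apply: Hp; lra.
have -> : f y - f x - (f b - f a) = (f y - f b) - (f x - f a) by ring.
rewrite (le_trans (nmD _ _)) // nmN [d]splitr lerD //; [exact: Hr|exact: Hq].
Qed.

Section Contour.
Variables (g : R -> R[i]) (v : R -> R) (D : set R[i]) (f : R[i] -> R[i]).
Hypotheses (cg : curve g v) (g01 : g 0 = g 1) (oD : eopen D) (hf : hol D f).
Hypothesis gD : forall t, 0 <= t <= 1 -> D (g t).
Hypothesis winding_out : forall z, ~ D z -> cauchy_transform g (fun=> 1) 1 z = 0.

Let N := cauchy_transform g (fun=> 1) 1.

(** Dixon's function. Off the trace both branches equal the transform of [f] minus [N z * f z],
    since [N] vanishes outside [D]; this is how they fit together. *)
Let h z : R[i] := if `[< D z >] then contour_integral g (divided_difference f z)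
             else cauchy_transform g f 1 z.

Let cf : cont_trace g f.
Proof. by apply: cont_at_trace => t t01; apply: sder_cont (hol_derivative hf (gD t01)). Qed.

Let isint_dd z : D z -> isint g (divided_difference f z) (h z).
Proof.
move=> Dz; rewrite /h; case: asboolP => // _; apply: (isintP cg).
apply: cont_at_trace => t t01; apply: sder_cont.
exact: hol_derivative (divided_difference_hol hf Dz) (gD t01).
Qed.

Let V0 : 0 <= v 1 - v 0. Proof. exact: curve_variation_ge0 cg.2. Qed.
Let V1 : 0 < v 1 - v 0 + 1. Proof. by rewrite ltr_wpDl. Qed.

Let VleV1 (e : R) : 0 < e -> e / (v 1 - v 0 + 1) * (v 1 - v 0) <= e.
Proof. by move=> e0; rewrite mulrAC ler_pdivrMr // ler_wpM2l ?(ltW e0) // lerDl. Qed.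

Let h_cont z : D z -> cont_at h z.
Proof.
move=> Dz e e0.
have e'0 : 0 < e / (v 1 - v 0 + 1) by rewrite divr_gt0.
have e20 : 0 < e / (v 1 - v 0 + 1) / 2 by rewrite divr_gt0.
have [t t01|d d' t dd H x xz|r r0 Hr] := @segment_uniform R 0 1 (fun d t => forall x, nm (x - z) < d ->
    nm (divided_difference f x (g t) - divided_difference f z (g t)) <= e / (v 1 - v 0 + 1)).
- have [r r0 Hr] := divided_difference_cont hf Dz (gD t01) e20.
  have r20 : 0 < r / 2 by rewrite divr_gt0.
  have [q q0 Hq] := cg.1 _ r20.
  exists (Num.min q r); first by rewrite lt_min q0.
  move=> y y01; rewrite lt_min => /andP[yq _] x; rewrite lt_min => /andP[_ xr].
  have yt : nm (g y - g t) < r by have := Hq y t y01 t01 yq; lra.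
  rewrite (le_trans (nm_triangle (divided_difference f z (g t)) _ _)) // [X in _ <= X]splitr lerD //.
    exact: Hr.
  by rewrite nmB; apply: Hr => //; rewrite subrr nm0.
- by apply: H; exact: lt_le_trans dd.
have [q q0 Hq] := oD Dz.
exists (Num.min r q); first by rewrite lt_min r0.
move=> x; rewrite lt_min => /andP[xr xq].
have I := isintD (isint_dd (Hq x xq)) (isintZ (-1) (isint_dd Dz)).
apply: (le_trans _ (VleV1 e0)); rewrite -mulN1r; apply: (isint_le cg.2 I) => t t01.
by rewrite mulN1r; apply: Hr.
Qed.

Let h_off z : (forall t, 0 <= t <= 1 -> g t != z) ->
  h z = cauchy_transform g f 1 z - N z * f z.
Proof.
move=> off; have [Dz|nDz] := pselect (D z); last first.
  by rewrite /N winding_out // mul0r subr0 /h; case: asboolP.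
apply: (isint_unique (isint_dd Dz)).
have I1 := isint_cauchy_transform 1 cg cf off.
have I2 := isint_cauchy_transform 1 cg (@cont_trace_cst R g 1) off.
have := isintD I1 (isintZ (- f z) I2).
rewrite -/N (_ : - f z * N z = - (N z * f z)); last by ring.
apply: eq_isint => t t01; rewrite /divided_difference (negPf (off t t01)) !expr1.
by field; rewrite subr_eq0 off.
Qed.

(** [N] is constant near [z]. If it is 0 there, [h] is the transform of [f] alone; otherwise
    [winding_out] puts the nearby points into [D], where [f] is differentiable. *)
Let h_sder_off z : (forall t, 0 <= t <= 1 -> g t != z) -> exists2 r : R, 0 < r &
  forall w, nm (w - z) < r -> exists d, sder h w d.
Proof.
move=> off; have [r r0 Hr] := trace_dist cg off.
have offw w : nm (w - z) < r -> forall t, 0 <= t <= 1 -> g t != w.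
  move=> wz t t01; apply/eqP => E; have := Hr t t01; rewrite E leNgt wz //.
have Nw w : nm (w - z) < r -> N w = N z.
  move=> wz; apply: (winding_segment cg g01) => s t s01 t01; apply: offw => //.
  by apply: nm_segment_ball => //; rewrite subrr nm0.
exists r => // w wz.
have [s0 Hs] := ball_inner wz.
have C := cauchy_transform_sder 1 cg cf (offw w wz).
have [N0|N0] := eqVneq (N z) 0.
  eexists; apply: (sder_eq s0 _ C) => x xw.
  by rewrite h_off ?Nw ?N0 ?mul0r ?subr0 //; [exact: Hs|move=> t t01; apply: offw => //; exact: Hs].
have Dw : D w by apply: contrapT => /winding_out Nw0; move: N0; rewrite -(Nw w wz) /N Nw0 eqxx.
have K := sderB C (sderZ (N z) (hol_derivative hf Dw)).
eexists; apply: (sder_eq s0 _ K) => x xw.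
by rewrite h_off ?Nw //; [exact: Hs|move=> t t01; apply: offw => //; exact: Hs].
Qed.

(** By Fubini [h] satisfies Cauchy's formula on a small circle, because [divided_difference f x y]
    does so in [x] for every [y] on the contour. Being a Cauchy transform, [h] is strictly
    differentiable, even at points of the trace. *)
Let h_sder_in z : D z -> exists2 r : R, 0 < r &
  forall w, nm (w - z) < r -> exists d, sder h w d.
Proof.
move=> Dz; have [q q0 Hq] := oD Dz.
pose r := q / 2.
have r0 : 0 < r by rewrite divr_gt0.
have rq : r < q by rewrite /r; lra.
have cc := circle_curve z r0.
set k := circle z r in cc *.
have kD t : D (k t) by apply: Hq; rewrite circle_dist.
have ch : cont_trace k h by apply: cont_at_trace => t _; exact: h_cont.
have key w : nm (w - z) < r -> cauchy_transform k h 1 w = twopii R * h w.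
  move=> wz.
  have Dw : D w by apply: Hq; exact: lt_trans rq.
  have offw t : 0 <= t <= 1 -> k t != w by move=> _; exact: circle_off.
  apply: (isint_fubini cc cg (K := fun x y => divided_difference f x y * (x - w)^-1 ^+ 1)
    (A := fun x => h x * (x - w)^-1 ^+ 1) (B := fun y => twopii R * divided_difference f w y)).
  - move=> e e0; have e20 : 0 < e / 2 by rewrite divr_gt0.
    have [s t s01 t01|d d' s t dd H s' t' *|d d0 Hd] := @segment2_uniform R 0 1 0 1
      (fun d s t => forall s' t', 0 <= s' <= 1 -> 0 <= t' <= 1 -> `|s' - s| < d -> `|t' - t| < d ->
         nm (divided_difference f (k s') (g t') * (k s' - w)^-1 ^+ 1 -
             divided_difference f (k s) (g t) * (k s - w)^-1 ^+ 1) <= e).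
    + have [p p0 Hp] := prod_close (divided_difference f (k s) (g t)) ((k s - w)^-1 ^+ 1) e20.
      have [a a0 Ha] := divided_difference_cont hf (kD s) (gD t01) p0.
      have [b b0 Hb] := cont_trace_unif cc (@cont_trace_kernel R k 1 w offw) p0.
      have a20 : 0 < a / 2 by rewrite divr_gt0.
      have [c c0 Hc] := cc.1 _ a20; have [c' c'0 Hc'] := cg.1 _ a20.
      pose m := Num.min b (Num.min c c').
      have m0 : 0 < m by rewrite !lt_min b0 c0.
      have P s' t' : 0 <= s' <= 1 -> 0 <= t' <= 1 -> `|s' - s| < m -> `|t' - t| < m ->
         nm (divided_difference f (k s') (g t') * (k s' - w)^-1 ^+ 1 -
             divided_difference f (k s) (g t) * (k s - w)^-1 ^+ 1) <= e / 2.
        move=> s'01 t'01; rewrite !lt_min => /andP[s1 /andP[s2 s3]] /andP[t1 /andP[t2 t3]].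
        apply: Hp; last exact: Hb.
        apply: Ha; [have := Hc s' s s'01 s01 s2|have := Hc' t' t t'01 t01 t3]; lra.
      exists (m / 2); first by rewrite divr_gt0.
      move=> s1 t1 s101 t101 ss tt s2 t2 s201 t201 ss' tt'.
      have := nmD (divided_difference f (k s2) (g t2) * (k s2 - w)^-1 ^+ 1 - divided_difference f (k s) (g t) * (k s - w)^-1 ^+ 1)
        (- (divided_difference f (k s1) (g t1) * (k s1 - w)^-1 ^+ 1 - divided_difference f (k s) (g t) * (k s - w)^-1 ^+ 1)).
      rewrite opprB addrA subrK => H; rewrite (le_trans H) // -opprB nmN [e]splitr lerD //.
        apply: P => //; first by have := ler_distD s1 s2 s; lra.
        by have := ler_distD t1 t2 t; lra.
      by apply: P => //; lra.
    + by apply: H => //; [exact: lt_le_trans dd|exact: lt_le_trans dd].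
    by exists d => // s s' t t' s01 s'01 t01 t'01 ss tt; apply: Hd.
  - move=> s s01; have := isintZ ((k s - w)^-1 ^+ 1) (isint_dd (kD s)).
    by rewrite mulrC; apply: eq_isint => t t01; rewrite mulrC.
  - move=> t t01.
    have hd := divided_difference_hol hf (gD t01).
    have Dd x : nm (x - z) < q -> sder (divided_difference f (g t)) x (derivative (divided_difference f (g t)) x).
      by move=> xq; apply: (hol_derivative hd); exact: Hq.
    rewrite (divided_differenceC f w) -(cauchy_formula_circle r0 rq Dd wz).
    have cd : cont_trace k (divided_difference f (g t)).
      by apply: cont_at_trace => s _; apply: sder_cont (Dd _ _); rewrite circle_dist.
    have := isint_cauchy_transform 1 cc cd offw.
    by apply: eq_isint => s s01; rewrite divided_differenceC.
  - exact: (isint_cauchy_transform 1 cc ch offw).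
  - exact: (isintZ (twopii R) (isint_dd Dw)).
exists r => // w wz.
have offw t : 0 <= t <= 1 -> k t != w by move=> _; exact: circle_off.
have [s0 Hs] := ball_inner wz.
have C := sderZ (twopii R)^-1 (cauchy_transform_sder 1 cc ch offw).
eexists; apply: (sder_eq s0 _ C) => x xw.
by rewrite (key x (Hs x xw)) mulrA mulVf ?twopii_neq0 // mul1r.
Qed.

Let h_sder z : exists d, sder h z d.
Proof.
have zz (r : R) : 0 < r -> nm (z - z) < r by rewrite subrr nm0.
have [Dz|nDz] := pselect (D z).
  by have [r /zz r0 Hr] := h_sder_in Dz; exact: Hr.
have [|r /zz r0 Hr] := @h_sder_off z; last exact: Hr.
by move=> t t01; apply/eqP => E; apply: nDz; rewrite -E; exact: gD.
Qed.

Let bounds : exists2 M : R, 0 < M & forall t, 0 <= t <= 1 -> nm (g t) <= M /\ nm (f (g t)) <= M.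
Proof.
have [M1 M10 H1] := trace_bounded cg cf.
have cid : cont_trace g id by apply: cont_at_trace => t _; apply: sder_cont (sder_id _).
have [M2 M20 H2] := trace_bounded cg cid.
exists (Num.max M1 M2); first by rewrite lt_max M10.
by move=> t t01; rewrite !le_max H1 // H2 // orbT.
Qed.

Let transform_small (rho : R[i] -> R[i]) (M : R) : 0 < M -> cont_trace g rho ->
  (forall t, 0 <= t <= 1 -> nm (g t) <= M /\ nm (rho (g t)) <= M) ->
  forall z, M < nm z -> nm (cauchy_transform g rho 1 z) <= M / (nm z - M) * (v 1 - v 0).
Proof.
move=> M0 cr b z zM.
have far t : 0 <= t <= 1 -> nm z - M <= nm (g t - z).
  by move=> t01; have [b1 _] := b t t01; have := nm_geB z (g t); rewrite nmB; lra.
have off t : 0 <= t <= 1 -> g t != z.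
  by move=> t01; rewrite -subr_eq0 -nm_gt0 (lt_le_trans _ (far t t01)) // subr_gt0.
apply: (isint_le cg.2 (isint_cauchy_transform 1 cg cr off)) => t t01.
have [_ b2] := b t t01.
rewrite nmM expr1 nmV ler_pM ?nm_ge0 ?invr_ge0 ?nm_ge0 // lef_pV2 ?posrE ?subr_gt0 //; first exact: far.
by rewrite (lt_le_trans _ (far t t01)) // subr_gt0.
Qed.

(** The winding number does not change along the ray from [z] outwards, which avoids the disc
    containing the trace, and it tends to 0 on that ray. *)
Lemma winding_far (M : R) : 0 < M -> (forall t, 0 <= t <= 1 -> nm (g t) <= M) ->
  forall z, M < nm z -> cauchy_transform g (fun=> 1) 1 z = 0.
Proof.
move=> M0 b z zM; rewrite -/(N z); apply: nm_eqP => e e0.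
pose M' := M + 1.
have b' t : 0 <= t <= 1 -> nm (g t) <= M' /\ nm (1 : R[i]) <= M'.
  by move=> t01; have := b t t01; rewrite nm1 /M'; split; lra.
have M'0 : 0 < M' by rewrite /M'; lra.
have z0 : 0 < nm z by lra.
pose T := M' * (v 1 - v 0) / e.
have T0 : 0 <= T by rewrite divr_ge0 ?(ltW e0) // mulr_ge0 // ltW.
(* The factor is chosen so that [nm y = nm z + M' + 1 + T]; as [M' * (v 1 - v 0) = e * T], the
   transform at [y] is then at most [e]. *)
pose s : R := 1 + (M' + 1 + T) / nm z.
have s1 : 1 <= s by rewrite /s lerDl divr_ge0 ?(ltW z0) //; lra.
pose y := s%:C * z.
have alg (p q : R) (w : R[i]) : w + p%:C * (q%:C * w - w) = (1 + p * (q - 1))%:C * w.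
  by rewrite rmorphD rmorphM rmorphB !rmorph1; ring.
have ny : nm y = nm z + M' + 1 + T.
  by rewrite /y nmM nm_real ger0_norm ?(le_trans _ s1) // /s; field; rewrite gt_eqF.
have -> : N z = N y.
  apply: esym; apply: (winding_segment cg g01) => x t /andP[x0 x1] t01; apply/eqP => E.
  have := b t t01; rewrite E leNgt => /negP; apply.
  have -> : z + x%:C * (y - z) = (1 + x * (s - 1))%:C * z.
    exact: alg.
  rewrite nmM nm_real (lt_le_trans zM) // ler_peMl ?(ltW z0) //.
  by rewrite (le_trans _ (ler_norm _)) // lerDl mulr_ge0 // subr_ge0.
have yM' : M' < nm y by rewrite ny; lra.
rewrite (le_trans (transform_small M'0 (@cont_trace_cst R g 1) b' yM')) //.
rewrite mulrAC ler_pdivrMr ?subr_gt0 //.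
have -> : M' * (v 1 - v 0) = e * T by rewrite /T; field; rewrite gt_eqF.
by rewrite ler_pM2l // ny; lra.
Qed.

(* Dixon's proof: [h] is entire and tends to 0 at infinity. *)
Theorem isint_divided_difference0 xi : D xi -> isint g (divided_difference f xi) 0.
Proof.
move=> Dxi; suff <- : h xi = 0 by exact: isint_dd.
have [M M0 HM] := bounds.
apply: nm_eqP => e e0.
pose T := M * (v 1 - v 0) / e.
have T0 : 0 <= T by rewrite divr_ge0 ?(ltW e0) // mulr_ge0 // ltW.
(* On the circle of this radius [nm z - M] exceeds [2 * T], so [h] is at most [e / 2] there; the
   length bound [4 * pi * q], twice the true length, turns this into [e] at the centre. *)
pose q := nm xi + 2 * M + 1 + 2 * T.
have x0 := nm_ge0 xi.
have q0 : 0 < q by rewrite /q; lra.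
have Dh w : nm (w - xi) < q + 1 -> sder h w (derivative h w).
  by move=> _; have [d /derivativeP] := h_sder w.
have qq : q < q + 1 by rewrite ltrDl.
have xx : nm (xi - xi) < q by rewrite subrr nm0.
have cc := circle_curve xi q0.
have ch : cont_trace (circle xi q) h.
  by apply: cont_at_trace => t _; have [d] := h_sder (circle xi q t); exact: sder_cont.
have off t : 0 <= t <= 1 -> circle xi q t != xi by move=> _; exact: circle_off.
have F := cauchy_formula_circle q0 qq Dh xx.
have small t : nm (h (circle xi q t)) <= e / 2.
  set z := circle xi q t.
  have nz : M + M + 1 + 2 * T <= nm z.
    have := circle_dist xi t q0; rewrite -/z => zq.
    by have := nmD z (- xi); rewrite nmN zq /q; lra.
  have zM : M < nm z by lra.
  have offz s : 0 <= s <= 1 -> g s != z.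
    by move=> s01; apply/eqP => E; have [+ _] := HM s s01; rewrite E leNgt zM.
  have N0 : N z = 0 by apply: (winding_far M0) => // s s01; have [] := HM s s01.
  rewrite h_off // N0 mul0r subr0 (le_trans (transform_small M0 cf HM zM)) //.
  rewrite mulrAC ler_pdivrMr ?subr_gt0 //.
  have -> : M * (v 1 - v 0) = e / 2 * (2 * T) by rewrite /T; field; rewrite gt_eqF.
  by rewrite ler_pM2l ?divr_gt0 //; lra.
have B : nm (cauchy_transform (circle xi q) h 1 xi) <= e / 2 / q * (4 * pi * q * 1 - 4 * pi * q * 0).
  apply: (isint_le cc.2 (isint_cauchy_transform 1 cc ch off)) => t _.
  by rewrite nmM expr1 nmV circle_dist // ler_wpM2r ?invr_ge0 ?(ltW q0).
rewrite F nmM in B.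
have n2 : nm (twopii R) = 2 * pi.
  by rewrite /twopii nmM nmi mulr1 nm_real gtr0_norm // mulr_gt0 ?pi_gt0.
have p0 : 0 < 2 * pi :> R by rewrite mulr_gt0 ?pi_gt0.
have alg (p : R) : e / 2 / q * (4 * p * q * 1 - 4 * p * q * 0) = 2 * p * e by field; rewrite gt_eqF.
by rewrite n2 alg ler_pM2l // in B.
Qed.

End Contour.

End Dixon.

(** * Cauchy's formula for Taylor coefficients; the inside of a contour *)

Section Contours.
Variable R : realType.
Implicit Types (D : set R[i]) (f : R[i] -> R[i]) (g : R -> R[i]).

(** Induction on the order of the pole: off [xi], [f] is [f xi] plus [w - xi] times its divided
    difference. The constant part gives [twopii R] at a simple pole and 0 at higher ones; the other
    part has a pole of lower order, and when no pole is left it is Dixon's theorem. *)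
Theorem cauchy_coefficients g v D f xi k : curve g v -> g 0 = g 1 -> eopen D -> hol D f ->
  (forall t, 0 <= t <= 1 -> D (g t)) ->
  (forall z, ~ D z -> cauchy_transform g (fun=> 1) 1 z = 0) ->
  D xi -> (forall t, 0 <= t <= 1 -> g t != xi) ->
  cauchy_transform g (fun=> 1) 1 xi = twopii R ->
  cauchy_transform g f k.+1 xi = twopii R * coefficient f k xi.
Proof.
move=> cg g01 oD hf gD out Dxi off wind.
have c1 := @cont_trace_cst R g 1.
have [r r0 Hr] := trace_dist cg off.
have offw w : nm (w - xi) < r -> forall t, 0 <= t <= 1 -> g t != w.
  by move=> wx t t01; apply/eqP => E; have := Hr t t01; rewrite E leNgt wx //.
have xx : nm (xi - xi) < r by rewrite subrr nm0.
(* Up to factors these are the derivatives of the winding number, which is constant near [xi]. *)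
have zero j w : nm (w - xi) < r -> cauchy_transform g (fun=> 1) j.+2 w = 0.
  elim: j w => [|j IH] w wx; have [s0 Hs] := ball_inner wx.
    have := cauchy_transform_sder 1 cg c1 (offw w wx); rewrite mul1r => C.
    apply: (sder_unique C); apply: (sder_eq s0 _ (sder_cst (twopii R) w)) => x xw.
    rewrite -wind; apply: (winding_segment cg g01) => s t s01 t01; apply: offw => //.
    apply: nm_segment_ball => //; first exact: Hs.
  have C := cauchy_transform_sder j.+2 cg c1 (offw w wx).
  have : j.+2%:R * cauchy_transform g (fun=> 1) j.+3 w = 0.
    by apply: (sder_unique C); apply: (sder_eq s0 _ (sder_cst 0 w)) => x xw; rewrite IH //; apply: Hs.
  by move/eqP; rewrite mulf_eq0 pnatr_eq0 => /eqP.
rewrite -(iterated_difference_coefficient k hf Dxi).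
have step f' j : hol D f' -> cauchy_transform g f' j.+1 xi =
   f' xi * cauchy_transform g (fun=> 1) j.+1 xi + cauchy_transform g (divided_difference f' xi) j xi.
  move=> hf'; apply: isint_contour.
  have cd : cont_trace g (divided_difference f' xi).
    apply: cont_at_trace => t t01; apply: sder_cont.
    exact: hol_derivative (divided_difference_hol hf' Dxi) (gD t t01).
  have I1 := isint_cauchy_transform j.+1 cg c1 off.
  have I2 := isint_cauchy_transform j cg cd off.
  have := isintD (isintZ (f' xi) I1) I2; apply: eq_isint => t t01.
  rewrite /divided_difference (negPf (off t t01)) exprS.
  by field; rewrite subr_eq0 off.
have shift j : iterated_difference (divided_difference f xi) xi j = iterated_difference f xi j.+1.
  by elim: j => //= j ->.
elim: k f hf shift => [|k IH] f hf shift /=.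
  rewrite step // wind mulrC /cauchy_transform.
  rewrite (isint_contour (L := 0)) ?addr0 //.
  have := isint_divided_difference0 cg g01 oD hf gD out Dxi.
  by apply: eq_isint => t t01; rewrite expr0 mulr1.
rewrite step // zero // mulr0 add0r IH; last 2 first.
- exact: divided_difference_hol.
- by elim=> //= j ->.
by rewrite shift.
Qed.

Lemma bounded_nmP (A : set R[i]) :
  bounded_set (A : set R[i]^o) <-> exists M : R, forall x, A x -> nm x <= M.
Proof.
split=> [[M [Mr HM]]|[M HM]].
  exists (complex.Re (M + 1)) => x Ax.
  have := HM (M + 1) _ x Ax; rewrite ltrDl ltr01 => /(_ isT).
  by rewrite /= normE lecE => /andP[].
exists M%:C; split; first by rewrite complex_real.
move=> x Mx y Ay /=; rewrite normE; apply: le_trans (ltW Mx).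
by rewrite lecR HM.
Qed.

Lemma eopen_open (A : set R[i]) : eopen A -> open A.
Proof.
by move=> oA; rewrite openE => x /oA [r r0 Hr]; apply/nbhs_nmP; exists r.
Qed.

Lemma traceP g z : ~ trace g z <-> forall t, 0 <= t <= 1 -> g t != z.
Proof.
split=> [H t t01|H [t]].
  by apply/eqP => E; apply: H; exists t => //=; rewrite in_itv.
by rewrite /= in_itv /= => /H /eqP.
Qed.

(** This stands in for the Jordan curve theorem: the winding number is constant on the component of
    [z] in the complement and vanishes far away, so that component is bounded. *)
Lemma winding_inside g v z : curve g v -> g 0 = g 1 -> ~ trace g z ->
  cauchy_transform g (fun=> 1) 1 z != 0 -> inside g z.
Proof.
move=> cg g01 tz Nz; split => //; apply/bounded_nmP.
have cid : cont_trace g id by apply: cont_at_trace => t _; apply: sder_cont (sder_id _).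
have [M M0 HM] := trace_bounded cg cid.
exists M => y.
have oN (P : R[i] -> Prop) : eopen [set y | ~ trace g y /\ P (cauchy_transform g (fun=> 1) 1 y)].
  move=> x [/traceP tx Px]; have [r r0 Hr] := trace_dist cg tx.
  exists r => // w wx.
  have offw w' : nm (w' - x) < r -> forall t, 0 <= t <= 1 -> g t != w'.
    by move=> wx' t t01; apply/eqP => E; have := Hr t t01; rewrite E leNgt wx' //.
  split; first by apply/traceP; exact: offw.
  rewrite (winding_segment (p := x) cg g01) // => s t s01 t01; apply: offw => //.
  by apply: nm_segment_ball => //; rewrite subrr nm0.
set A := connected_component _ _.
have cA : connected A by exact: component_connected.
have sA : A `<=` ~` trace g by exact: connected_component_sub.
pose O := [set y | ~ trace g y /\ (fun u => u = cauchy_transform g (fun=> 1) 1 z) (cauchy_transform g (fun=> 1) 1 y)].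
pose O' := [set y | ~ trace g y /\ (fun u => u <> cauchy_transform g (fun=> 1) 1 z) (cauchy_transform g (fun=> 1) 1 y)].
(* [O] is open, and so is the rest [O'] of the complement of the trace; hence [O] is open and closed
   relative to the connected set [A]. *)
have AE : A `&` O = A.
  apply: cA.
  - by exists z; split; [exact: connected_component_refl|].
  - by exists O => //; apply: eopen_open; exact: oN.
  exists (~` O'); first by rewrite closedC; apply: eopen_open; exact: oN.
  apply/seteqP; split=> x [Ax]; split => //.
    by case: b => _ E [_ /(_ E)].
  by split; [exact: sA|apply: contrapT => E; apply: b; split => //; exact: sA].
rewrite -AE => -[_ [_ Ny]]; rewrite leNgt; apply/negP => My.
move: Nz; rewrite -Ny (winding_far cg g01 M0 HM My) eqxx //.
Qed.

Lemma closed_jordan_curve g : closed_jordan g -> rectifiable g -> exists v, curve g v.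
Proof.
move=> [cg _ _] /rectifiable_dominated [v gv]; exists v; split => // e e0.
have e20 : 0 < e / 2 by rewrite divr_gt0.
have [t t01|d d' t dd H s s01 st|r r0 Hr] := @segment_uniform R 0 1
  (fun d t => forall s, 0 <= s <= 1 -> `|s - t| < d -> nm (g s - g t) <= e).
- have tI : `[0, 1]%classic t by rewrite /= in_itv.
  have Hn : g y @[y --> within `[0, 1]%classic (nbhs t)] --> g t.
    by rewrite (nbhs_subspace_in tI); exact: cg.
  have [d /= d0 Hd] := (cvg_nmP _ _ _).1 Hn _ e20.
  have near y : 0 <= y <= 1 -> `|y - t| < d -> nm (g y - g t) < e / 2.
    by move=> y01 yt; apply: Hd; [rewrite /= distrC|rewrite /= in_itv].
  exists (d / 2); first by rewrite divr_gt0.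
  move=> y y01 yt s s01 sy.
  rewrite (le_trans (nm_triangle (g t) _ _)) // [e]splitr lerD // ltW //.
    by apply: near => //; have := ler_distD y s t; lra.
  by rewrite nmB; apply: near => //; lra.
- by apply: H => //; apply: lt_le_trans dd.
by exists r => // s t s01 t01; apply: Hr.
Qed.

(** A point outside [D] is not inside [g], so its winding number vanishes by [winding_inside]; the
    orientation supplies [twopii R] at [xi]. *)
Theorem admissible_cauchy D f g xi k : eopen D -> hol D f -> admissible_contour D g ->
  inside g xi ->
  isint g (fun t => f t * (t - xi)^-1 ^+ k.+1) (twopii R * coefficient f k xi).
Proof.
move=> oD hf [jg rg pg tD iD] ixi.
have [v cg] := closed_jordan_curve jg rg.
have [_ g01 _] := jg.
have gD t : 0 <= t <= 1 -> D (g t) by move=> t01; apply: tD; exists t => //=; rewrite in_itv.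
have Dxi : D xi by exact: iD.
have off : forall t, 0 <= t <= 1 -> g t != xi by apply/traceP; case: ixi.
have cf : cont_trace g f.
  by apply: cont_at_trace => t t01; apply: sder_cont (hol_derivative hf (gD t t01)).
rewrite -(@cauchy_coefficients g v D f xi k) //.
- exact: (isint_cauchy_transform k.+1 cg cf off).
- move=> z nDz; apply: contrapT => /eqP Nz.
  have tz : ~ trace g z by move=> /tD.
  by apply: nDz; apply: iD; exact: (winding_inside cg g01 tz Nz).
rewrite -[RHS](pg xi ixi); congr contour_integral; apply/funext => w.
by rewrite mul1r expr1.
Qed.

(** Half angle: the cosine can be 1 only if the sine of [|x| / 2] is 0, whereas the sine is positive
    between 0 and [pi]. This gives the injectivity of the circle. *)
Lemma circle_sym (x : R) : cos x = 1 -> `|x| < 2 * pi -> x = 0.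
Proof.
move=> cx xb; apply/eqP; apply: contrapT => /negP x0.
have : 0 < sin (`|x| / 2).
  apply: sin_gt0_pi; rewrite divr_gt0 ?normr_gt0 //=; lra.
have : cos (`|x| / 2 + `|x| / 2) = 1.
  by rewrite -splitr; case: (ger0P x) => _; rewrite ?cosN.
rewrite cosD; have := cos2Dsin2 (`|x| / 2); rewrite !expr2; nra.
Qed.

Lemma circle_surj c (r : R) z : 0 < r -> nm (z - c) = r -> trace (circle c r) z.
Proof.
move=> r0 zc; have p0 : 0 < 2 * pi :> R by rewrite mulr_gt0 ?pi_gt0.
pose w := (z - c) / r%:C.
have rC : r%:C != 0 by rewrite -nm_gt0 nm_real normr_gt0 gt_eqF.
have nw : nm w = 1 by rewrite /w nmM nmV nm_real zc gtr0_norm // divff // gt_eqF.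
have w2 : complex.Re w ^+ 2 + complex.Im w ^+ 2 = 1.
  by apply: complexI; rewrite add_Re2_Im2 normE nw rmorph1 expr1n.
have x1 : -1 <= complex.Re w <= 1 by have := nm_le_Re w; rewrite nw ler_norml.
suff [t t01 tw] : exists2 t, 0 <= t <= 1 & cis (2 * pi * t) = w.
  exists t; first by rewrite /= in_itv.
  by rewrite /circle tw /w mulrC divfK // addrC subrK.
have a0 := acos_ge0 x1; have api := acos_lepi x1.
have ca : cos (acos (complex.Re w)) = complex.Re w by rewrite acosK // in_itv.
have sa := sin_acos x1.
have sq : Num.sqrt (1 - complex.Re w ^+ 2) = `|complex.Im w|.
  by rewrite -w2 addrAC subrr add0r sqrtr_sqr.
have pE (y : R) : 2 * pi * (y / (2 * pi)) = y by rewrite mulrC divfK // gt_eqF.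
have [im0|im0] := leP 0 (complex.Im w).
  exists (acos (complex.Re w) / (2 * pi)).
    rewrite divr_ge0 ?(ltW p0) //= ler_pdivrMr // mul1r; have := pi_gt0 R; lra.
  rewrite pE /cis ca sa sq ger0_norm //.
  by apply/eqP; rewrite eq_complex /= !eqxx.
exists (1 - acos (complex.Re w) / (2 * pi)).
  rewrite subr_ge0 lerBlDr lerDl divr_ge0 ?(ltW p0) // andbT ler_pdivrMr // mul1r; have := pi_gt0 R; lra.
rewrite mulrBr mulr1 pE /cis.
have -> : cos (2 * pi - acos (complex.Re w)) = complex.Re w.
  by rewrite addrC mulr_natl cosD2pi cosN ca.
have -> : sin (2 * pi - acos (complex.Re w)) = complex.Im w.
  by rewrite addrC mulr_natl sinD2pi sinN sa sq ltr0_norm // opprK.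
by apply/eqP; rewrite eq_complex /= !eqxx.
Qed.

(** For a point beyond the circle, the ray away from [c] misses the circle and makes the component
    unbounded; within the disc the winding number is not 0. *)
Lemma circle_inside c (r : R) z : 0 < r -> inside (circle c r) z <-> nm (z - c) < r.
Proof.
move=> r0; have cc := circle_curve c r0; split=> [[tz bz]|zr].
  rewrite ltNge le_eqVlt; apply/negP => /orP[/eqP rz|rz].
    by apply: tz; apply: circle_surj.
  move/bounded_nmP : bz => [M HM].
  have zc0 : 0 < nm (z - c) by exact: lt_trans rz.
  pose ray := (fun s : R => c + s%:C * (z - c)) @` `[1, +oo[%classic.
  have rayc : connected ray.
    apply: connected_continuous_connected; first by apply/connected_intervalP; exact: interval_is_interval.
    apply: continuous_subspaceT => s; apply/cvg_nmP => e e0.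
    exists (e / nm (z - c)); first by rewrite /= divr_gt0.
    move=> t /=; rewrite distrC ltr_pdivlMr // => ts.
    by rewrite (_ : _ - _ = (t - s)%:C * (z - c)) ?nmM ?nm_real // rmorphB; ring.
  have rays : ray `<=` ~` trace (circle c r).
    move=> y [s]; rewrite /= in_itv /= andbT => s1 <-; apply/traceP => t t01; apply/eqP => E.
    have := circle_dist c t r0; rewrite E addrC addKr nmM nm_real ger0_norm ?(le_trans ler01) // => E2.
    by have := ler_pM ler01 (ltW r0) s1 (ltW rz); nra.
  have rayz : ray z by exists 1; rewrite /= ?in_itv /= ?lexx // rmorph1 mul1r addrC subrK.
  pose s := 1 + (`|M| + nm c + 1) / nm (z - c).
  have s1 : 1 <= s by rewrite lerDl divr_ge0 ?nm_ge0 // !addr_ge0 ?nm_ge0.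
  have : nm (c + s%:C * (z - c)) <= M.
    apply: HM; apply: (connected_component_max rayz rays rayc).
    by exists s => //; rewrite /= in_itv /= s1.
  rewrite leNgt => /negP; apply.
  have := nm_geB (s%:C * (z - c)) (- c); rewrite opprK addrC nmN nmM nm_real ger0_norm ?(le_trans ler01) //.
  rewrite (addrC _ c); apply: lt_le_trans.
  have -> : s * nm (z - c) = nm (z - c) + `|M| + nm c + 1 by rewrite /s; field; rewrite gt_eqF.
  by have := ler_norm M; lra.
apply: (winding_inside cc (circle_closed c r)).
  by apply/traceP => t _; exact: circle_off.
by rewrite circle_winding // twopii_neq0.
Qed.

Lemma circle_admissible D c (r : R) : 0 < r -> (forall w, nm (w - c) <= r -> D w) ->
  admissible_contour D (circle c r).
Proof.
move=> r0 HD; have cc := circle_curve c r0.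
have p0 : 0 < 2 * pi :> R by rewrite mulr_gt0 ?pi_gt0.
split.
- split; last 2 first.
  + exact: circle_closed.
  + move=> s t; rewrite !in_itv /= => /andP[s0 s1] /andP[t0 t1] /addrI /mulfI E.
    have rC : r%:C != 0 by rewrite -nm_gt0 nm_real normr_gt0 gt_eqF.
    have {}E := E rC.
    have : cis (2 * pi * (s - t)) = 1.
      apply: (mulIf (cis_neq0 (2 * pi * t))).
      by rewrite -cisD -mulrDr subrK E mul1r.
    rewrite /cis => -[ct _].
    have := circle_sym ct; rewrite normrM (gtr0_norm p0) -[ltRHS]mulr1 ltr_pM2l //.
    rewrite ltr_norml => /(_ _) H; apply/eqP; rewrite -subr_eq0.
    have : 2 * pi * (s - t) == 0 by apply/eqP; apply: H; apply/andP; split; lra.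
    by rewrite mulf_eq0 (gt_eqF p0).
  apply: continuous_subspaceT => t; apply/cvg_nmP => e e0.
  have C0 : 0 < 4 * pi * r by rewrite !mulr_gt0 // pi_gt0.
  exists (e / (4 * pi * r)); first by rewrite /= divr_gt0.
  move=> s /=; rewrite distrC ltr_pdivlMr // mulrC => st.
  exact: le_lt_trans (circle_lipschitz c s t r0) st.
- exists (4 * pi * r)%:C => s part.
  have tP : tagged_partition (s, s).
    split => // i iP /=; have [pth _] := part.
    by rewrite lexx andbT ltW //; move/(pathP 1) : pth => /(_ i iP).
  have [X01 X1 _ _] := tagged_partitionP tP.
  under eq_bigr do rewrite normE.
  rewrite -rmorph_sum /= lecR.
  have -> : 4 * pi * r = 4 * pi * r * 1 - 4 * pi * r * 0 by rewrite mulr0 mulr1 subr0.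
  rewrite -(dominated_sum (fun t => 4 * pi * r * t) tP) /=.
  rewrite big_nat [leRHS]big_nat; apply: ler_sum => i /andP[_ iP].
  have /andP[a _] := X1 i; have /andP[_ b] := X1 i.+1.
  by apply: cc.2 => //; exact: X01.
- move=> w /circle_inside wr; rewrite -(circle_winding r0 (wr r0)).
  by congr contour_integral; apply/funext => t; rewrite mul1r expr1.
- by move=> z [t _ <-]; apply: HD; rewrite circle_dist.
by move=> w /circle_inside wr; apply: HD; exact: ltW (wr r0).
Qed.

End Contours.

(** * Continuous Gateaux-differentiable functions are holomorphic *)

Section SegmentIntegral.
Variable R : realType.
Implicit Types (u U V : R -> R[i]).

Definition primitive_on (a b : R) U u := forall x, a <= x <= b -> forall e : R, 0 < e ->
  exists2 r : R, 0 < r & forall y, a <= y <= b -> `|y - x| < r ->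
    nm (U y - U x - (y - x)%:C * u x) <= e * `|y - x|.

Definition continuous_on (a b : R) u := forall x, a <= x <= b -> forall e : R, 0 < e ->
  exists2 r : R, 0 < r & forall y, a <= y <= b -> `|y - x| < r -> nm (u y - u x) <= e.

Lemma primitive_onS a b c d U u : a <= c -> d <= b -> primitive_on a b U u -> primitive_on c d U u.
Proof.
move=> ac db H x /andP[cx xd] e e0.
have [r r0 Hr] := H x (introT andP (conj (le_trans ac cx) (le_trans xd db))) e e0.
exists r => // y /andP[cy yd]; apply: Hr.
by rewrite (le_trans ac cy) (le_trans yd db).
Qed.

(** The segment is rescaled to [[0, 1]], where [right_mean_value] applies. *)
Lemma primitive_on_le a b U u (B : R) : a <= b -> primitive_on a b U u ->
  (forall x, a <= x <= b -> nm (u x) <= B) -> nm (U b - U a) <= B * (b - a).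
Proof.
rewrite le_eqVlt => /orP[/eqP<- _ _|ab H HB]; first by rewrite !subrr nm0 mulr0.
have l0 : 0 < b - a by rewrite subr_gt0.
have B0 : 0 <= B by apply: le_trans (HB a _); rewrite ?nm_ge0 // lexx ltW.
have co s : 0 <= s <= 1 -> a <= a + s * (b - a) <= b.
  move=> /andP[s0 s1]; rewrite lerDl mulr_ge0 ?(ltW l0) //=.
  by rewrite -lerBrDl ler_piMl // ltW.
pose J s := U (a + s * (b - a)).
have step s : 0 <= s <= 1 -> forall e : R, 0 < e -> exists2 r, 0 < r &
    forall t, 0 <= t <= 1 -> `|t - s| < r -> nm (J t - J s) <= (B + e) * (b - a) * `|t - s|.
  move=> s01 e e0; have [r r0 Hr] := H _ (co s s01) e e0.
  exists (r / (b - a)); first by rewrite divr_gt0.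
  move=> t t01 ts.
  have E : a + t * (b - a) - (a + s * (b - a)) = (t - s) * (b - a) by ring.
  have := Hr _ (co t t01); rewrite E normrM (gtr0_norm l0) -ltr_pdivlMr // => /(_ ts) K.
  have -> : J t - J s = (J t - J s - ((t - s) * (b - a))%:C * u (a + s * (b - a))) +
     ((t - s) * (b - a))%:C * u (a + s * (b - a)) by rewrite subrK.
  rewrite (le_trans (nmD _ _)) // nmM nm_real normrM (gtr0_norm l0).
  have -> : (B + e) * (b - a) * `|t - s| = e * (`|t - s| * (b - a)) + `|t - s| * (b - a) * B by ring.
  by rewrite lerD // ler_wpM2l ?HB ?co // mulr_ge0 // ltW.
have -> : U b - U a = J 1 - J 0 by rewrite /J mul1r mul0r addr0 (addrC a) subrK.
apply: right_mean_value; first by rewrite mulr_ge0 // ltW.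
- move=> s s01 e e0; have [r r0 Hr] := step s s01 1 ltr01.
  have C0 : 0 < (B + 1) * (b - a) by rewrite mulr_gt0 // ltr_wpDl.
  exists (Num.min r (e / ((B + 1) * (b - a)))); first by rewrite lt_min r0 divr_gt0.
  move=> t t01; rewrite lt_min => /andP[tr te].
  by rewrite (le_trans (Hr t t01 tr)) // mulrC -ler_pdivlMr // ltW.
move=> s /andP[s0 s1] e e0.
have [r r0 Hr] := step s (introT andP (conj s0 (ltW s1))) (e / (b - a)) (divr_gt0 e0 l0).
exists r => // t st tr t1.
have ts : `|t - s| = t - s by rewrite ger0_norm // subr_ge0.
have := Hr t _ _; rewrite ts (le_trans s0 st) t1 => /(_ isT) K.
apply: (le_trans (K _)); first by lra.
by rewrite mulrDl divfK ?gt_eqF.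
Qed.

Lemma primitive_onB a b U V u w : primitive_on a b U u -> primitive_on a b V w ->
  primitive_on a b (fun x => U x - V x) (fun x => u x - w x).
Proof.
move=> H1 H2 x xab e e0; have e20 : 0 < e / 2 by rewrite divr_gt0.
have [r1 r10 Hr1] := H1 x xab _ e20; have [r2 r20 Hr2] := H2 x xab _ e20.
exists (Num.min r1 r2); first by rewrite lt_min r10.
move=> y yab; rewrite lt_min => /andP[y1 y2].
have -> : U y - V y - (U x - V x) - (y - x)%:C * (u x - w x) =
  (U y - U x - (y - x)%:C * u x) - (V y - V x - (y - x)%:C * w x) by ring.
rewrite (le_trans (nmD _ _)) // nmN [e]splitr mulrDl lerD //; [exact: Hr1|exact: Hr2].
Qed.

Lemma primitive_on_affine a b (p q : R[i]) :
  primitive_on a b (fun x => p * x%:C + q * (x ^+ 2)%:C / 2) (fun x => p + x%:C * q).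
Proof.
move=> x xab e e0.
have C0 : 0 < nm q + 1 by rewrite ltr_wpDl ?nm_ge0.
exists (e / (nm q + 1)); first by rewrite divr_gt0.
move=> y yab; rewrite ltr_pdivlMr // => yx.
have alg (X Y P Q : R[i]) : P * Y + Q * Y ^+ 2 / 2 - (P * X + Q * X ^+ 2 / 2) - (Y - X) * (P + X * Q) =
   Q * (Y - X) / 2 * (Y - X) by field.
rewrite !rmorphXn rmorphB /= alg -rmorphB nmM nm_real ler_wpM2r // !nmM nm_real nmV nm_nat.
rewrite ler_pdivrMr //; apply: (@le_trans _ _ e); last by rewrite ler_pMr // ler1n.
by rewrite (le_trans _ (ltW yx)) // mulrC ler_wpM2l // lerDl.
Qed.

(** The integral is taken from -1 and considered up to 2, so that the ends of [[0, 1]] are interior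
    points and the derivative there is two-sided. *)
Lemma real_primitive (u : R -> R) : continuous u ->
  exists U : R -> R, forall x : R, 0 <= x <= 1 -> is_derive x (1 : R) U (u x).
Proof.
move=> cu; exists (fun x => \int[lebesgue_measure]_(t in `[-1, x]) u t)%R => x /andP[x0 x1].
have [] := @continuous_FTC1_closed R u (-1) x 2 _ _ _ (cu x); first by lra.
- apply: continuous_compact_integrable; first exact: segment_compact.
  exact: continuous_subspaceT.
- lra.
by move=> d1; rewrite derive1E => d2; exact: DeriveDef d1 d2.
Qed.

Lemma primitive_exists u : continuous_on 0 1 u -> exists U, primitive_on 0 1 U u.
Proof.
move=> cu.
(* Composition with the projection onto [[0, 1]] extends [u] continuously to the line. *)
pose k (x : R) : R := if x < 0 then 0 else if 1 < x then 1 else x.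
have k01 x : 0 <= k x <= 1.
  by rewrite /k; case: (ltP x 0) => ?; [|case: (ltP 1 x) => ?]; apply/andP; split; lra.
have kE x : 0 <= x <= 1 -> k x = x by move=> /andP[x0 x1]; rewrite /k ltNge x0 ltNge x1.
have kmono x y : x <= y -> 0 <= k y - k x <= y - x.
  rewrite /k => xy; case: (ltP x 0) => ?; case: (ltP y 0) => ?; try case: (ltP 1 x) => ?;
    try case: (ltP 1 y) => ?; apply/andP; split; lra.
have kL x y : `|k x - k y| <= `|x - y|.
  have [/kmono/andP[h1 h2]|/ltW/kmono/andP[h1 h2]] := leP x y.
    by rewrite distrC (distrC x) ger0_norm // (le_trans h2) // ler_norm.
  by rewrite ger0_norm // (le_trans h2) // ler_norm.
have real (h : R[i] -> R) : (forall x y : R[i], h x - h y = h (x - y)) ->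
    (forall z, `|h z| <= nm z) ->
    exists U : R -> R, forall x, 0 <= x <= 1 -> forall e : R, 0 < e -> exists2 r, 0 < r &
      forall y, `|y - x| < r -> `|U y - U x - (y - x) * h (u x)| <= e * `|y - x|.
  move=> hB hle.
  have [|U HU] := @real_primitive (fun x => h (u (k x))).
    move=> x; apply/cvgrPdist_le => e e0; have [r r0 Hr] := cu _ (k01 x) e e0.
    exists r => // y /= xy; rewrite hB (le_trans (hle _)) // nmB.
    by apply: Hr => //; rewrite (le_lt_trans (kL _ _)) // distrC.
  exists U => x x01 e e0.
  have /is_derive1_caratheodory [q [qE /cvgrPdist_le /(_ _ e0) [r r0 Hr] qx]] := HU x x01.
  exists r => // y yx; rewrite qE [q y * _]mulrC -mulrBr normrM mulrC ler_wpM2r //.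
  have -> : h (u x) = q x by rewrite qx kE.
  by rewrite distrC; apply: Hr; rewrite /= distrC.
have [||U1 H1] := real (@complex.Re R); [by move=> [? ?] [? ?]|exact: nm_le_Re|].
have [||U2 H2] := real (@complex.Im R); [by move=> [? ?] [? ?]|exact: nm_le_Im|].
exists (fun x => U1 x +i* U2 x) => x x01 e e0.
have e20 : 0 < e / 2 by rewrite divr_gt0.
have [r1 r10 Hr1] := H1 x x01 _ e20; have [r2 r20 Hr2] := H2 x x01 _ e20.
exists (Num.min r1 r2); first by rewrite lt_min r10.
move=> y _; rewrite lt_min => /andP[y1 y2].
have := Hr1 y y1; have := Hr2 y y2.
case: (u x) => p q /= K2 K1.
have -> : U1 y +i* U2 y - (U1 x +i* U2 x) - (y - x)%:C * (p +i* q) =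
  (U1 y - U1 x - (y - x) * p) +i* (U2 y - U2 x - (y - x) * q).
  by apply/eqP; rewrite eq_complex /=; apply/andP; split; apply/eqP; ring.
by rewrite (le_trans (nm_le_ReIm _)) //= [e]splitr [leRHS]mulrDl lerD.
Qed.

(** A primitive is chosen once for each [u]; additivity and reversal of the limits of integration
    thus become identities of differences. *)
Definition seg u (a b : R) : R[i] :=
  let U := xget (fun=> 0) [set U | primitive_on 0 1 U u] in U b - U a.

Lemma seg_split u a b c : seg u a b + seg u b c = seg u a c.
Proof. by rewrite /seg; set U := xget _ _; ring. Qed.

Lemma segxx u a : seg u a a = 0.
Proof. by rewrite /seg subrr. Qed.

Lemma seg_rev u a b : seg u a b = - seg u b a.
Proof. by rewrite /seg opprB. Qed.

Lemma seg_approx u (a b : R) (p q : R[i]) (e : R) : continuous_on 0 1 u ->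
  0 <= a -> a <= b -> b <= 1 ->
  (forall x, a <= x <= b -> nm (u x - (p + x%:C * q)) <= e) ->
  nm (seg u a b - (p * (b - a)%:C + q * (b ^+ 2 - a ^+ 2)%:C / 2)) <= e * (b - a).
Proof.
move=> cu a0 ab b1 ue; rewrite /seg.
have ex : [set U | primitive_on 0 1 U u] !=set0 by exact: primitive_exists.
case: xgetP => [U _ HU|/(_ _) nU]; last by have [U /nU] := ex.
have := primitive_onB (primitive_onS a0 b1 HU) (@primitive_on_affine a b p q).
move=> /(primitive_on_le ab) /(_ ue); congr (nm _ <= _).
by rewrite !rmorphB /=; ring.
Qed.

Lemma seg_eq u V a b : continuous_on 0 1 u -> 0 <= a -> a <= b -> b <= 1 ->
  primitive_on a b V u -> seg u a b = V b - V a.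
Proof.
move=> cu a0 ab b1 HV; rewrite /seg.
have ex : [set U | primitive_on 0 1 U u] !=set0 by exact: primitive_exists.
case: xgetP => [U _ HU|/(_ _) nU]; last by have [U /nU] := ex.
have := primitive_onB (primitive_onS a0 b1 HU) HV.
move=> P; have H := @primitive_on_le a b _ _ 0 ab P.
apply/eqP; rewrite -subr_eq0 -nm_eq0 eq_le nm_ge0 andbT.
have -> : U b - U a - (V b - V a) = U b - V b - (U a - V a) by ring.
by rewrite -[leRHS](mul0r (b - a)) H // => x _; rewrite subrr nm0.
Qed.

End SegmentIntegral.

(** * Baire's theorem and nested rectangles *)

Section Nested.
Variable R : realType.

Lemma iterate_choice (T : Type) (Q : T -> Prop) (S : T -> T -> Prop) (x0 : T) :
  Q x0 -> (forall x, Q x -> exists2 y, S x y & Q y) ->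
  exists2 u : nat -> T, u 0%N = x0 & forall n, Q (u n) /\ S (u n) (u n.+1).
Proof.
move=> Q0 H.
have [|f Hf] := @choice T T (fun x y => Q x -> S x y /\ Q y).
  move=> x; have [Qx|nQx] := pselect (Q x); last by exists x => /nQx.
  by have [y Sy Qy] := H x Qx; exists y.
exists (fun n => iter n f x0) => // n.
have Qn k : Q (iter k f x0) by elim: k => //= k /Hf[].
by split=> //; have [] := Hf _ (Qn n).
Qed.

Lemma half_pow_small (r e : R) : 0 < r -> 0 < e -> exists N, forall n, (N <= n)%N -> r / 2 ^+ n <= e.
Proof.
move=> r0 e0; have re : 0 <= r / e by rewrite divr_ge0 ?ltW.
exists (Num.bound (r / e)) => n Nn.
have n2 : 0 < 2 ^+ n :> R by rewrite exprn_gt0.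
rewrite ler_pdivrMr // mulrC -ler_pdivrMr //.
apply: le_trans (ltW (archi_boundP re)) _.
apply: (@le_trans _ _ (n%:R)); first by rewrite ler_nat.
by rewrite -natrX ler_nat ltnW // ltn_expl.
Qed.

(** If no portion of [K] lay in a single [E n], there would be nested discs centred in [K] with
    radii at most [r0 / 2 ^+ n], the next disc always avoiding [E n] on [K]; their limit point would
    be in [K] and in no [E n]. *)
Lemma baire_complex (K : R[i] -> Prop) (E : nat -> R[i] -> Prop) z0 (r0 : R) :
  K z0 -> 0 < r0 ->
  (forall y, nm (y - z0) < r0 ->
     (forall r : R, 0 < r -> exists2 w, K w & nm (w - y) < r) -> K y) ->
  (forall n y, nm (y - z0) < r0 -> K y -> ~ E n y ->
     exists2 r : R, 0 < r & forall w, K w -> nm (w - y) < r -> ~ E n w) ->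
  (forall y, nm (y - z0) < r0 -> K y -> exists n, E n y) ->
  exists n x (r : R), [/\ K x, 0 < r, forall w, nm (w - x) < r -> nm (w - z0) < r0 &
    forall w, K w -> nm (w - x) < r -> E n w].
Proof.
move=> Kz0 r00 clK clE cov; apply: contrapT => H.
have bad n x (r : R) : K x -> 0 < r -> (forall w, nm (w - x) < r -> nm (w - z0) < r0) ->
    exists w, [/\ K w, nm (w - x) < r & ~ E n w].
  move=> Kx rp sub; apply: contrapT => nw; apply: H; exists n, x, r; split => // w Kw wx.
  by apply: contrapT => nE; apply: nw; exists w.
pose Q (s : nat * (R[i] * R)) := [/\ K s.2.1, 0 < s.2.2,
   s.2.2 <= r0 / 2 ^+ s.1 & forall w, nm (w - s.2.1) < s.2.2 -> nm (w - z0) < r0].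
pose S (s s' : nat * (R[i] * R)) := [/\ s'.1 = s.1.+1,
   forall w, nm (w - s'.2.1) <= s'.2.2 -> nm (w - s.2.1) < s.2.2 &
   forall w, K w -> nm (w - s'.2.1) <= s'.2.2 -> ~ E s.1 w].
have Q0 : Q (0%N, (z0, r0)) by split => //=; rewrite expr0 divr1.
have [|u u0 Hu] := @iterate_choice _ Q S _ Q0.
  move=> [n [x r]] [/= Kx rp rn sub]; have [w [Kw wx nE]] := bad n x r Kx rp sub.
  have [q q0 Hq] := clE n w (sub w wx) Kw nE.
  pose m := Num.min q (r - nm (w - x)) / 2.
  have [mq mr] : m < q /\ m < r - nm (w - x).
    have : 0 < Num.min q (r - nm (w - x)) by rewrite lt_min q0 subr_gt0.
    have : Num.min q (r - nm (w - x)) <= q by rewrite ge_min lexx.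
    have : Num.min q (r - nm (w - x)) <= r - nm (w - x) by rewrite ge_min lexx orbT.
    by rewrite /m; split; lra.
  have m0 : 0 < m by rewrite divr_gt0 // lt_min q0 subr_gt0.
  have inb v : nm (v - w) <= m -> nm (v - x) < r.
    by move=> vw; have := nm_triangle w v x; lra.
  exists (n.+1, (w, m)).
    by split=> //= v Kv vw; apply: Hq => //; exact: le_lt_trans mq.
  split=> //=; last by move=> v vw; apply: sub; apply: inb; exact: ltW.
  have mle : m <= r / 2.
    have : Num.min q (r - nm (w - x)) <= r - nm (w - x) by rewrite ge_min lexx orbT.
    by have := nm_ge0 (w - x); rewrite /m; lra.
  by rewrite (le_trans mle) // exprSr invfM mulrA ler_pM2r // invr_gt0.
pose x n := (u n).2.1; pose r n := (u n).2.2.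
have un n : (u n).1 = n by elim: n => [|n IH]; [rewrite u0|have [_ []] := Hu n; rewrite IH].
have rn n : r n <= r0 / 2 ^+ n by have [[_ _ + _] _] := Hu n; rewrite un.
have rp n : 0 < r n by have [[]] := Hu n.
have inball n w : nm (w - x n.+1) <= r n.+1 -> nm (w - x n) < r n by have [_ [_ + _]] := Hu n; apply.
have inballs n k w : nm (w - x (k + n)%N) <= r (k + n)%N -> nm (w - x n) <= r n.
  by elim: k => // k IH h; apply: IH; apply: ltW; exact: inball.
have xx n k : nm (x (k + n)%N - x n) <= r n by apply: (inballs n k); rewrite subrr nm0 ltW.
have [e e0|l Hl] := @cauchy_complex R x.
  have e20 : 0 < e / 2 by rewrite divr_gt0.
  have [N HN] := half_pow_small r00 e20; exists N => i j Ni Nj.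
  rewrite (le_trans (nm_triangle (x N) _ _)) // (nmB (x N)) [e]splitr lerD //.
    by rewrite -(subnK Ni) (le_trans (xx _ _)) // (le_trans (rn _)) // HN.
  by rewrite -(subnK Nj) (le_trans (xx _ _)) // (le_trans (rn _)) // HN.
have lx n : nm (l - x n) <= r n.
  apply/ler_addgt0Pr => e e0; have [N HN] := Hl e e0.
  have := nm_triangle (x (N + n)%N) l (x n); have := xx n N.
  by have := HN (N + n)%N (leq_addr _ _); rewrite nmB; lra.
have lz : nm (l - z0) < r0.
  by have := inball 0%N l (lx 1%N); rewrite /x /r u0.
have Kl : K l.
  apply: clK => // e e0; have [N HN] := Hl e e0.
  have [m0 m1] : 0 < e / 2 /\ e / 2 < e by lra.
  have [N' HN'] := Hl _ m0.
  by exists (x N'); [have [[]] := Hu N'|rewrite (le_lt_trans (HN' _ _))].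
have [n En] := cov l lz Kl.
by have [_ [_ _ /(_ l Kl (lx n.+1))]] := Hu n; rewrite un.
Qed.

(** Bisection in both coordinates at once. The index of [P] allows the selected property to be
    sharpened from stage to stage. *)
Lemma nested_rectangles (P : nat -> R -> R -> R -> R -> Prop) a b c d :
  a <= b -> c <= d -> P 0%N a b c d ->
  (forall n a b c d, a <= b -> c <= d -> P n a b c d -> exists a' b' c' d',
     [/\ a <= a' /\ a' <= b', b' <= b, c <= c' /\ c' <= d', d' <= d &
        [/\ b' - a' <= (b - a) / 2, d' - c' <= (d - c) / 2 & P n.+1 a' b' c' d']]) ->
  exists s t, forall n, exists a' b' c' d',
    [/\ a <= a' <= s, s <= b' <= b, c <= c' <= t, t <= d' <= d &
       [/\ b' - a' <= (b - a) / 2 ^+ n, d' - c' <= (d - c) / 2 ^+ n & P n a' b' c' d']].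
Proof.
move=> ab cd P0 H.
pose T : Type := (nat * ((R * R) * (R * R)))%type.
pose Q (x : T) := [/\ x.2.1.1 <= x.2.1.2, x.2.2.1 <= x.2.2.2,
   x.2.1.2 - x.2.1.1 <= (b - a) / 2 ^+ x.1, x.2.2.2 - x.2.2.1 <= (d - c) / 2 ^+ x.1 &
   P x.1 x.2.1.1 x.2.1.2 x.2.2.1 x.2.2.2].
pose S (x y : T) := [/\ y.1 = x.1.+1, x.2.1.1 <= y.2.1.1, y.2.1.2 <= x.2.1.2,
   x.2.2.1 <= y.2.2.1 & y.2.2.2 <= x.2.2.2].
have Q0 : Q (0%N, ((a, b), (c, d))) by split => //=; rewrite expr0 divr1.
have [|u u0 Hu] := @iterate_choice T Q S _ Q0.
  move=> [n [[a1 b1] [c1 d1]]] [/= ab1 cd1 sz1 sz2 Pn].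
  have [a' [b' [c' [d' [[h1 h2] h3 [h4 h5] h6 [h7 h8 h9]]]]]] := H n a1 b1 c1 d1 ab1 cd1 Pn.
  exists (n.+1, ((a', b'), (c', d'))); split => //=.
    by rewrite (le_trans h7) // exprSr invfM mulrA ler_pM2r // invr_gt0.
  by rewrite (le_trans h8) // exprSr invfM mulrA ler_pM2r // invr_gt0.
have un n : (u n).1 = n by elim: n => [|n IH]; [rewrite u0|have [_ []] := Hu n; rewrite IH].
have mono (A B : nat -> R) : (forall n, A n <= B n) -> (forall n, A n <= A n.+1) ->
    (forall n, B n.+1 <= B n) -> exists s, forall n, A n <= s <= B n.
  move=> AB mA mB.
  have mA' i k : A i <= A (k + i)%N by elim: k => // k IH; exact: le_trans (mA _).
  have mB' i k : B (k + i)%N <= B i by elim: k => // k IH; exact: le_trans (mB _) _.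
  have le i j : A i <= B j.
    by apply: le_trans (mA' i j) _; apply: le_trans (AB _) _; rewrite addnC.
  exists (sup (range A)) => n; apply/andP; split.
    by apply: ub_le_sup; [exists (B 0%N) => _ [i _ <-]|exists n].
  by apply: ge_sup; [exists (A 0%N); exists 0%N|move=> _ [i _ <-]].
have [|n||s Hs] := mono (fun n => (u n).2.1.1) (fun n => (u n).2.1.2).
- by move=> n; have [[]] := Hu n.
- by have [_ []] := Hu n.
- by move=> n; have [_ []] := Hu n.
have [|n||t Ht] := mono (fun n => (u n).2.2.1) (fun n => (u n).2.2.2).
- by move=> n; have [[]] := Hu n.
- by have [_ []] := Hu n.
- by move=> n; have [_ []] := Hu n.
exists s, t => n; have [[_ _ h1 h2 h3] _] := Hu n.
have /andP[s1 s2] := Hs n; have /andP[t1 t2] := Ht n.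
have [b1 b2 b3 b4] : [/\ a <= (u n).2.1.1, (u n).2.1.2 <= b, c <= (u n).2.2.1 & (u n).2.2.2 <= d].
  elim: n {h1 h2 h3 s1 s2 t1 t2} => [|n [i1 i2 i3 i4]]; first by rewrite u0.
  have [_ [_ j1 j2 j3 j4]] := Hu n.
  by split; [exact: le_trans j1|exact: le_trans j2 _|exact: le_trans j3|exact: le_trans j4 _].
exists (u n).2.1.1, (u n).2.1.2, (u n).2.2.1, (u n).2.2.2.
by rewrite un in h1 h2 h3; split; rewrite ?b1 ?b2 ?b3 ?b4 ?s1 ?s2 ?t1 ?t2.
Qed.

End Nested.

(** * Boundary integrals of parallelograms *)

Section Rectangles.
Variable R : realType.
Variables (f : R -> R -> R[i]) (d1 d2 : R[i]).

(** For [f s t = F (z + s d1 + t d2)] this is the integral of [F] around a parallelogram, written in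
    the parameters along its sides. *)
Definition rect a b c d : R[i] :=
  d1 * seg (fun s => f s c) a b + d2 * seg (f b) c d
  - d1 * seg (fun s => f s d) a b - d2 * seg (f a) c d.

Lemma rect_hsplit a b x c d : rect a x c d + rect x b c d = rect a b c d.
Proof.
rewrite /rect -(seg_split (fun s => f s c) a x b) -(seg_split (fun s => f s d) a x b).
by move: (seg _ _ _) (seg _ _ _) (seg _ _ _) => *; ring.
Qed.

Lemma rect_vsplit a b c y d : rect a b c y + rect a b y d = rect a b c d.
Proof.
rewrite /rect -(seg_split (f a) c y d) -(seg_split (f b) c y d).
by move: (seg _ _ _) (seg _ _ _) (seg _ _ _) => *; ring.
Qed.

Lemma rect_hrev a b c d : rect b a c d = - rect a b c d.
Proof.
rewrite /rect (seg_rev (fun s => f s c) b) (seg_rev (fun s => f s d) b).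
by move: (seg _ _ _) (seg _ _ _) (seg _ _ _) => *; ring.
Qed.

Lemma rect_vrev a b c d : rect a b d c = - rect a b c d.
Proof.
rewrite /rect (seg_rev (f a) d) (seg_rev (f b) d).
by move: (seg _ _ _) (seg _ _ _) (seg _ _ _) => *; ring.
Qed.

Hypothesis cf : forall e : R, 0 < e -> exists2 r : R, 0 < r & forall s t s' t',
  0 <= s <= 1 -> 0 <= t <= 1 -> 0 <= s' <= 1 -> 0 <= t' <= 1 ->
  `|s - s'| <= r -> `|t - t'| <= r -> nm (f s t - f s' t') <= e.

Lemma continuous_on_row t : 0 <= t <= 1 -> continuous_on 0 1 (fun s => f s t).
Proof.
move=> t01 x x01 e e0; have [r r0 Hr] := cf e0; exists r => // y y01 yx.
by apply: Hr => //; [exact: ltW|rewrite subrr normr0 ltW].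
Qed.

Lemma continuous_on_col s : 0 <= s <= 1 -> continuous_on 0 1 (f s).
Proof.
move=> s01 x x01 e e0; have [r r0 Hr] := cf e0; exists r => // y y01 yx.
by apply: Hr => //; [rewrite subrr normr0 ltW|exact: ltW].
Qed.

(** An affine function of the position [s d1 + t d2] has boundary integral 0, so only the error
    enters, multiplied by the perimeter. *)
Lemma rect_approx a b c d (p q : R[i]) (e : R) :
  0 <= a -> a <= b -> b <= 1 -> 0 <= c -> c <= d -> d <= 1 ->
  (forall s t, a <= s <= b -> c <= t <= d ->
     nm (f s t - (p + (s%:C * d1 + t%:C * d2) * q)) <= e) ->
  nm (rect a b c d) <= e * (2 * nm d1 * (b - a) + 2 * nm d2 * (d - c)).
Proof.
move=> a0 ab b1 c0 cd dd H.
have [a01 b01 c01 d01] : [/\ 0 <= a <= 1, 0 <= b <= 1, 0 <= c <= 1 & 0 <= d <= 1].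
  by split; apply/andP; split; lra.
have aab : a <= a <= b by rewrite lexx.
have bab : a <= b <= b by rewrite lexx andbT.
have ccd : c <= c <= d by rewrite lexx.
have dcd : c <= d <= d by rewrite lexx andbT.
have row t : c <= t <= d -> 0 <= t <= 1 ->
    nm (seg (fun s => f s t) a b - ((p + t%:C * d2 * q) * (b - a)%:C + d1 * q * (b ^+ 2 - a ^+ 2)%:C / 2)) <= e * (b - a).
  move=> tcd t01; apply: seg_approx => //; first exact: continuous_on_row.
  move=> x xab; have -> : p + t%:C * d2 * q + x%:C * (d1 * q) = p + (x%:C * d1 + t%:C * d2) * q by ring.
  exact: H.
have col s : a <= s <= b -> 0 <= s <= 1 ->
    nm (seg (f s) c d - ((p + s%:C * d1 * q) * (d - c)%:C + d2 * q * (d ^+ 2 - c ^+ 2)%:C / 2)) <= e * (d - c).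
  move=> sab s01; apply: seg_approx => //; first exact: continuous_on_col.
  move=> x xcd; have -> : p + s%:C * d1 * q + x%:C * (d2 * q) = p + (s%:C * d1 + x%:C * d2) * q by ring.
  exact: H.
have r1 := row c ccd c01; have r2 := row d dcd d01.
have r3 := col a aab a01; have r4 := col b bab b01.
rewrite /rect; move: r1 r2 r3 r4; rewrite !rmorphB !rmorphXn /=.
move: (seg (fun s => f s c) a b) (seg (fun s => f s d) a b) (seg (f a) c d) (seg (f b) c d) => S1 S2 S3 S4.
set E1 := S1 - _; set E2 := S2 - _; set E3 := S3 - _; set E4 := S4 - _ => r1 r2 r3 r4.
have -> : d1 * S1 + d2 * S4 - d1 * S2 - d2 * S3 = d1 * E1 + d2 * E4 + d1 * - E2 + d2 * - E3.
  rewrite /E1 /E2 /E3 /E4.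
  move: (a%:C) (b%:C) (c%:C) (d%:C) => a' b' c' d'.
  by field.
have n1 : nm (d1 * E1) <= nm d1 * (e * (b - a)) by rewrite nmM ler_wpM2l ?nm_ge0.
have n2 : nm (d2 * E4) <= nm d2 * (e * (d - c)) by rewrite nmM ler_wpM2l ?nm_ge0.
have n3 : nm (d1 * - E2) <= nm d1 * (e * (b - a)) by rewrite nmM nmN ler_wpM2l ?nm_ge0.
have n4 : nm (d2 * - E3) <= nm d2 * (e * (d - c)) by rewrite nmM nmN ler_wpM2l ?nm_ge0.
have := nmD (d1 * E1 + d2 * E4 + d1 * - E2) (d2 * - E3).
have := nmD (d1 * E1 + d2 * E4) (d1 * - E2).
have := nmD (d1 * E1) (d2 * E4).
nra.
Qed.

Variable K : R -> R -> Prop.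
Hypothesis loc : forall s t, 0 <= s <= 1 -> 0 <= t <= 1 -> ~ K s t ->
  exists2 r : R, 0 < r & forall a b c d, 0 <= a -> a <= b -> b <= 1 -> 0 <= c -> c <= d -> d <= 1 ->
    `|a - s| < r -> `|b - s| < r -> `|c - t| < r -> `|d - t| < r -> rect a b c d = 0.

(** Goursat's bisection: a nonzero integral passes to some quarter at every stage, down to a point
    outside [K], near which [loc] makes it 0. *)
Lemma rect_free a b c d : 0 <= a -> a <= b -> b <= 1 -> 0 <= c -> c <= d -> d <= 1 ->
  (forall s t, a <= s <= b -> c <= t <= d -> ~ K s t) -> rect a b c d = 0.
Proof.
move=> a0 ab b1 c0 cd dd free; apply: contrapT => /eqP nz.
have [|s [t H]] := @nested_rectangles R (fun _ a b c d => rect a b c d != 0) a b c d ab cd nz.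
  move=> _ {}a {}b {}c {}d {a0 b1 c0 dd free} {}ab {}cd {}nz.
  pose m := (a + b) / 2; pose k := (c + d) / 2.
  have [m1 m2 k1 k2] : [/\ a <= m, m <= b, c <= k & k <= d] by rewrite /m /k; split; lra.
  have [z1|] := eqVneq (rect a m c k) 0; last first.
    by move=> z; exists a, m, c, k; split; rewrite ?lexx //; split => //; rewrite /m /k; lra.
  have [z2|] := eqVneq (rect a m k d) 0; last first.
    by move=> z; exists a, m, k, d; split; rewrite ?lexx //; split => //; rewrite /m /k; lra.
  have [z3|] := eqVneq (rect m b c k) 0; last first.
    by move=> z; exists m, b, c, k; split; rewrite ?lexx //; split => //; rewrite /m /k; lra.
  have [z4|] := eqVneq (rect m b k d) 0; last first.
    by move=> z; exists m, b, k, d; split; rewrite ?lexx //; split => //; rewrite /m /k; lra.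
  move: nz; rewrite -(rect_hsplit a b m) -(rect_vsplit a m c k) -(rect_vsplit m b c k).
  by rewrite z1 z2 z3 z4 !addr0 eqxx.
have [a' [b' [c' [d' [/andP[h1 h2] /andP[h3 h4] /andP[h5 h6] /andP[h7 h8] _]]]]] := H 0%N.
have s01 : 0 <= s <= 1 by apply/andP; split; lra.
have t01 : 0 <= t <= 1 by apply/andP; split; lra.
have [|r r0 Hr] := loc s01 t01; first by apply: free; apply/andP; split; lra.
have r20 : 0 < r / 2 by rewrite divr_gt0.
have l1 : 0 < b - a + 1 by lra.
have l2 : 0 < d - c + 1 by lra.
have [N1 HN1] := half_pow_small l1 r20; have [N2 HN2] := half_pow_small l2 r20.
have [a2 [b2 [c2 [d2' [/andP[g1 g2] /andP[g3 g4] /andP[g5 g6] /andP[g7 g8] [g9 g10 nz']]]]]] := H (maxn N1 N2).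
have x1 := HN1 _ (leq_maxl N1 N2); have x2 := HN2 _ (leq_maxr N1 N2).
have p0 : 0 < (2 ^+ maxn N1 N2)^-1 :> R by rewrite invr_gt0 exprn_gt0.
have y1 : b2 - a2 <= r / 2 by apply: le_trans x1; apply: le_trans g9 _; rewrite ler_pM2r //; lra.
have y2 : d2' - c2 <= r / 2 by apply: le_trans x2; apply: le_trans g10 _; rewrite ler_pM2r //; lra.
clear x1 x2 p0 g9 g10 l1 l2 h1 h2 h3 h4 h5 h6 h7 h8 HN1 HN2 H.
have in1 x y : x <= s -> s <= y -> y - x <= r / 2 -> `|x - s| < r /\ `|y - s| < r.
  by move=> *; rewrite !ltr_norml; split; apply/andP; split; lra.
have in2 x y : x <= t -> t <= y -> y - x <= r / 2 -> `|x - t| < r /\ `|y - t| < r.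
  by move=> *; rewrite !ltr_norml; split; apply/andP; split; lra.
have [k1 k2] := in1 _ _ g2 g3 y1; have [k3 k4] := in2 _ _ g6 g7 y2.
move/eqP: nz'; apply; apply: Hr => //; [exact: le_trans g1|exact: le_trans g3|exact: le_trans g4 _
  |exact: le_trans g5|exact: le_trans g7|exact: le_trans g8 _].
Qed.

(** The values are controlled only at points that have a point of [K] to their lower left. The other
    points form a lower left region free of [K], which is cut off column by column by means of
    [rect_free]. What remains lies above a descending staircase; its boundary is no longer than that
    of the square, and on it [f] is within [B + e] of the constant [c0], which integrates to 0. *)
Lemma rect_staircase a c h c0 (B : R) : 0 <= a -> 0 <= c -> 0 < h -> a + h <= 1 -> c + h <= 1 ->
  (forall s t, a <= s <= a + h -> c <= t <= c + h ->
    (exists s' t', [/\ K s' t', a <= s' <= s & c <= t' <= t]) -> nm (f s t - c0) <= B) ->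
  (exists s t, [/\ K s t, a <= s <= a + h & c <= t <= c + h]) ->
  nm (rect a (a + h) c (c + h)) <= B * (2 * nm d1 + 2 * nm d2) * h.
Proof.
move=> a0 c0' h0 ah ch HV [ks [kt [Kst ksQ ktQ]]].
have in01 lo y : 0 <= lo -> lo <= y -> y <= lo + h -> lo + h <= 1 -> 0 <= y <= 1.
  by move=> lo0 loy yh h1; rewrite (le_trans lo0 loy) (le_trans yh h1).
have cch : c <= c + h by rewrite lerDl ltW.
have aah : a <= a + h by rewrite lerDl ltW.
have B0 : 0 <= B.
  by apply: le_trans (nm_ge0 _) (HV ks kt ksQ ktQ _); exists ks, kt; rewrite !lexx !andbT;
    case/andP: ksQ => ->; case/andP: ktQ => ->.
have D0 : 0 <= (2 * nm d1 + 2 * nm d2) * h.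
  by rewrite mulr_ge0 ?(ltW h0) // addr_ge0 // mulr_ge0 // nm_ge0.
apply/ler_addgt0Pr => e' e'0.
pose e := e' / ((2 * nm d1 + 2 * nm d2) * h + 1).
have D1 : 0 < (2 * nm d1 + 2 * nm d2) * h + 1 by lra.
have e0 : 0 < e by rewrite divr_gt0.
suff main : nm (rect a (a + h) c (c + h)) <= (B + e) * (2 * nm d1 * h + 2 * nm d2 * h).
  apply: (le_trans main).
  have -> : (B + e) * (2 * nm d1 * h + 2 * nm d2 * h) =
     B * (2 * nm d1 + 2 * nm d2) * h + e * ((2 * nm d1 + 2 * nm d2) * h) by ring.
  rewrite lerD2l /e mulrAC ler_pdivrMr // ler_wpM2l ?(ltW e'0) // lerDl //.
have [r r0 Hr] := cf e0.
pose n := (Num.bound (h / r)).+1.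
have n0 : 0 < n%:R :> R by rewrite ltr0n.
pose w := h / n%:R.
have w0 : 0 < w by rewrite divr_gt0.
have wr : w <= r.
  rewrite /w ler_pdivrMr // mulrC -ler_pdivrMr //.
  have hr : 0 <= h / r by rewrite divr_ge0 ?ltW.
  by apply: (le_trans (ltW (archi_boundP hr))); rewrite ler_nat.
pose X (i : nat) : R := a + i%:R * w; pose Y (j : nat) : R := c + j%:R * w.
have XS i : X i.+1 = X i + w by rewrite /X -natr1; ring.
have YS i : Y i.+1 = Y i + w by rewrite /Y -natr1; ring.
have nw : n%:R * w = h by rewrite /w mulrC divfK // gt_eqF.
have Xn : X n = a + h by rewrite /X nw.
have Yn : Y n = c + h by rewrite /Y nw.
have Xm i j : (i <= j)%N -> X i <= X j by move=> ij; rewrite lerD2l ler_wpM2r ?(ltW w0) // ler_nat.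
have Ym i j : (i <= j)%N -> Y i <= Y j by move=> ij; rewrite lerD2l ler_wpM2r ?(ltW w0) // ler_nat.
have X0 : X 0%N = a by rewrite /X mul0r addr0.
have Y0 : Y 0%N = c by rewrite /Y mul0r addr0.
pose Free i j := forall s t, a <= s <= X i -> c <= t <= Y j -> ~ K s t.
(* [J i] is the height, in grid units, up to which the first [i.+1] columns contain no point of [K];
   at height 0 nothing is cut off. *)
have [J HJ] : exists J : nat -> nat, forall i, [/\ (J i <= n)%N, J i = 0%N \/ Free i.+1 (J i) &
    (J i < n)%N -> ~ Free i.+1 (J i).+1].
  suff ex i : exists j, [/\ (j <= n)%N, j = 0%N \/ Free i.+1 j & (j < n)%N -> ~ Free i.+1 j.+1].
    by have [J HJ] := choice ex; exists J.
  have A k : (exists j, [/\ (j < k)%N, j = 0%N \/ Free i.+1 j & ~ Free i.+1 j.+1]) \/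
      (k = 0%N \/ Free i.+1 k).
    elim: k => [|k [[j [jk F nF]]|IH]]; first by right; left.
      by left; exists j; split => //; exact: leq_trans jk _.
    have [F|nF] := pselect (Free i.+1 k.+1); first by right; right.
    by left; exists k.
  have [[j [jn F nF]]|F] := A n; first by exists j; split => //; exact: ltnW.
  by exists n; split => //; rewrite ltnn.
have [J1 J2 J3] : [/\ forall i, (J i <= n)%N, forall i, J i = 0%N \/ Free i.+1 (J i) &
   forall i, (J i < n)%N -> ~ Free i.+1 (J i).+1] by split=> i; have [] := HJ i.
have FreeS i j i' j' : (i' <= i)%N -> (j' <= j)%N -> Free i j -> Free i' j'.
  move=> ii jj F s t /andP[s1 s2] /andP[t1 t2]; apply: F; apply/andP; split => //.
    exact: le_trans s2 (Xm _ _ ii).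
  exact: le_trans t2 (Ym _ _ jj).
(* The height of the preceding step. With [H 0 = n] the left side of the square counts as a step
   like the others. *)
pose H i := if i is k.+1 then J k else n.
have JH i : (J i <= H i)%N.
  case: i => [|i] /=; first exact: J1.
  rewrite leqNgt; apply/negP => lt.
  have Jn : (J i < n)%N := leq_trans lt (J1 _).
  apply: (J3 i Jn); have [E|F] := J2 i.+1; first by rewrite E in lt.
  exact: FreeS F.
(* There is a point of [K] to the lower left only up to one mesh width. Moving [(x, y)] by that
   width, clipped at the square, makes [HV] applicable, and uniform continuity charges [e] for the
   move. *)
have close i x y : (i < n)%N -> (J i < n)%N -> X i <= x <= X i.+1 -> Y (J i) <= y <= Y n ->
    nm (f x y - c0) <= B + e.
  move=> iN Jn /andP[x1 x2] /andP[y1 y2].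
  have [s [t [/andP[s1 s2] [/andP[t1 t2] Ks]]]] : exists s t, [/\ a <= s <= X i.+1 &
      c <= t <= Y (J i).+1 /\ K s t].
    apply: contrapT => nE; apply: (J3 i Jn) => s t s1 t1 Ks; apply: nE.
    by exists s, t.
  pose x' := Num.min (x + w) (a + h); pose y' := Num.min (y + w) (c + h).
  have Xin : X i.+1 <= a + h by rewrite -Xn Xm.
  have Yin : Y (J i).+1 <= c + h by rewrite -Yn Ym.
  have ax : a <= x by rewrite -X0 (le_trans _ x1) // Xm.
  have cy : c <= y by rewrite -Y0 (le_trans _ y1) // Ym.
  have xah : x <= a + h by exact: le_trans x2 Xin.
  have ych : y <= c + h by rewrite -Yn.
  have xx' : x <= x' <= x + w.
    by rewrite le_min ge_min lexx /= andbT (le_trans x2 Xin) andbT lerDl ltW.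
  have yy' : y <= y' <= y + w.
    by rewrite le_min ge_min lexx /= andbT -Yn y2 andbT lerDl ltW.
  have x'h : x' <= a + h by rewrite ge_min lexx orbT.
  have y'h : y' <= c + h by rewrite ge_min lexx orbT.
  have sx' : s <= x' by rewrite le_min (le_trans s2 Xin) andbT (le_trans s2) // XS lerD2r.
  have ty' : t <= y' by rewrite le_min (le_trans t2 Yin) andbT (le_trans t2) // YS lerD2r.
  case/andP: xx' => xx1 xx2; case/andP: yy' => yy1 yy2.
  have F1 : nm (f x' y' - c0) <= B.
    apply: HV; [by rewrite (le_trans ax xx1)|by rewrite (le_trans cy yy1)|].
    by exists s, t; rewrite s1 t1 sx' ty'.
  have F2 : nm (f x y - f x' y') <= e.
    apply: Hr.
    - exact: (in01 a).
    - exact: (in01 c).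
    - exact: (in01 a _ a0 (le_trans ax xx1)).
    - exact: (in01 c _ c0' (le_trans cy yy1)).
    - by rewrite distrC ger0_norm ?subr_ge0 // lerBlDl (le_trans xx2) // lerD2l.
    - by rewrite distrC ger0_norm ?subr_ge0 // lerBlDl (le_trans yy2) // lerD2l.
  by have := nm_triangle (f x' y') (f x y) c0; lra.
(* Side integrals with the constant [c0] subtracted; [rectE] shows that a closed boundary does not
   notice the subtraction. *)
pose e1 t x y := seg (fun s => f s t) x y - c0 * (y - x)%:C.
pose e2 s x y := seg (f s) x y - c0 * (y - x)%:C.
have rectE x x' y y' : rect x x' y y' = d1 * e1 y x x' + d2 * e2 x' y y' - d1 * e1 y' x x' - d2 * e2 x y y'.
  rewrite /rect /e1 /e2; move: (seg _ _ _) (seg _ _ _) (seg _ _ _) (seg _ _ _) => *; ring.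
have Be : 0 <= B + e by lra.
have e1b t x y : 0 <= t <= 1 -> 0 <= x -> x <= y -> y <= 1 ->
    (forall s, x <= s <= y -> nm (f s t - c0) <= B + e) -> nm (e1 t x y) <= (B + e) * (y - x).
  move=> t01 x0 xy y1 Hs; have := @seg_approx R (fun s => f s t) x y c0 0 (B + e) (continuous_on_row t01) x0 xy y1.
  rewrite !mul0r addr0; apply => s sxy; rewrite mulr0 addr0; exact: Hs.
have e2b s x y : 0 <= s <= 1 -> 0 <= x -> x <= y -> y <= 1 ->
    (forall t, x <= t <= y -> nm (f s t - c0) <= B + e) -> nm (e2 s x y) <= (B + e) * (y - x).
  move=> s01 x0 xy y1 Hs; have := @seg_approx R (f s) x y c0 0 (B + e) (continuous_on_col s01) x0 xy y1.
  rewrite !mul0r addr0; apply => t txy; rewrite mulr0 addr0; exact: Hs.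
have Xr i : (i <= n)%N -> a <= X i <= a + h.
  by move=> iN; apply/andP; split; [rewrite -X0|rewrite -Xn]; exact: Xm.
have Yr i : (i <= n)%N -> c <= Y i <= c + h.
  by move=> iN; apply/andP; split; [rewrite -Y0|rewrite -Yn]; exact: Ym.
have colE i : (i < n)%N -> rect (X i) (X i.+1) c (c + h) = rect (X i) (X i.+1) (Y (J i)) (c + h).
  move=> iN; rewrite -(rect_vsplit _ _ c (Y (J i))).
  have /andP[p1 p2] := Xr i (ltnW iN); have /andP[p3 p4] := Xr i.+1 iN.
  have /andP[p5 p6] := Yr (J i) (J1 i).
  rewrite [X in X + _](_ : _ = 0) ?add0r //.
  have [E|F] := J2 i.
    by rewrite E Y0 /rect !segxx; move: (seg _ _ _) => *; ring.
  apply: (rect_free (le_trans a0 p1) (Xm _ _ (leqnSn i)) (le_trans p4 ah) c0' p5 (le_trans p6 ch)).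
  by move=> s t /andP[s1 s2] tt; apply: F => //; rewrite s2 andbT (le_trans p1).
pose S i := rect a (X i) c (c + h).
have SS i : S i.+1 = S i + rect (X i) (X i.+1) c (c + h) by rewrite /S rect_hsplit.
(* The integral over the first [i] columns, without the right side above the last step. The vertical
   contributions telescope because the staircase descends. *)
have claim i : (i <= n)%N -> nm (S i - d2 * e2 (X i) (Y (H i)) (c + h)) <=
    (B + e) * (2 * nm d1 * (X i - a) + nm d2 * (c + h - Y (H i))).
  elim: i => [_|i IH iN].
    rewrite /S X0 /H Yn /e2 !subrr !segxx mulr0 subrr mulr0 subr0 /rect !segxx.
    have -> : d1 * 0 + d2 * seg (f a) c (c + h) - d1 * 0 - d2 * seg (f a) c (c + h) = 0.
      by move: (seg _ _ _) => *; ring.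
    by rewrite nm0 !mulr0 addr0 mulr0.
  have {}IH := IH (ltnW iN).
  have /andP[p1 p2] := Xr i (ltnW iN); have /andP[p3 p4] := Xr i.+1 iN.
  have /andP[p5 p6] := Yr (J i) (J1 i).
  have Hin : (H i <= n)%N by case: (i) => //= *; exact: J1.
  have /andP[q5 q6] := Yr (H i) Hin.
  have JHY : Y (J i) <= Y (H i) by exact: Ym.
  have Xi : X i <= X i.+1 by exact: Xm.
  rewrite SS colE // rectE (_ : H i.+1 = J i) //.
  have e2s : e2 (X i) (Y (J i)) (c + h) = e2 (X i) (Y (J i)) (Y (H i)) + e2 (X i) (Y (H i)) (c + h).
    rewrite /e2 -(seg_split (f (X i)) (Y (J i)) (Y (H i)) (c + h)) !rmorphB /=.
    by move: (seg _ _ _) (seg _ _ _) ((Y (J i))%:C) ((Y (H i))%:C) ((c + h)%:C) => *; ring.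
  rewrite e2s.
  have alg (k1 k2 k3 k4 k5 k6 : R[i]) : k5 + (k1 + k4 - k2 - d2 * (k3 + k6)) - k4 = (k5 - d2 * k6) + k1 + - k2 + - (d2 * k3) by ring.
  rewrite alg //.
  (* If [J i = n], nothing is left of the column and its two horizontal sides cancel. *)
  have P1 : nm (d1 * e1 (Y (J i)) (X i) (X i.+1)) + nm (d1 * e1 (c + h) (X i) (X i.+1)) <= (B + e) * (2 * nm d1 * w) \/
     d1 * e1 (Y (J i)) (X i) (X i.+1) = d1 * e1 (c + h) (X i) (X i.+1).
    have [Jn|Jn] := ltnP (J i) n; last first.
      by right; have -> : J i = n; [apply/eqP; rewrite eqn_leq J1|rewrite Yn].
    left; have b1 : nm (e1 (Y (J i)) (X i) (X i.+1)) <= (B + e) * w.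
      have -> : w = X i.+1 - X i by rewrite XS; ring.
      apply: (e1b _ _ _ (in01 c _ c0' p5 p6 ch) (le_trans a0 p1) Xi (le_trans p4 ah)).
      by move=> s sX; apply: (close i) => //; rewrite lexx Ym.
    have b2 : nm (e1 (c + h) (X i) (X i.+1)) <= (B + e) * w.
      have -> : w = X i.+1 - X i by rewrite XS; ring.
      apply: (e1b _ _ _ (in01 c _ c0' cch (lexx _) ch) (le_trans a0 p1) Xi (le_trans p4 ah)).
      by move=> s sX; apply: (close i) => //; rewrite -Yn lexx Ym.
    rewrite !nmM; have := ler_wpM2l (nm_ge0 d1) b1; have := ler_wpM2l (nm_ge0 d1) b2; nra.
  have P2 : nm (d2 * e2 (X i) (Y (J i)) (Y (H i))) <= (B + e) * (nm d2 * (Y (H i) - Y (J i))).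
    rewrite nmM mulrCA ler_wpM2l ?nm_ge0 //.
    have [Jn|Jn] := ltnP (J i) n; last first.
      have E : J i = H i by apply/eqP; rewrite eqn_leq JH (leq_trans Hin Jn).
      by rewrite /e2 E segxx subrr mulr0 subrr nm0 mulr0.
    apply: (e2b _ _ _ (in01 a _ a0 p1 p2 ah) (le_trans c0' p5) JHY (le_trans q6 ch)).
    move=> t /andP[t1 t2]; apply: (close i) => //; first by rewrite lexx.
    by rewrite t1 (le_trans t2) // Ym.
  have -> : (B + e) * (2 * nm d1 * (X i.+1 - a) + nm d2 * (c + h - Y (J i))) =
    (B + e) * (2 * nm d1 * (X i - a) + nm d2 * (c + h - Y (H i))) + (B + e) * (2 * nm d1 * w)
    + (B + e) * (nm d2 * (Y (H i) - Y (J i))) by rewrite XS; ring.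
  apply: (le_trans (nmD _ _)); rewrite nmN; apply: lerD => //.
  case: P1 => [P1|->].
    have := nmD (S i - d2 * e2 (X i) (Y (H i)) (c + h) + d1 * e1 (Y (J i)) (X i) (X i.+1)) (- (d1 * e1 (c + h) (X i) (X i.+1))).
    have := nmD (S i - d2 * e2 (X i) (Y (H i)) (c + h)) (d1 * e1 (Y (J i)) (X i) (X i.+1)).
    rewrite nmN; lra.
  rewrite addrK; apply: (le_trans IH); rewrite lerDl; apply: mulr_ge0 => //.
  by apply: mulr_ge0; [apply: mulr_ge0 => //; exact: nm_ge0|exact: ltW].
have := claim n (leqnn n); rewrite /S Xn (_ : H n = J n.-1) //.
set j := J n.-1 => M1.
have M2 : nm (d2 * e2 (a + h) (Y j) (c + h)) <= (B + e) * (nm d2 * (c + h - Y j)).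
  have /andP[p5 p6] := Yr j (J1 _).
  rewrite nmM mulrCA ler_wpM2l ?nm_ge0 //.
  have [Jn|Jn] := ltnP j n; last first.
    have E : j = n by apply/eqP; rewrite eqn_leq J1.
    by rewrite /e2 E Yn segxx subrr mulr0 subrr nm0 mulr0.
  apply: (e2b _ _ _ (in01 a _ a0 aah (lexx _) ah) (le_trans c0' p5) p6 ch).
  move=> t tY; apply: (close n.-1) => //; last by rewrite Yn.
  by rewrite -Xn lexx andbT Xm.
have /andP[p5 p6] := Yr j (J1 _).
have := nmD (rect a (a + h) c (c + h) - d2 * e2 (a + h) (Y j) (c + h)) (d2 * e2 (a + h) (Y j) (c + h)).
rewrite subrK => M3; apply: (le_trans M3); apply: (le_trans (lerD M1 M2)).
have -> : a + h - a = h by ring.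
rewrite -mulrDr ler_wpM2l // -addrA lerD2l -mulrDr [2 * nm d2]mulrC -mulrA ler_wpM2l ?nm_ge0 //; lra.
Qed.

End Rectangles.

(** * Vanishing of the integrals over squares *)

Section Tiles.
Variable R : realType.

Fact half_complement (u : R) : u <= 4^-1 -> 2^-1 <= 1 - u.
Proof. by move=> *; lra. Qed.

Fact eighth_lt1 : ~ (1 <= 8^-1 :> R).
Proof. by move=> ?; lra. Qed.

Fact tile_dense (p u w e : R) : u <= p - e -> p - e <= u + e -> u <= w -> w <= u + e ->
  p - 2 * e <= w /\ w <= p.
Proof. by move=> *; split; lra. Qed.

Fact tile_bound (s x k p : R) : 0 < k -> x <= s -> s <= x + k -> x + k / 2 <= p -> p <= x + k ->
  s - p <= k /\ p - s <= k.
Proof. by move=> *; split; lra. Qed.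

Fact tile_grid (o k p T e : R) : k * (T * e) <= p - o + k * 1 -> p - o + k * 1 <= k * (T * e + e) ->
  o + k * (T * e - 1) <= p /\ p - (o + k * (T * e - 1)) <= e * k.
Proof. by move=> *; split; lra. Qed.

Fact tile_lower (x k p e q : R) : x + k / 2 <= p -> p - q <= e -> e <= k / 8 -> 0 < k -> x + e <= q.
Proof. by move=> *; lra. Qed.

Fact tile_cone (l e y u w u' w' : R) : 0 <= l -> u - 2 * e <= u' -> w - 2 * e <= w' ->
  y <= l * ((u - u') + (w - w')) -> y <= 4 * l * e.
Proof. by move=> l0 h1 h2 /le_trans; apply; rewrite (mulrC 4) -mulrA ler_wpM2l //; lra. Qed.

Fact tile_cone2 (l e y u w u' w' p q : R) : 0 <= l -> u - 2 * e <= u' -> w - 2 * e <= w' ->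
  p - u <= e -> q - w <= e -> y <= l * ((p - u') + (q - w')) -> y <= 6 * l * e.
Proof. by move=> l0 h1 h2 h3 h4 /le_trans; apply; rewrite (mulrC 6) -mulrA ler_wpM2l //; lra. Qed.

Fact tile_add (x y z u v w : R) : x <= y + z -> y <= 6 * u * v -> z <= 4 * u * v -> x <= 10 * u * v.
Proof. by move=> *; lra. Qed.

Fact tile_total (x y z w l d e : R) : x <= y + z -> y <= 10 * l * e -> z <= e -> w <= d * e ->
  x + w <= (10 * l + 1 + d) * e.
Proof. by move=> *; lra. Qed.

(** Dyadic subsquares of generation [m], described by descent from the large square; this suits
    inductions that compare a square with its four quarters. *)
Fixpoint subtile m (a c h a' c' h' : R) : Prop :=
  if m is m'.+1 then exists i j : bool,
    subtile m' (a + i%:R * (h / 2)) (c + j%:R * (h / 2)) (h / 2) a' c' h'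
  else [/\ a' = a, c' = c & h' = h].

Lemma subtile_trans m k a c h a' c' h' a2 c2 h2 : subtile m a c h a' c' h' ->
  subtile k a' c' h' a2 c2 h2 -> subtile (m + k) a c h a2 c2 h2.
Proof.
elim: m a c h => [|m IH] a c h /=; first by move=> [-> -> ->].
by move=> [i [j H]] H2; exists i, j; exact: IH.
Qed.

Lemma subtile_in m a c h a' c' h' : 0 < h -> subtile m a c h a' c' h' ->
  [/\ a <= a', a' + h' <= a + h, c <= c', c' + h' <= c + h & h' = h / 2 ^+ m].
Proof.
elim: m a c h => [|m IH] a c h h0 /=.
  by move=> [-> -> ->]; split; rewrite ?expr0 ?divr1.
move=> [i [j H]]; have h20 : 0 < h / 2 by rewrite divr_gt0.
have [h1 h2 h3 h4 h5] := IH _ _ _ h20 H.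
have bi (b : bool) : 0 <= b%:R * (h / 2) <= h / 2.
  by case: b; rewrite ?mul1r ?mul0r lexx ltW.
have /andP[i0 i1] := bi i; have /andP[j0 j1] := bi j.
split; try lra.
by rewrite h5 exprS invfM mulrA.
Qed.

Lemma subtile_point m a c h x y : 0 < h -> a <= x <= a + h -> c <= y <= c + h ->
  exists a' c' h', [/\ subtile m a c h a' c' h', a' <= x <= a' + h' & c' <= y <= c' + h'].
Proof.
elim: m a c h => [|m IH] a c h h0 xa yc; first by exists a, c, h.
have h20 : 0 < h / 2 by rewrite divr_gt0.
have pick (u z : R) : u <= z <= u + h -> exists i : bool,
    u + i%:R * (h / 2) <= z <= u + i%:R * (h / 2) + h / 2.
  move=> /andP[uz zu]; have [zm|mz] := leP z (u + h / 2).
    by exists false; rewrite mul0r addr0 uz.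
  by exists true; rewrite mul1r (ltW mz) -addrA -splitr.
have [i Hi] := pick a x xa; have [j Hj] := pick c y yc.
have [a' [c' [h' [H1 H2 H3]]]] := IH _ _ _ h20 Hi Hj.
by exists a', c', h'; split => //; exists i, j.
Qed.

Lemma finite_radius (n : nat) (Q : nat -> R -> Prop) :
  (forall k, (k <= n)%N -> exists2 r : R, 0 < r & forall h, 0 < h -> h < r -> Q k h) ->
  exists2 r : R, 0 < r & forall h, 0 < h -> h < r -> forall k, (k <= n)%N -> Q k h.
Proof.
elim: n => [|n IH] H.
  have [r r0 Hr] := H 0%N (leqnn 0); exists r => // h h0 hr k.
  by rewrite leqn0 => /eqP ->; exact: Hr.
have [|r r0 Hr] := IH; first by move=> k kn; apply: H; exact: leqW.
have [q q0 Hq] := H n.+1 (leqnn _).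
exists (Num.min r q); first by rewrite lt_min r0.
move=> h h0; rewrite lt_min => /andP[hr hq] k; rewrite leq_eqVlt => /orP[/eqP ->|].
  exact: Hq.
by rewrite ltnS; exact: Hr.
Qed.

Variables (f : R -> R -> R[i]) (d1 d2 : R[i]).
Let rect := rect f d1 d2.

Hypothesis cf : forall e : R, 0 < e -> exists2 r : R, 0 < r & forall s t s' t',
  0 <= s <= 1 -> 0 <= t <= 1 -> 0 <= s' <= 1 -> 0 <= t' <= 1 ->
  `|s - s'| <= r -> `|t - t'| <= r -> nm (f s t - f s' t') <= e.

Variable K : R -> R -> Prop.
Hypothesis loc : forall s t, 0 <= s <= 1 -> 0 <= t <= 1 -> ~ K s t ->
  exists2 r : R, 0 < r & forall a b c d, 0 <= a -> a <= b -> b <= 1 -> 0 <= c -> c <= d -> d <= 1 ->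
    `|a - s| < r -> `|b - s| < r -> `|c - t| < r -> `|d - t| < r -> rect a b c d = 0.

Variable L : R.
Hypothesis L0 : 0 <= L.
Hypothesis cone : forall s t x y, K s t -> 0 <= s -> 0 <= t -> s <= x -> t <= y -> x <= 1 -> y <= 1 ->
  nm (f x y - f s t) <= L * ((x - s) + (y - t)).

Hypothesis gateaux : forall s t, 0 <= s <= 1 -> 0 <= t <= 1 -> exists D : R[i],
  forall v1 v2 (e : R), 0 < e -> exists2 r : R, 0 < r & forall h, 0 < h -> h < r ->
    0 <= s + h * v1 <= 1 -> 0 <= t + h * v2 <= 1 ->
    nm (f (s + h * v1) (t + h * v2) - f s t - h%:C * (v1%:C * d1 + v2%:C * d2) * D) <= e * h.

Let sq (a c h : R) := rect a (a + h) c (c + h).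
Let valid (a c h : R) := [/\ 0 <= a, 0 <= c, 0 < h, a + h <= 1 & c + h <= 1].
(** The integral per area. By additivity it is at most the mean of its values on the four quarters,
    and this drives the extremal argument. *)
Let sigma (a c h : R) : R := nm (sq a c h) / h ^+ 2.
(** [6 * L] collects three cone estimates of size [2 * L * h]; the other factor comes from the
    perimeter. *)
Let C : R := 6 * L * (2 * nm d1 + 2 * nm d2).

Let D0 : 0 <= 2 * nm d1 + 2 * nm d2.
Proof. by rewrite addr_ge0 // mulr_ge0 // nm_ge0. Qed.

Let valid_sub m a c h a' c' h' : valid a c h -> subtile m a c h a' c' h' -> valid a' c' h'.
Proof.
move=> [a0 c0 h0 ah ch] /(subtile_in h0) [h1 h2 h3 h4 h5].
have h'0 : 0 < h' by rewrite h5 divr_gt0 // exprn_gt0.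
by split=> //; [exact: le_trans h1|exact: le_trans h3|exact: le_trans ah|exact: le_trans ch].
Qed.

Let sq_free a c h : valid a c h ->
  (forall s t, a <= s <= a + h -> c <= t <= c + h -> ~ K s t) -> sq a c h = 0.
Proof.
move=> [a0 c0 h0 ah ch] free; apply: (@rect_free R f d1 d2 K loc) => //.
  by rewrite lerDl ltW.
by rewrite lerDl ltW.
Qed.

Let sigma_le a c h : valid a c h -> sigma a c h <= C.
Proof.
move=> v; have [a0 c0 h0 ah ch] := v.
have C0 : 0 <= C by rewrite !mulr_ge0.
have [[ks [kt [Kst ksQ ktQ]]]|nK] := pselect (exists s t, [/\ K s t, a <= s <= a + h & c <= t <= c + h]); last first.
  rewrite /sigma sq_free ?nm0 ?mul0r // => s t s1 t1 Kst; apply: nK; exists s, t; split=> //.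
rewrite /sigma ler_pdivrMr ?exprn_gt0 //.
have -> : C * h ^+ 2 = (6 * L * h) * (2 * nm d1 + 2 * nm d2) * h by rewrite /C; ring.
apply: (@rect_staircase R f d1 d2 cf K loc a c h (f ks kt)) => //; last by exists ks, kt.
move=> s t /andP[s1 s2] /andP[t1 t2] [s' [t' [Kst' /andP[h1 h2] /andP[h3 h4]]]].
case/andP: ksQ => k1 k2; case/andP: ktQ => k3 k4.
(* The join of the two points of [K] lies in both of their cones and links their values. *)
pose x := Num.max s' ks; pose y := Num.max t' kt.
have [x1 x2] : s' <= x /\ ks <= x by rewrite !le_max !lexx orbT.
have [y1 y2] : t' <= y /\ kt <= y by rewrite !le_max !lexx orbT.
have xh : x <= a + h by rewrite ge_max k2 (le_trans h2).
have yh : y <= c + h by rewrite ge_max k4 (le_trans h4).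
have w0 : 0 <= s' by exact: le_trans h1.
have w1 : 0 <= t' by exact: le_trans h3.
have q0 : 0 <= ks by exact: le_trans k1.
have q1 : 0 <= kt by exact: le_trans k3.
have X1 := cone Kst' w0 w1 h2 h4 (le_trans s2 ah) (le_trans t2 ch).
have X2 := cone Kst' w0 w1 x1 y1 (le_trans xh ah) (le_trans yh ch).
have X3 := cone Kst q0 q1 x2 y2 (le_trans xh ah) (le_trans yh ch).
have b2 (u : R) : u <= h + h -> L * u <= 2 * L * h.
  by move=> uh; have := ler_wpM2l L0 uh; lra.
have Y1 : nm (f s t - f s' t') <= 2 * L * h by apply: le_trans X1 (b2 _ _); lra.
have Y2 : nm (f x y - f s' t') <= 2 * L * h by apply: le_trans X2 (b2 _ _); lra.
have Y3 : nm (f x y - f ks kt) <= 2 * L * h by apply: le_trans X3 (b2 _ _); lra.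
have := nm_triangle (f s' t') (f s t) (f ks kt).
have := nm_triangle (f x y) (f s' t') (f ks kt); rewrite (nmB (f s' t') (f x y)); lra.
Qed.

Let child_sum a c h : valid a c h ->
  sigma a c h <= (sigma a c (h / 2) + sigma (a + h / 2) c (h / 2)
    + sigma a (c + h / 2) (h / 2) + sigma (a + h / 2) (c + h / 2) (h / 2)) / 4.
Proof.
move=> [a0 c0 h0 ah ch].
have E u : u + h / 2 + h / 2 = u + h by rewrite -addrA -splitr.
have -> : sigma a c h = nm (sq a c (h / 2) + sq a (c + h / 2) (h / 2) +
    (sq (a + h / 2) c (h / 2) + sq (a + h / 2) (c + h / 2) (h / 2))) / h ^+ 2.
  by rewrite /sq /rect !rect_vsplit rect_hsplit !E.
have alg (k1 k2 k3 k4 : R) : (k1 / (h / 2) ^+ 2 + k2 / (h / 2) ^+ 2 + k3 / (h / 2) ^+ 2 + k4 / (h / 2) ^+ 2) / 4 =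
   (k1 + k3 + (k2 + k4)) / h ^+ 2 by field; rewrite gt_eqF.
rewrite /sigma alg ler_pM2r ?invr_gt0 ?exprn_gt0 // (le_trans (nmD _ _)) //.
by apply: lerD; exact: nmD.
Qed.

Let childE a c h (i j : bool) : sigma (a + i%:R * (h / 2)) (c + j%:R * (h / 2)) (h / 2) =
  sigma (if i then a + h / 2 else a) (if j then c + h / 2 else c) (h / 2).
Proof. by case: i; case: j; rewrite ?mul1r ?mul0r ?addr0. Qed.

(** Among four numbers not above [S], with mean at least [(1 - eta) * S], one alone can absorb the
    whole deficit, which is then multiplied by 4. *)
Let child_large a c h (i j : bool) (S eta : R) : valid a c h ->
  (forall m a' c' h', subtile m a c h a' c' h' -> sigma a' c' h' <= S) ->
  (1 - eta) * S <= sigma a c h ->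
  (1 - 4 * eta) * S <= sigma (a + i%:R * (h / 2)) (c + j%:R * (h / 2)) (h / 2).
Proof.
move=> v ub lo; have := child_sum v; rewrite childE.
have U (i' j' : bool) : sigma (if i' then a + h / 2 else a) (if j' then c + h / 2 else c) (h / 2) <= S.
  by rewrite -childE; apply: (ub 1%N); exists i', j'.
have := U false false; have := U false true; have := U true false; have := U true true.
by case: i; case: j => /=; lra.
Qed.

Let subtile_large m a c h a' c' h' (S eta : R) : valid a c h ->
  (forall m a' c' h', subtile m a c h a' c' h' -> sigma a' c' h' <= S) ->
  (1 - eta) * S <= sigma a c h -> subtile m a c h a' c' h' ->
  (1 - 4 ^+ m * eta) * S <= sigma a' c' h'.
Proof.
elim: m a c h eta => [|m IH] a c h eta v ub lo /=.
  by move=> [-> -> ->]; rewrite expr0 mul1r.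
move=> [i [j H]]; rewrite exprSr -mulrA.
have sub : subtile 1 a c h (a + i%:R * (h / 2)) (c + j%:R * (h / 2)) (h / 2) by exists i, j.
apply: IH H => //; first exact: valid_sub sub.
  move=> k a2 c2 h2 H2; apply: (ub (1 + k)%N); exact: subtile_trans sub H2.
exact: child_large.
Qed.

Let child_max a c h : valid a c h -> exists i j : bool,
  sigma a c h <= sigma (a + i%:R * (h / 2)) (c + j%:R * (h / 2)) (h / 2).
Proof.
move=> v; have := child_sum v => H; apply: contrapT => N.
have lt (i j : bool) : sigma (if i then a + h / 2 else a) (if j then c + h / 2 else c) (h / 2) < sigma a c h.
  by rewrite ltNge -childE; apply/negP => le; apply: N; exists i, j.
have := lt false false; have := lt false true; have := lt true false; have := lt true true.
by move=> /=; lra.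
Qed.

Let values (a c h : R) := [set x : R | exists m a' c' h', subtile m a c h a' c' h' /\ x = sigma a' c' h'].
Let top a c h := sup (values a c h).

Let top_ub m a c h a' c' h' : valid a c h -> subtile m a c h a' c' h' -> sigma a' c' h' <= top a c h.
Proof.
move=> v H; apply: ub_le_sup; last by exists m, a', c', h'.
by exists C => _ [k [a2 [c2 [h2 [H2 ->]]]]]; apply: sigma_le; exact: valid_sub H2.
Qed.

Let top_sub m a c h a' c' h' : valid a c h -> subtile m a c h a' c' h' -> top a' c' h' <= top a c h.
Proof.
move=> v H; apply: ge_sup; first by exists (sigma a' c' h'); exists 0%N, a', c', h'.
move=> _ [k [a2 [c2 [h2 [H2 ->]]]]]; apply: (top_ub v); exact: subtile_trans H H2.
Qed.

(** By [child_max] one further quartering loses nothing; the subsquare can thus be taken of positive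
    generation, so that the sides shrink. *)
Let top_approx a c h (e : R) : valid a c h -> 0 < e -> exists m a' c' h',
  subtile m.+1 a c h a' c' h' /\ top a c h - e < sigma a' c' h'.
Proof.
move=> v e0; have ne : values a c h !=set0 by exists (sigma a c h); exists 0%N, a, c, h.
have [|_ [m [a' [c' [h' [H ->]]]]] lt] := @sup_gt _ (values a c h) (top a c h - e) ne.
  by rewrite ltrBlDr ltrDl.
have v' := valid_sub v H; have [i [j le]] := child_max v'.
exists m, (a' + i%:R * (h' / 2)), (c' + j%:R * (h' / 2)), (h' / 2); split; last exact: lt_le_trans lt le.
by rewrite -addn1; apply: subtile_trans H _; exists i, j.
Qed.

(** The bounds [al * (2^-1 + p)] leave room for a loss at every stage: for [p <= 1 / 2] the factor
    [1 - (p / 2) ^+ 2] costs less than the passage from [p] to [p / 2], and all the bounds stay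
    above [al / 2]. *)
Let shrink (p S S' u al : R) : 0 < p -> p <= 1 / 2 -> 0 < al -> al * (2^-1 + p) <= S ->
  S - S * (p / 2) ^+ 2 <= u -> u <= S' -> al * (2^-1 + p / 2) <= S'.
Proof.
move=> p0 p1 al0 lo h1 h2; apply: le_trans h2; apply: le_trans h1.
have -> : S - S * (p / 2) ^+ 2 = (1 - (p / 2) ^+ 2) * S by ring.
have q1 : 0 <= 1 - (p / 2) ^+ 2 by rewrite expr2; nra.
apply: (le_trans _ (ler_wpM2l q1 lo)).
rewrite mulrCA ler_pM2l //; rewrite expr2; nra.
Qed.

(* Otherwise there are nested squares whose quotient [sigma] is nearly the
   largest among their subsquares. Hence all their subsquares of a given depth
   meet [K], and [cone] transports the affine approximation provided by
   [gateaux] at the common point of the squares, along finitely many directions,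
   to the whole upper right quarter of a late square. There [sigma] is then
   small, whereas it is nearly maximal. *)
Theorem square_integral0 a c h : valid a c h -> sq a c h = 0.
Proof.
move=> v; apply: contrapT => /eqP nz; have [a0 c0 h0 ah ch] := v.
pose al := sigma a c h.
have al0 : 0 < al by rewrite divr_gt0 ?exprn_gt0 // nm_gt0.
(* The supremum over the subsquares stays above [al / 2]. From the first selected square on, [sigma]
   misses it by a relative amount that decreases like powers of 1/4, so that any fixed number of
   generations is nearly maximal in the end. *)
pose P n x x' y y' := [/\ x' - x = y' - y, valid x y (x' - x),
   al * (2^-1 + 2^-1 ^+ n.+1) <= top x y (x' - x) &
   (0 < n)%N -> (1 - (4 ^+ n.+1)^-1) * top x y (x' - x) <= sigma x y (x' - x)].
have hE (u w : R) : u + w - u = w by rewrite addrC addKr.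
have P0 : P 0%N a (a + h) c (c + h).
  rewrite /P !hE; split => //; rewrite expr1 -div1r -splitr mulr1.
  by apply: (@top_ub 0) => //; split.
have [|||s [t H]] := @nested_rectangles R P a (a + h) c (c + h) _ _ P0.
- by rewrite lerDl ltW.
- by rewrite lerDl ltW.
- move=> n x x' y y' _ _ [sz vx lo _].
  set S := top _ _ _ in lo.
  have pn0 : 0 < 2^-1 ^+ n.+1 :> R by rewrite exprn_gt0 // invr_gt0.
  have S0 : 0 < S by apply: lt_le_trans lo; rewrite mulr_gt0 // addr_gt0 ?invr_gt0.
  have q0 : 0 < (4 ^+ n.+2)^-1 :> R by rewrite invr_gt0.
  (* The relative tolerance is the square of half of [2^-1 ^+ n.+1], as [shrink] requires. *)
  have [m [x2 [y2 [h2 [Hs gt]]]]] := top_approx vx (mulr_gt0 S0 q0).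
  have v2 := valid_sub vx Hs; have [_ _ h20 _ _] := v2; have [_ _ hx0 _ _] := vx.
  have [i1 i2 i3 i4 i5] := subtile_in hx0 Hs.
  have xE : x + (x' - x) = x' by ring.
  have yE : y + (x' - x) = y' by rewrite sz; ring.
  rewrite xE in i2; rewrite yE in i4.
  have h2le : h2 <= (x' - x) / 2.
    rewrite i5 ler_pM2l // lef_pV2 ?posrE ?exprn_gt0 // exprS ler_peMr // exprn_ege1 // ler1n //.
  exists x2, (x2 + h2), y2, (y2 + h2); rewrite /P !hE.
  split=> //.
  + by rewrite i1 lerDl ltW.
  + by rewrite i3 lerDl ltW.
  split=> //; first by rewrite -sz.
  split=> // [|_].
    have qE : (4 ^+ n.+2)^-1 = (2^-1 ^+ n.+1 / 2) ^+ 2 :> R.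
      by rewrite -exprSr -exprM mulnC exprM expr2 -invfM -natrM exprVn.
    rewrite [2^-1 ^+ n.+2]exprSr.
    apply: (@shrink (2^-1 ^+ n.+1) S _ (sigma x2 y2 h2)) => //.
    * by rewrite div1r exprS ler_piMr ?invr_ge0 // exprn_ile1 ?invr_ge0 // invf_le1 // ler1n.
    * by rewrite -qE ltW.
    by apply: (@top_ub 0) => //; split.
  apply: le_trans (ltW gt).
  have -> : S - S / 4 ^+ n.+2 = (1 - (4 ^+ n.+2)^-1) * S by ring.
  rewrite ler_wpM2l ?subr_ge0 ?invf_le1 // ?exprn_ege1 ?ler1n //.
  exact: top_sub Hs.
have [x0 [x0' [y0 [y0' [/andP[g1 g2] /andP[g3 g4] /andP[g5 g6] /andP[g7 g8] _]]]]] := H 0%N.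
have s01 : 0 <= s <= 1.
  by apply/andP; split; [exact: le_trans a0 (le_trans g1 g2)|exact: le_trans g3 (le_trans g4 ah)].
have t01 : 0 <= t <= 1.
  by apply/andP; split; [exact: le_trans c0 (le_trans g5 g6)|exact: le_trans g7 (le_trans g8 ch)].
clear x0 x0' y0 y0' g1 g2 g3 g4 g5 g6 g7 g8.
have [D HD] := gateaux s01 t01.
pose M := nm d1 + nm d2.
have M0 : 0 <= M by rewrite addr_ge0 ?nm_ge0.
(* [4 * L + 6 * L] stems from two cone estimates, 1 from the differentiability at the common point,
   [nm D * M] from moving the argument of the affine function to a grid point. *)
pose C1 := 10 * L + 1 + nm D * M.
have C10 : 0 < C1 by rewrite /C1 ltr_wpDr ?mulr_ge0 ?nm_ge0 // ltr_wpDl // mulr_ge0.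
(* The depth of the grid. The first inequality will contradict near-maximality; the second keeps
   points a few grid steps below the upper right quarter within the square. *)
have [l Hl] : exists l : nat, 4 * C1 * M * (2 ^+ l)^-1 < al / 4 /\ (2 ^+ l)^-1 <= 8^-1 :> R.
  have K0 : 0 < 4 * C1 * M + 1 by rewrite ltr_wpDl // !mulr_ge0 // ltW.
  have q0 : 0 < Num.min (al / 8 / (4 * C1 * M + 1)) 8^-1 :> R.
    by rewrite lt_min; apply/andP; split; [rewrite divr_gt0 // divr_gt0|rewrite invr_gt0].
  have [l Hl] := half_pow_small ltr01 q0; exists l; have := Hl l (leqnn l).
  rewrite div1r le_min => /andP[l1 l2]; split=> //.
  have := l1; rewrite ler_pdivlMr // => l3.
  have e0 : 0 < (2 ^+ l)^-1 :> R by rewrite invr_gt0 exprn_gt0.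
  have : al / 8 < al / 4 by lra.
  apply: le_lt_trans; apply: le_trans l3; rewrite mulrC ler_pM2l // lerDl //.
case: Hl; set eta := (2 ^+ l)^-1 => Hl1 Hl2.
have eta0 : 0 < eta by rewrite invr_gt0 exprn_gt0.
pose N := (2 ^ l.+1)%N.
(* Displacements from -1 to 1 in steps of [eta]: they make up finitely many directions, for which
   [gateaux] yields a common radius. *)
pose V (k : nat) : R := k%:R * eta - 1.
have [r r0 Hr] : exists2 r : R, 0 < r & forall h, 0 < h -> h < r -> forall k, (k <= N)%N -> forall k', (k' <= N)%N ->
    0 <= s + h * V k <= 1 -> 0 <= t + h * V k' <= 1 ->
    nm (f (s + h * V k) (t + h * V k') - f s t - h%:C * ((V k)%:C * d1 + (V k')%:C * d2) * D) <= eta * h.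
  by apply: finite_radius => k _; apply: finite_radius => k' _; exact: HD.
have r20 : 0 < r / 2 by rewrite divr_gt0.
have [n1 Hn1] := half_pow_small h0 r20.
(* [n1] makes the square smaller than that radius; [l.+1] limits the loss over [l] generations and
   excludes the initial square. *)
pose n := maxn n1 l.+1.
have [x [x' [y [y' [/andP[ax xs] /andP[sx' x'a] /andP[cy yt] /andP[ty' y'c] [szx _ [sz vx lo hi]]]]]]] := H n.
have {}hi := hi (leq_ltn_trans (leq0n l) (leq_maxr n1 l.+1)).
have [x0 y0 k0 xk yk] := vx.
set k := x' - x in vx k0 xk yk lo hi sz szx.
have x'E : x' = x + k by rewrite /k; ring.
have y'E : y' = y + k by rewrite sz; ring.
have kr : k < r.
  rewrite (le_lt_trans szx) // hE (le_lt_trans (Hn1 n (leq_maxl _ _))) // ltr_pdivrMr // mulr_natr mulr2n ltrDl //.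
have S0 : 0 < top x y k by apply: lt_le_trans lo; rewrite mulr_gt0 // addr_gt0 ?invr_gt0 // exprn_gt0 // invr_gt0.
have S1 : al / 4 <= 2^-1 * top x y k.
  rewrite (_ : al / 4 = 2^-1 * (al / 2)); last by field.
  rewrite ler_pM2l //.
  by apply: le_trans lo; rewrite ler_pM2l // lerDl exprn_ge0 // invr_ge0.
have ub m a' c' h' : subtile m x y k a' c' h' -> sigma a' c' h' <= top x y k by exact: top_ub.
have hi' : (1 - (4 ^+ n.+1)^-1) * top x y k <= sigma x y k by [].
have ratio_le m : (m <= l)%N -> 4 ^+ m * (4 ^+ n.+1)^-1 <= 4^-1 :> R.
  move=> ml; have mn : (m <= n)%N by apply: leq_trans ml (leq_trans (leqnSn l) (leq_maxr _ _)).
  rewrite ler_pdivrMr // mulrC exprSr mulfK ?gt_eqF //.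
  by apply: ler_weXn2l; rewrite // ler1n.
(* A subsquare of depth [l] without points of [K] would have [sigma] equal to 0, yet it is nearly
   maximal. The one containing the point moved by [eta * k] to the left and down thus supplies a
   point of [K] to the lower left of [(p, q)]. *)
have dense p q : x + eta * k <= p -> p <= x' -> y + eta * k <= q -> q <= y' ->
    exists w1 w2, [/\ K w1 w2, p - 2 * (eta * k) <= w1 /\ w1 <= p, q - 2 * (eta * k) <= w2 /\ w2 <= q,
      x <= w1 & y <= w2].
  move=> p1 p2 q1 q2.
  have ek : 0 < eta * k by rewrite mulr_gt0.
  have [||a2 [c2 [h2 [Hs /andP[z1 z2] /andP[z3 z4]]]]] := @subtile_point l x y k (p - eta * k) (q - eta * k) k0.
  - by apply/andP; split; [rewrite lerBrDr|rewrite lerBlDr -x'E (le_trans p2) // lerDl ltW].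
  - by apply/andP; split; [rewrite lerBrDr|rewrite lerBlDr -y'E (le_trans q2) // lerDl ltW].
  have v2 := valid_sub vx Hs.
  have [i1 i2 i3 i4 i5] := subtile_in k0 Hs.
  have h2E : h2 = eta * k by rewrite i5 mulrC.
  have [w1 [w2 [Kw /andP[j1 j2] /andP[j3 j4]]]] : exists w1 w2, [/\ K w1 w2, a2 <= w1 <= a2 + h2 & c2 <= w2 <= c2 + h2].
    apply: contrapT => nK.
    have : 0 < sigma a2 c2 h2.
      apply: lt_le_trans (subtile_large vx ub hi' Hs); rewrite mulr_gt0 // subr_gt0.
      by rewrite (le_lt_trans (ratio_le l (leqnn l))) // invf_lt1 // ltr1n.
    rewrite /sigma sq_free ?nm0 ?mul0r ?ltxx // => w1 w2 h1 h3 Kw; apply: nK.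
    by exists w1, w2.
  exists w1, w2; rewrite h2E in z2 z4 j2 j4.
  by split => //; [exact: tile_dense z1 z2 j1 j2|exact: tile_dense z3 z4 j3 j4|exact: le_trans i1 j1|exact: le_trans i3 j3].
have grid (o p : R) : o - p <= k -> p - o <= k -> exists2 i : nat, (i <= N)%N &
    o + k * V i <= p /\ p - (o + k * V i) <= eta * k.
  move=> op po; pose u := ((p - o) / k + 1) * 2 ^+ l.
  have e2 : 2 ^+ l * eta = 1 :> R by rewrite divff // gt_eqF // exprn_gt0.
  have w0 : 0 <= (p - o) / k + 1 by rewrite -lerBlDr sub0r ler_pdivlMr // mulN1r lerNl opprB.
  have w2 : (p - o) / k + 1 <= 2 by rewrite -[2]/(1 + 1) lerD2r ler_pdivrMr // mul1r.
  have u0 : 0 <= u by rewrite mulr_ge0 // exprn_ge0.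
  have /andP[tu1 tu2] := truncn_itv u0.
  exists (Num.truncn u).
    rewrite -(ler_nat R) (le_trans tu1) // /u /N natrX exprS ler_wpM2r // exprn_ge0 //.
  have uE : u * eta = (p - o) / k + 1 by rewrite /u -mulrA e2 mulr1.
  have kE : k * ((p - o) / k) = p - o by rewrite mulrC divfK // gt_eqF.
  have := ler_wpM2r (ltW eta0) tu1; rewrite uE => h1.
  have := ltW tu2; rewrite -natr1 => h2; have := ler_wpM2r (ltW eta0) h2; rewrite uE [leRHS]mulrDl mul1r => h3.
  move: h1 h3; rewrite /V; move: ((Num.truncn u)%:R) => T h1 h3.
    have g1 := ler_wpM2l (ltW k0) h1; have g3 := ler_wpM2l (ltW k0) h3.
  move: g1 g3; rewrite [k * (_ + 1)]mulrDr kE; exact: tile_grid.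
(* A grid point lies at most one step to the lower left of [(p, q)], and a point of [K] to the lower
   left of both. The derivative at the common point governs the value at the grid point, and the two
   cone estimates carry it over to [(p, q)]. *)
have approx p q : x + k / 2 <= p <= x' -> y + k / 2 <= q <= y' ->
    nm (f p q - ((f s t - (s%:C * d1 + t%:C * d2) * D) + (p%:C * d1 + q%:C * d2) * D)) <= C1 * (eta * k).
  move=> /andP[p1 p2] /andP[q1 q2].
  have sxk : s <= x + k by rewrite -x'E.
  have tyk : t <= y + k by rewrite -y'E.
  have pxk : p <= x + k by rewrite -x'E.
  have qyk : q <= y + k by rewrite -y'E.
  have ek : eta * k <= k / 8 by rewrite mulrC ler_pM2l.
  have [g1 g2] := @tile_bound s x k p k0 xs sxk p1 pxk.
  have [i iN [i1 i2]] := grid s p g1 g2.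
  have [g3 g4] := @tile_bound t y k q k0 yt tyk q1 qyk.
  have [j jN [j1 j2]] := grid t q g3 g4.
  set r1 := s + k * V i in i1 i2 *; set r2 := t + k * V j in j1 j2 *.
  have r1x : x + eta * k <= r1 by exact: tile_lower p1 i2 ek k0.
  have r2y : y + eta * k <= r2 by exact: tile_lower q1 j2 ek k0.
  have [w1 [w2 [Kw [b1 b2] [b3 b4] b5 b6]]] := dense r1 r2 r1x (le_trans i1 p2) r2y (le_trans j1 q2).
  have w10 : 0 <= w1 by exact: le_trans b5.
  have w20 : 0 <= w2 by exact: le_trans b6.
  have x'1 : x' <= 1 by rewrite x'E.
  have y'1 : y' <= 1 by rewrite y'E.
  have F1 := cone Kw w10 w20 b2 b4 (le_trans (le_trans i1 p2) x'1) (le_trans (le_trans j1 q2) y'1).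
  have F2 := cone Kw w10 w20 (le_trans b2 i1) (le_trans b4 j1) (le_trans p2 x'1) (le_trans q2 y'1).
  have G1 : nm (f r1 r2 - f w1 w2) <= 4 * L * (eta * k) by exact: tile_cone L0 b1 b3 F1.
  have G2 : nm (f p q - f w1 w2) <= 6 * L * (eta * k) by exact: tile_cone2 L0 b1 b3 i2 j2 F2.
  have G3 : nm (f p q - f r1 r2) <= 10 * L * (eta * k).
    have := nm_triangle (f w1 w2) (f p q) (f r1 r2); rewrite (nmB (f w1 w2) (f r1 r2)) => g.
    exact: tile_add g G2 G1.
  have G4 : nm (f r1 r2 - f s t - k%:C * ((V i)%:C * d1 + (V j)%:C * d2) * D) <= eta * k.
    apply: (Hr k k0 kr i iN j jN).
      by rewrite (le_trans _ r1x) ?(le_trans (le_trans i1 p2) x'1) // addr_ge0 // mulr_ge0 // ltW.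
    by rewrite (le_trans _ r2y) ?(le_trans (le_trans j1 q2) y'1) // addr_ge0 // mulr_ge0 // ltW.
  have E1 : k%:C * (V i)%:C = r1%:C - s%:C by rewrite -rmorphM -rmorphB /r1 addrC addKr.
  have E2 : k%:C * (V j)%:C = r2%:C - t%:C by rewrite -rmorphM -rmorphB /r2 addrC addKr.
  have alg (A B E F k1 v1 v2 R1 R2 s1 t1 X1 Y1 : R[i]) : k1 * v1 = R1 - s1 -> k1 * v2 = R2 - t1 ->
     A - ((B - (s1 * d1 + t1 * d2) * D) + (X1 * d1 + Y1 * d2) * D) =
     (A - E) + (E - B - k1 * (v1 * d1 + v2 * d2) * D) - ((X1 - R1) * d1 + (Y1 - R2) * d2) * D.
    move=> e1 e2; have -> : k1 * (v1 * d1 + v2 * d2) = (k1 * v1) * d1 + (k1 * v2) * d2 by ring.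
    by rewrite e1 e2; ring.
  rewrite (alg _ _ (f r1 r2) 0 _ _ _ _ _ _ _ _ _ E1 E2).
  have G5 : nm (((p%:C - r1%:C) * d1 + (q%:C - r2%:C) * d2) * D) <= nm D * M * (eta * k).
    rewrite nmM mulrC -mulrA ler_wpM2l ?nm_ge0 // (le_trans (nmD _ _)) // !nmM -!rmorphB !nm_real.
    rewrite /M mulrDl mulrC lerD // ?ler_wpM2l ?nm_ge0 // ?ger0_norm ?subr_ge0 //.
    by rewrite mulrC ler_wpM2l ?nm_ge0 // ger0_norm ?subr_ge0.
  apply: (le_trans (nmD _ _)); rewrite nmN.
  have := nmD (f p q - f r1 r2) (f r1 r2 - f s t - k%:C * ((V i)%:C * d1 + (V j)%:C * d2) * D).
  by rewrite /C1 => g; exact: tile_total g G3 G4 G5.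
have k20 : 0 < k / 2 by rewrite divr_gt0.
have half (u : R) : u + k / 2 + k / 2 = u + k by rewrite -addrA -splitr.
have sub : subtile 1 x y k (x + k / 2) (y + k / 2) (k / 2).
  by exists true, true; rewrite /= !mul1r.
have [w1 w2 _ w3 w4] := valid_sub vx sub.
have est : nm (sq (x + k / 2) (y + k / 2) (k / 2)) <= C1 * (eta * k) * (2 * nm d1 * (k / 2) + 2 * nm d2 * (k / 2)).
  have := @rect_approx R f d1 d2 cf (x + k / 2) (x + k / 2 + k / 2) (y + k / 2) (y + k / 2 + k / 2)
     (f s t - (s%:C * d1 + t%:C * d2) * D) D (C1 * (eta * k)) w1 _ w3 w2 _ w4.
  rewrite !hE; apply; [by rewrite lerDl ltW|by rewrite lerDl ltW|].
  by move=> p q; rewrite !half -x'E -y'E; exact: approx.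
have low := subtile_large vx ub hi' sub.
have : (1 - 4 ^+ 1 * (4 ^+ n.+1)^-1) * top x y k >= al / 4.
  have := ratio_le 1%N; rewrite expr1 => f1.
  have {}f1 : 4 * (4 ^+ n.+1)^-1 <= 4^-1 :> R.
    have [l0|l0] := ltnP 0 l; first exact: f1.
    move: Hl2; rewrite /eta (_ : l = 0%N) ?expr0 ?invr1; last by case: (l) l0.
    by move=> /eighth_lt1.
  apply: (@le_trans _ _ (2^-1 * top x y k)); first exact: S1.
  by rewrite ler_pM2r //; exact: half_complement f1.
move=> /le_trans /(_ low) big.
have : sigma (x + k / 2) (y + k / 2) (k / 2) <= 4 * C1 * M * eta.
  rewrite /sigma ler_pdivrMr ?exprn_gt0 // (le_trans est) //.
  have -> : 4 * C1 * M * eta * (k / 2) ^+ 2 = C1 * (eta * k) * (2 * nm d1 * (k / 2) + 2 * nm d2 * (k / 2)).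
    by rewrite /M; field.
  by [].
move=> /(le_trans big); rewrite leNgt => /negP; apply; exact: Hl1.
Qed.

End Tiles.

(** * From squares to rectangles *)

Section Rectangles0.
Variable R : realType.
Variables (f : R -> R -> R[i]) (d1 d2 : R[i]).
Local Notation rectf := (rect f d1 d2).

Lemma rect_stack a b c e (B : R) n :
  (forall k, (k < n)%N -> nm (rectf a b (c + k%:R * e) (c + k%:R * e + e)) <= B) ->
  nm (rectf a b c (c + n%:R * e)) <= n%:R * B.
Proof.
elim: n => [_|n IH H].
  by rewrite !mul0r addr0 /rect !segxx !mulr0 addr0 subr0 subrr nm0.
have -> : c + n.+1%:R * e = c + n%:R * e + e by rewrite -natr1 mulrDl mul1r addrA.
rewrite -(rect_vsplit f d1 d2 a b c (c + n%:R * e)) (le_trans (nmD _ _)) //.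
rewrite -natr1 [leRHS]mulrDl mul1r; apply: lerD; last exact: H.
by apply: IH => k kn; exact: H (leqW kn).
Qed.

Hypothesis cf : forall e : R, 0 < e -> exists2 r : R, 0 < r & forall s t s' t',
  0 <= s <= 1 -> 0 <= t <= 1 -> 0 <= s' <= 1 -> 0 <= t' <= 1 ->
  `|s - s'| <= r -> `|t - t'| <= r -> nm (f s t - f s' t') <= e.

Lemma rect_small a b c d (e r : R) : 0 <= a -> a <= b -> b <= 1 -> 0 <= c -> c <= d -> d <= 1 ->
  (forall s t s' t', 0 <= s <= 1 -> 0 <= t <= 1 -> 0 <= s' <= 1 -> 0 <= t' <= 1 ->
    `|s - s'| <= r -> `|t - t'| <= r -> nm (f s t - f s' t') <= e) ->
  b - a <= r -> d - c <= r ->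
  nm (rectf a b c d) <= e * (2 * nm d1 * (b - a) + 2 * nm d2 * (d - c)).
Proof.
move=> a0 ab b1 c0 cd dd H w1 w2.
apply: (rect_approx cf (p := f a c) (q := 0)) => // s t /andP[s1 s2] /andP[t1 t2].
rewrite mulr0 addr0; apply: H; rewrite ?ger0_norm ?subr_ge0 //.
- by rewrite (le_trans a0 s1) (le_trans s2 b1).
- by rewrite (le_trans c0 t1) (le_trans t2 dd).
- by rewrite a0 (le_trans ab b1).
- by rewrite c0 (le_trans cd dd).
- by apply: le_trans w1; rewrite lerD2r.
- by apply: le_trans w2; rewrite lerD2r.
Qed.

Hypothesis square0 : forall a c h : R, 0 <= a -> 0 <= c -> 0 < h -> a + h <= 1 -> c + h <= 1 ->
  rectf a (a + h) c (c + h) = 0.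

Lemma rect_row0 a b c e q : (forall k, (k < q)%N -> rectf (a + k%:R * e) (a + k%:R * e + e) b c = 0) ->
  rectf a (a + q%:R * e) b c = 0.
Proof.
elim: q => [_|q IH H].
  by rewrite mul0r addr0 /rect !segxx !mulr0 add0r subr0 subrr.
rewrite -(rect_hsplit f d1 d2 a _ (a + q%:R * e)) IH; last by move=> k kq; exact: H (leqW kq).
by rewrite add0r -natr1 mulrDl mul1r addrA H.
Qed.

(** Squares of side [w = (d - c) / n] fill all but a column of width at most [w]. The column is cut
    into [n] pieces whose integrals are at most a small oscillation times [M * w], and these bounds
    add up to [e]. *)
Lemma rect_ordered0 a b c d : 0 <= a -> a <= b -> b <= 1 -> 0 <= c -> c <= d -> d <= 1 ->
  rectf a b c d = 0.
Proof.
move=> a0 ab b1 c0; rewrite le_eqVlt => /orP[/eqP<- _|cd dd].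
  by rewrite /rect !segxx !mulr0 addr0 subr0 subrr.
have h0 : 0 < d - c by rewrite subr_gt0.
apply: nm_eqP => e e0.
pose M := 2 * nm d1 + 2 * nm d2 + 1.
have M0 : 0 < M by rewrite ltr_wpDl // addr_ge0 // mulr_ge0 // nm_ge0.
have [r r0 Hr] := cf (divr_gt0 (divr_gt0 e0 M0) h0).
pose n := (Num.truncn ((d - c) / r)).+1.
have n0 : 0 < n%:R :> R by rewrite ltr0n.
pose w := (d - c) / n%:R.
have w0 : 0 < w by rewrite divr_gt0.
have wr : w <= r.
  rewrite ler_pdivrMr // mulrC -ler_pdivrMr // ltW //.
  by have /andP[] := truncn_itv (divr_ge0 (ltW h0) (ltW r0)).
have nw : n%:R * w = d - c by rewrite mulrC divfK // gt_eqF.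
have dE : d = c + n%:R * w by rewrite nw addrC subrK.
pose q := Num.truncn ((b - a) / w).
have /andP[q1 q2] : q%:R <= (b - a) / w < q.+1%:R.
  by apply: (truncn_itv (divr_ge0 _ (ltW w0))); rewrite subr_ge0.
have {}q1 : a + q%:R * w <= b by rewrite -lerBrDl -ler_pdivlMr.
have {}q2 : b - (a + q%:R * w) <= w.
  by move: (ltW q2); rewrite ler_pdivrMr // -natr1 mulrDl mul1r => h; rewrite opprD addrA !lerBlDl -lerBlDl.
have kw (k N : nat) (x y : R) : 0 <= x -> x + N%:R * w <= y -> (k < N)%N ->
    0 <= x + k%:R * w /\ x + k%:R * w + w <= y.
  move=> x0 xy kN; split; first by rewrite addr_ge0 // mulr_ge0 // ltW.
  apply: le_trans xy; rewrite -addrA lerD2l -[X in _ + X]mul1r -mulrDl.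
  by rewrite natr1 ler_wpM2r ?(ltW w0) // ler_nat.
have dn : c + n%:R * w <= d by rewrite -dE.
rewrite -(rect_hsplit f d1 d2 a b (a + q%:R * w)) rect_row0 ?add0r; last first.
  move=> k kq; have [k1 k2] := kw k q a b a0 q1 kq.
  rewrite {1}dE; apply/eqP; rewrite -nm_eq0 eq_le nm_ge0 andbT -(mulr0 n%:R).
  apply: rect_stack => j jn; have [j1 j2] := kw j n c d c0 dn jn.
  by rewrite square0 ?nm0 // ?(le_trans k2) ?(le_trans j2).
have qa : 0 <= a + q%:R * w by rewrite addr_ge0 // mulr_ge0 // ltW.
rewrite dE; have -> : e = n%:R * (e / M / (d - c) * (M * w)).
  have alg (N W E m D : R) : N * W = D -> 0 < m -> 0 < D -> E = N * (E / m / D * (m * W)).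
    move=> E1 m0 D0; have -> : N * (E / m / D * (m * W)) = E / m / D * m * (N * W) by ring.
    by rewrite E1 mulrAC divfK ?gt_eqF // divfK ?gt_eqF.
  exact: (alg _ _ _ _ _ nw).
apply: rect_stack => j jn; have [j1 j2] := kw j n c d c0 dn jn.
have jw : c + j%:R * w <= c + j%:R * w + w by rewrite lerDl ltW.
apply: (le_trans (rect_small qa q1 b1 j1 jw (le_trans j2 dd) Hr _ _)).
- exact: le_trans q2 wr.
- by rewrite addrC addKr.
rewrite (addrC (c + _) w) addrK ler_wpM2l ?divr_ge0 ?(ltW e0) ?(ltW M0) ?(ltW h0) //.
rewrite /M [leRHS]mulrDl mul1r ler_wpDr ?(ltW w0) // [leRHS]mulrDl lerD2r.
by rewrite ler_wpM2l // mulr_ge0 // nm_ge0.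
Qed.

Lemma rect_all0 a b c d : 0 <= a <= 1 -> 0 <= b <= 1 -> 0 <= c <= 1 -> 0 <= d <= 1 ->
  rectf a b c d = 0.
Proof.
move=> /andP[a0 a1] /andP[b0 b1] /andP[c0 c1] /andP[d0 d1'].
have H x y : 0 <= x -> x <= y -> y <= 1 -> rectf x y c d = 0.
  move=> x0 xy y1; have [cd|/ltW dc] := leP c d; first exact: rect_ordered0.
  by rewrite rect_vrev rect_ordered0 ?oppr0.
have [ab|/ltW ba] := leP a b; first exact: H.
by rewrite rect_hrev H ?oppr0.
Qed.

End Rectangles0.

(** * Local primitives and parallelograms *)

Section Parallelogram.
Variable R : realType.
Implicit Types (F P : R[i] -> R[i]).

Definition has_local_primitive F z := exists2 r : R, 0 < r &
  exists P, forall w, nm (w - z) < r -> sder P w (F w).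

Lemma line_primitive F P (g : R -> R[i]) d a b : d != 0 ->
  (forall x y, g y - g x = (y - x)%:C * d) ->
  (forall x, a <= x <= b -> sder P (g x) (F (g x))) ->
  primitive_on a b (fun s => d^-1 * P (g s)) (fun s => F (g s)).
Proof.
move=> d0 gE H x xab e e0; have [r r0 Hr] := H x xab e e0.
have nd : 0 < nm d by rewrite nm_gt0.
exists (r / nm d); first by rewrite divr_gt0.
move=> y yab; rewrite ltr_pdivlMr // => yx.
have gyx : nm (g y - g x) = `|y - x| * nm d by rewrite gE nmM nm_real.
have := Hr (g x) (g y); rewrite subrr nm0 gyx => /(_ r0 yx).
have -> : P (g y) - P (g x) - F (g x) * (g y - g x) =
    d * (d^-1 * P (g y) - d^-1 * P (g x) - (y - x)%:C * F (g x)).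
  by rewrite gE; move: ((y - x)%:C) => *; field.
by rewrite nmM mulrA (mulrC (nm d)) ler_pM2r.
Qed.

Lemma seg_near u (a b : R) (p : R[i]) (e : R) : continuous_on 0 1 u ->
  0 <= a <= 1 -> 0 <= b <= 1 ->
  (forall x, 0 <= x <= 1 -> `|x - a| <= `|b - a| -> nm (u x - p) <= e) ->
  nm (seg u a b - p * (b - a)%:C) <= e * `|b - a|.
Proof.
move=> cu /andP[a0 a1] /andP[b0 b1] H.
have [ab|/ltW ba] := leP a b.
  rewrite (@ger0_norm _ (b - a)) ?subr_ge0 // in H *.
  have := @seg_approx _ u a b p 0 e cu a0 ab b1; rewrite mul0r mul0r addr0; apply.
  move=> x /andP[ax xb]; rewrite mulr0 addr0; apply: H.
    by rewrite (le_trans a0 ax) (le_trans xb b1).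
  by rewrite ger0_norm ?subr_ge0 // lerD2r.
rewrite (distrC b) (@ger0_norm _ (a - b)) ?subr_ge0 // in H *; rewrite seg_rev.
have -> : - seg u b a - p * (b - a)%:C = - (seg u b a - p * (a - b)%:C).
  by rewrite !rmorphB /=; move: (b%:C) (a%:C) => *; ring.
rewrite nmN; have := @seg_approx _ u b a p 0 e cu b0 ba a1; rewrite mul0r mul0r addr0; apply.
move=> x /andP[bx xa]; rewrite mulr0 addr0; apply: H.
  by rewrite (le_trans b0 bx) (le_trans xa a1).
by rewrite distrC ger0_norm ?subr_ge0 // lerD2l lerN2.
Qed.

Variables (F : R[i] -> R[i]) (z0 d1 d2 : R[i]).
Definition para (s t : R) : R[i] := z0 + s%:C * d1 + t%:C * d2.
Let f s t := F (para s t).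

Lemma paraB s t s' t' : para s' t' - para s t = (s' - s)%:C * d1 + (t' - t)%:C * d2.
Proof. by rewrite /para !rmorphB /=; move: (s%:C) (t%:C) (s'%:C) (t'%:C) => *; ring. Qed.

Lemma para_dist s t s' t' : nm (para s' t' - para s t) <= `|s' - s| * nm d1 + `|t' - t| * nm d2.
Proof. by rewrite paraB (le_trans (nmD _ _)) // !nmM !nm_real. Qed.

Lemma para_close s t s' t' (r : R) : 0 < r ->
  `|s' - s| < r / (nm d1 + nm d2 + 1) -> `|t' - t| < r / (nm d1 + nm d2 + 1) ->
  nm (para s' t' - para s t) < r.
Proof.
move=> r0; have := nm_ge0 d1; have := nm_ge0 d2.
move: (nm d1) (nm d2) (para_dist s t s' t') => x y H y0 x0.
have M0 : 0 < x + y + 1 by rewrite ltr_wpDl // addr_ge0.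
rewrite !ltr_pdivlMr //; move: H (normr_ge0 (s' - s)) (normr_ge0 (t' - t)).
move: `|s' - s| `|t' - t| (nm _) => p q k H p0 q0 h1 h2.
apply: (le_lt_trans H); have [pq|qp] := leP p q.
  by apply: le_lt_trans h2; rewrite !mulrDr mulr1 ler_wpDr // lerD2r ler_wpM2r.
apply: le_lt_trans h1; rewrite !mulrDr mulr1 ler_wpDr // lerD2l ler_wpM2r //.
exact: ltW.
Qed.

Lemma para_uniform : (forall s t, 0 <= s <= 1 -> 0 <= t <= 1 -> cont_at F (para s t)) ->
  forall e : R, 0 < e -> exists2 r : R, 0 < r & forall s t s' t',
  0 <= s <= 1 -> 0 <= t <= 1 -> 0 <= s' <= 1 -> 0 <= t' <= 1 ->
  `|s - s'| <= r -> `|t - t'| <= r -> nm (f s t - f s' t') <= e.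
Proof.
move=> cF e e0; have e20 : 0 < e / 2 by rewrite divr_gt0.
pose M := nm d1 + nm d2 + 1.
have M0 : 0 < M by rewrite ltr_wpDl // addr_ge0 // nm_ge0.
have [s t s01 t01|r r' s t rr H s' t' s1 t1 h1 h2|r r0 Hr] := @segment2_uniform R 0 1 0 1
  (fun r s t => forall s' t', 0 <= s' <= 1 -> 0 <= t' <= 1 -> `|s - s'| <= r -> `|t - t'| <= r ->
     nm (f s t - f s' t') <= e).
- have [q q0 Hq] := cF s t s01 t01 _ e20.
  have q2 : 0 < q / M / 2 by rewrite !divr_gt0.
  exists (q / M / 2) => // s1 t1 s11 t11 h1 h2 s' t' s'1 t'1 h3 h4.
  have sp (a b c : R) : `|b - a| < q / M / 2 -> `|b - c| <= q / M / 2 -> `|c - a| < q / M.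
    move=> k1 k2; have -> : c - a = (b - a) - (b - c) by ring.
    apply: le_lt_trans (ler_normB _ _) _; rewrite (splitr (q / M)); exact: ltr_leD.
  have w1 : `|s1 - s| < q / M by apply: lt_trans h1 _; rewrite gtr_pMr ?divr_gt0 // invf_lt1 // ltr1n.
  have w2 : `|t1 - t| < q / M by apply: lt_trans h2 _; rewrite gtr_pMr ?divr_gt0 // invf_lt1 // ltr1n.
  have := Hq _ (para_close q0 w1 w2).
  have := Hq _ (para_close q0 (sp _ _ _ h1 h3) (sp _ _ _ h2 h4)).
  rewrite -/(f s t) -/(f s1 t1) -/(f s' t') => k1 k2.
  apply: le_trans (nm_triangle (f s t) _ _) _; rewrite (splitr e) lerD // nmB //.
- by apply: H => //; [exact: le_trans h1 rr|exact: le_trans h2 rr].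
by exists r => // s t s' t' s01 t01; exact: Hr.
Qed.

Hypotheses (d10 : d1 != 0) (d20 : d2 != 0).
Hypothesis cf : forall e : R, 0 < e -> exists2 r : R, 0 < r & forall s t s' t',
  0 <= s <= 1 -> 0 <= t <= 1 -> 0 <= s' <= 1 -> 0 <= t' <= 1 ->
  `|s - s'| <= r -> `|t - t'| <= r -> nm (f s t - f s' t') <= e.

Lemma primitive_rect0 s t : has_local_primitive F (para s t) -> exists2 r : R, 0 < r &
  forall a b c d, 0 <= a -> a <= b -> b <= 1 -> 0 <= c -> c <= d -> d <= 1 ->
    `|a - s| < r -> `|b - s| < r -> `|c - t| < r -> `|d - t| < r -> rect f d1 d2 a b c d = 0.
Proof.
move=> [q q0 [P HP]]; have M0 : 0 < nm d1 + nm d2 + 1 by rewrite ltr_wpDl // addr_ge0 // nm_ge0.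
exists (q / (nm d1 + nm d2 + 1)); first by rewrite divr_gt0.
move=> a b c d a0 ab b1 c0 cd dd as1 bs ct dt.
have mid (u v w y : R) : `|u - w| < y -> `|v - w| < y -> forall x, u <= x <= v -> `|x - w| < y.
  rewrite !ltr_norml => /andP[h1 _] /andP[_ h2] x /andP[h4 h5].
  by rewrite ltr_norml; apply/andP; split; [exact: lt_le_trans h1 (lerB h4 (lexx w))|exact: le_lt_trans (lerB h5 (lexx w)) h2].
have row k : `|k - t| < q / (nm d1 + nm d2 + 1) -> 0 <= k <= 1 ->
    seg (fun s => f s k) a b = d1^-1 * P (para b k) - d1^-1 * P (para a k).
  move=> kt k01; apply: (seg_eq (V := fun s => d1^-1 * P (para s k))) => //.
    exact: (continuous_on_row cf).
  apply: line_primitive => // [x y|x xab]; first by rewrite paraB subrr mul0r addr0.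
  by apply: HP; apply: para_close => //; exact: mid xab.
have col k : `|k - s| < q / (nm d1 + nm d2 + 1) -> 0 <= k <= 1 ->
    seg (f k) c d = d2^-1 * P (para k d) - d2^-1 * P (para k c).
  move=> ks k01; apply: (seg_eq (V := fun t => d2^-1 * P (para k t))) => //.
    exact: (continuous_on_col cf).
  apply: line_primitive => // [x y|x xab]; first by rewrite paraB subrr mul0r add0r.
  by apply: HP; apply: para_close => //; exact: mid xab.
rewrite /rect row ?col ?row ?col //; try by apply/andP; split; rewrite // ?(le_trans _ cd) ?(le_trans _ ab) // ?(le_trans cd) ?(le_trans ab).
by field; rewrite d10 d20.
Qed.

Hypothesis rect0 : forall a b c d : R, 0 <= a <= 1 -> 0 <= b <= 1 -> 0 <= c <= 1 -> 0 <= d <= 1 ->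
  rect f d1 d2 a b c d = 0.
Variables (S T : R[i] -> R) (C : R) (x : R[i]).
Hypotheses (C0 : 0 < C) (paraK : forall w, para (S w) (T w) = w).
Hypotheses (lS : forall w w', `|S w' - S w| <= C * nm (w' - w))
  (lT : forall w w', `|T w' - T w| <= C * nm (w' - w)).
Hypotheses (Sx : S x = 2^-1) (Tx : T x = 2^-1).
Hypothesis cF : forall s t, 0 <= s <= 1 -> 0 <= t <= 1 -> cont_at F (para s t).

(** The candidate integrates along the middle row and then along a column. By [rect0] its increments
    can be computed on a path that starts at the first point itself, where [F] is close to [F w0];
    this gives a strict derivative. *)
Lemma rect0_primitive : has_local_primitive F x.
Proof.
(* The coordinates of [x] are 1/2 and [C] is their Lipschitz constant, so on this disc they stay in
   [[0, 1]]. *)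
pose rho := (2 * C)^-1; have rho0 : 0 < rho by rewrite invr_gt0 mulr_gt0.
have inI (U : R[i] -> R) (lU : forall w w', `|U w' - U w| <= C * nm (w' - w)) (Ux : U x = 2^-1) w :
    nm (w - x) < rho -> 0 <= U w <= 1.
  move=> wx; have h : `|U w - 2^-1| <= 2^-1.
    rewrite -Ux (le_trans (lU x w)) // Ux (le_trans (ler_wpM2l (ltW C0) (ltW wx))) //.
    by rewrite /rho invfM mulrCA divff ?gt_eqF // mulr1.
  move: h; rewrite ler_norml lerBlDr lerBrDr addNr -[X in X + X]div1r -splitr => /andP[-> ->] //.
pose P w := d1 * seg (fun s => f s 2^-1) 2^-1 (S w) + d2 * seg (f (S w)) 2^-1 (T w).
have half01 : 0 <= (2^-1 : R) <= 1 by rewrite invr_ge0 ler0n invf_le1 // ler1n.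
exists rho => //; exists P => w0 w0x e e0.
pose K := C * (nm d1 + nm d2) + 1.
have N0 : 0 <= nm d1 + nm d2 by rewrite addr_ge0 ?nm_ge0.
have K0 : 0 < K by rewrite ltr_wpDl // mulr_ge0 // ltW.
have [q q0 Hq] : exists2 q : R, 0 < q & forall y, nm (y - w0) < q -> nm (F y - F w0) <= e / K.
  have := cF (inI S lS Sx _ w0x) (inI T lT Tx _ w0x); rewrite paraK => /(_ _ (divr_gt0 e0 K0)) [q q0 Hq]; exists q => //.
have [i0 Hi] := ball_inner w0x.
have K20 : 0 < 2 * K by rewrite mulr_gt0.
exists (Num.min (rho - nm (w0 - x)) (q / (2 * K))); first by rewrite lt_min i0 divr_gt0.
move=> w w'; rewrite !lt_min => /andP[/Hi w1 w2] /andP[/Hi w'1 w'2].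
have s01 := inI S lS Sx w w1; have t01 := inI T lT Tx w w1.
have s'01 := inI S lS Sx w' w'1; have t'01 := inI T lT Tx w' w'1.
have ds := lS w w'; have dt := lT w w'.
set s := S w in s01 ds *; set t := T w in t01 dt *; set s' := S w' in s'01 ds *; set t' := T w' in t'01 dt *.
have PE : P w' - P w = d1 * seg (fun s => f s t) s s' + d2 * seg (f s') t t'.
  have := rect0 s01 s'01 half01 t01; rewrite /rect /P -/s -/s' -/t -/t'.
  rewrite -(seg_split (fun s => f s 2^-1) 2^-1 s s') -(seg_split (f s') 2^-1 t t').
  move: (seg _ _ _) (seg _ _ _) (seg _ _ _) (seg _ _ _) (seg _ _ _) (seg _ _ _) => a1 a2 a3 a4 a5 a6 h.
  apply/eqP; rewrite -subr_eq0 -h; apply/eqP; ring.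
have near (a b : R) : `|a - s| <= C * nm (w' - w) -> `|b - t| <= C * nm (w' - w) -> nm (f a b - F w0) <= e / K.
  move=> ha hb; apply: Hq.
  have dw : nm (w' - w) <= 2 * (q / (2 * K)).
    have := nm_triangle w0 w' w; rewrite (nmB w0 w) => /le_trans; apply.
    by rewrite mulr_natl mulr2n lerD // ltW.
  apply: (le_lt_trans (nm_triangle (para s t) _ _)).
  have -> : q = C * (2 * (q / (2 * K))) * (nm d1 + nm d2) + 2 * (q / (2 * K)).
    by rewrite /K; field; rewrite gt_eqF.
  rewrite [X in _ + nm (X - _)]paraK; apply: ler_ltD; last first.
    by apply: lt_le_trans w2 _; rewrite ler_peMl ?ler1n // divr_ge0 // ltW.
  apply: (le_trans (para_dist _ _ _ _)); rewrite mulrDr.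
  apply: lerD; apply: ler_wpM2r; rewrite ?nm_ge0 //.
    by apply: le_trans ha _; rewrite ler_wpM2l // ltW.
  by apply: le_trans hb _; rewrite ler_wpM2l // ltW.
have nC : 0 <= C * nm (w' - w) by rewrite mulr_ge0 ?nm_ge0 ?ltW.
have e1 : nm (seg (fun s => f s t) s s' - F w0 * (s' - s)%:C) <= e / K * `|s' - s|.
  apply: seg_near => //; first exact: (continuous_on_row cf).
  by move=> y y01 ys; apply: near; [exact: le_trans ds|rewrite subrr normr0].
have e2 : nm (seg (f s') t t' - F w0 * (t' - t)%:C) <= e / K * `|t' - t|.
  apply: seg_near => //; first exact: (continuous_on_col cf).
  by move=> y y01 ys; apply: near; [exact: ds|exact: le_trans dt].
have wE : w' - w = (s' - s)%:C * d1 + (t' - t)%:C * d2 by rewrite -paraB !paraK.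
rewrite PE {1}wE.
have -> : d1 * seg (fun s => f s t) s s' + d2 * seg (f s') t t' -
    F w0 * ((s' - s)%:C * d1 + (t' - t)%:C * d2) =
  d1 * (seg (fun s => f s t) s s' - F w0 * (s' - s)%:C) + d2 * (seg (f s') t t' - F w0 * (t' - t)%:C).
  by move: (seg _ _ _) (seg _ _ _) ((s' - s)%:C) ((t' - t)%:C) => *; ring.
rewrite (le_trans (nmD _ _)) // !nmM.
have eK0 : 0 <= e / K by rewrite divr_ge0 // ltW.
apply: (@le_trans _ _ (nm d1 * (e / K * (C * nm (w' - w))) + nm d2 * (e / K * (C * nm (w' - w))))).
  apply: lerD; apply: ler_wpM2l; rewrite ?nm_ge0 //.
    by apply: le_trans e1 _; exact: ler_wpM2l.
  by apply: le_trans e2 _; exact: ler_wpM2l.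
have -> : nm d1 * (e / K * (C * nm (w' - w))) + nm d2 * (e / K * (C * nm (w' - w))) =
  e * nm (w' - w) * ((C * (nm d1 + nm d2)) / K) by ring.
by rewrite ler_piMr ?mulr_ge0 ?nm_ge0 ?(ltW e0) // ler_pdivrMr // mul1r /K lerDl.
Qed.

End Parallelogram.

(** * Slope bounds and Baire's theorem *)

Section Gateaux.
Variable R : realType.
Variables (D : set R[i]) (F : R[i] -> R[i]).
Hypothesis oD : eopen D.
Hypothesis cF : forall z, D z -> cont_at F z.
Hypothesis gF : forall z, D z -> exists d : R[i], forall v (e : R), 0 < e ->
  exists2 r : R, 0 < r & forall h : R, 0 < h -> h < r ->
    nm (F (z + h%:C * v) - F z - h%:C * v * d) <= e * h.

Definition direction (tau : R) : R[i] := 1 + tau%:C * 'i%C.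

Lemma nm_direction tau : 0 <= tau <= 2 -> nm (direction tau) <= 3.
Proof.
move=> /andP[t0 t2]; rewrite (le_trans (nmD _ _)) // nm1 nmM nmi nm_real mulr1 ger0_norm //; lra.
Qed.

(** One integer bounds the quotient and, through [r / N.+1%:R], also limits the range of the steps;
    countably many conditions arise in this way. *)
Definition slope_bound (r : R) (N : nat) z tau := forall h : R, 0 <= h <= r / N.+1%:R ->
  nm (F (z + h%:C * direction tau) - F z) <= N%:R * h.

(** In [B], the first two summands bound the quotient by the derivative plus 1, and [r / q] forces
    the steps into the range where that derivative is accurate. *)
Lemma slope_bound_exists z tau r : D z -> 0 < r -> exists N, slope_bound r N z tau.
Proof.
move=> /gF [d Hd] r0; have [q q0 Hq] := Hd (direction tau) 1 ltr01.
pose B : R := nm (direction tau * d) + 1 + r / q.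
have dd0 := nm_ge0 (direction tau * d).
have rq0 : 0 < r / q by rewrite divr_gt0.
have B0 : 0 <= B by rewrite /B; lra.
exists (Num.bound B) => h; have := archi_boundP B0; set N := Num.bound B => BN /andP[].
rewrite le_eqVlt => /orP[/eqP<- _|h0 hr].
  by rewrite mul0r addr0 subrr nm0 mulr0.
have hq : h < q.
  apply: le_lt_trans hr _; rewrite ltr_pdivrMr ?ltr0n // mulrC -ltr_pdivrMr //.
  by rewrite -natr1; move: BN; rewrite /B; lra.
have := Hq h h0 hq; rewrite mul1r => H.
have -> : F (z + h%:C * direction tau) - F z =
   (F (z + h%:C * direction tau) - F z - h%:C * direction tau * d) + h%:C * (direction tau * d).
  by rewrite mulrA subrK.
rewrite (le_trans (nmD _ _)) // [in X in _ + X]nmM nm_real gtr0_norm //.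
have : (nm (direction tau * d) + 1) * h <= N%:R * h.
  by rewrite ler_wpM2r ?(ltW h0) //; move: BN; rewrite /B; lra.
lra.
Qed.

Lemma slope_violation r N z tau : ~ slope_bound r N z tau -> exists2 h : R,
  0 <= h <= r / N.+1%:R & N%:R * h < nm (F (z + h%:C * direction tau) - F z).
Proof.
move=> nH; apply: contrapT => nE; apply: nH => h hr.
by rewrite leNgt; apply/negP => lt; apply: nE; exists h.
Qed.

Lemma violation_open w z (B : R) : D w -> D z -> B < nm (F w - F z) -> exists2 r : R, 0 < r &
  forall w' z', nm (w' - w) < r -> nm (z' - z) < r -> B < nm (F w' - F z').
Proof.
move=> Dw Dz lt; pose e := (nm (F w - F z) - B) / 3.
have e0 : 0 < e by rewrite divr_gt0 // subr_gt0.
have [r1 r10 H1] := cF Dw e0; have [r2 r20 H2] := cF Dz e0.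
exists (Num.min r1 r2); first by rewrite lt_min r10.
move=> w' z'; rewrite !lt_min => /andP[w1 _] /andP[_ z2].
have a1 := H1 _ w1; have a2 := H2 _ z2; rewrite nmB in a1.
have t1 := nm_triangle (F z') (F w) (F z); have t2 := nm_triangle (F w') (F w) (F z').
by move: a1 a2 t1 t2 lt; rewrite /e; lra.
Qed.

(** A violation is a strict inequality between values of a continuous function and persists for
    nearby points and slopes. The factor 4 leaves room for a displacement of length at most
    [3 * r0]. *)
Lemma slope_bound_closed r N z tau z0 (r0 : R) : (forall y, nm (y - z0) < 4 * r0 -> D y) ->
  nm (z - z0) < r0 -> r <= r0 -> 0 <= tau <= 2 -> ~ slope_bound r N z tau -> exists2 q : R, 0 < q &
    forall z' tau', nm (z' - z) < q -> `|tau' - tau| < q -> ~ slope_bound r N z' tau'.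
Proof.
move=> HD zz rr t02 /slope_violation [h /andP[h0 hr] lt].
have r0p : 0 < r0 by apply: le_lt_trans zz; rewrite nm_ge0.
have hr0 : h <= r0.
  apply: le_trans hr _; rewrite ler_pdivrMr ?ltr0n //; apply: le_trans rr _.
  by rewrite ler_peMr ?(ltW r0p) // ler1n.
have Dz : D z by apply: HD; apply: lt_le_trans zz _; lra.
have Dw : D (z + h%:C * direction tau).
  apply: HD; have -> : z + h%:C * direction tau - z0 = (z - z0) + h%:C * direction tau by ring.
  apply: le_lt_trans (nmD _ _) _; rewrite nmM nm_real (ger0_norm h0).
  have : h * nm (direction tau) <= r0 * 3 by rewrite ler_pM ?nm_ge0 ?nm_direction.
  lra.
have [q q0 Hq] := violation_open Dw Dz lt.
have C0 : 0 < 1 + r0 by lra.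
exists (Num.min q (q / 2 / (1 + r0))); first by rewrite lt_min q0 !divr_gt0.
move=> z' tau'; rewrite !lt_min => /andP[zq zq2] /andP[_ tq] H.
have : nm (z' + h%:C * direction tau' - (z + h%:C * direction tau)) < q.
  have -> : z' + h%:C * direction tau' - (z + h%:C * direction tau) =
     (z' - z) + (h * (tau' - tau))%:C * 'i%C.
    by rewrite /direction rmorphM rmorphB /=; move: (h%:C) (tau%:C) (tau'%:C) => *; ring.
  apply: le_lt_trans (nmD _ _) _; rewrite nmM nmi mulr1 nm_real normrM (ger0_norm h0).
  have -> : q = q / 2 / (1 + r0) + r0 * (q / 2 / (1 + r0)) + q / 2 by field; rewrite gt_eqF.
  have : h * `|tau' - tau| <= r0 * (q / 2 / (1 + r0)) by rewrite ler_pM // ltW.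
  lra.
move=> /Hq /(_ zq); rewrite ltNge => /negP; apply; apply: H.
by rewrite h0.
Qed.

(** The triple ranges over a countable type, as Baire's theorem requires, and fixes one bound for a
    whole interval of slopes, which will span the cone. *)
Definition dyadic_slopes r z (c : nat * nat * nat) : Prop := let: (N, k, j) := c in
  j.+1%:R / 2 ^+ k <= 2 :> R /\
  forall tau, j%:R / 2 ^+ k <= tau <= j.+1%:R / 2 ^+ k -> slope_bound r N z tau.

(** A first use of Baire's theorem, in the slope with [z] fixed: the bound depends on the slope, but
    one bound serves an interval of them. Slopes are the points of the real axis in the disc of
    radius 1 about 1. *)
Lemma dyadic_slopes_exists z z0 (r0 : R) : (forall y, nm (y - z0) < 4 * r0 -> D y) ->
  nm (z - z0) < r0 -> exists c, dyadic_slopes r0 z c.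
Proof.
move=> HD zz; have r0p : 0 < r0 by apply: le_lt_trans zz; rewrite nm_ge0.
have Dz : D z by apply: HD; apply: lt_le_trans zz _; lra.
pose K (w : R[i]) := complex.Im w = 0.
have near1 (y : R[i]) : nm (y - 1) < 1 -> 0 < complex.Re y < 2.
  move=> /(le_lt_trans (nm_le_Re _)); rewrite raddfB /= ltr_norml => /andP[h1 h2].
  by apply/andP; split; lra.
have [|||y|N [x [rho [Kx rho0 inb HE]]]] := @baire_complex R K
  (fun n w => slope_bound r0 n z (complex.Re w)) 1 1 _ ltr01.
- by [].
- move=> y _ H; apply/eqP; rewrite -normr_eq0; apply/eqP.
  apply/eqP; rewrite eq_le normr_ge0 andbT; apply/ler_addgt0Pr => e e0.
  have [w Kw wy] := H e e0; have := le_trans (nm_le_Im _) (ltW wy).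
  by rewrite raddfB /= [complex.Im w]Kw sub0r normrN add0r.
- move=> n y /near1 /andP[y0 y2] Ky nE.
  have y02 : 0 <= complex.Re y <= 2 by rewrite !ltW.
  have [q q0 Hq] := slope_bound_closed HD zz (lexx r0) y02 nE.
  exists q => // w Kw wy; apply: Hq; first by rewrite subrr nm0.
  by apply: le_lt_trans wy; rewrite -raddfB; exact: nm_le_Re.
- by move=> _ _; exact: slope_bound_exists.
have [k Hk] := half_pow_small ltr01 (divr_gt0 rho0 (ltr0n _ 2)).
have p0 : 0 < 2 ^+ k :> R by rewrite exprn_gt0.
have := Hk k (leqnn k); rewrite div1r => {}Hk.
have x1 : nm (x - 1) < 1 by apply: inb; rewrite subrr nm0.
have /andP[u0 u2] := near1 x x1; set u := complex.Re x in u0 u2.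
pose j := Num.truncn (u * 2 ^+ k).
have /andP[j1 j2] := truncn_itv (mulr_ge0 (ltW u0) (ltW p0)).
have {}j1 : j%:R / 2 ^+ k <= u by rewrite ler_pdivrMr.
have {}j2 : u < j.+1%:R / 2 ^+ k by rewrite ltr_pdivlMr.
have jS : j.+1%:R / 2 ^+ k = j%:R / 2 ^+ k + (2 ^+ k)^-1 :> R by rewrite -natr1 mulrDl mul1r.
have close tau : j%:R / 2 ^+ k <= tau <= j.+1%:R / 2 ^+ k -> nm (tau%:C - x) < rho.
  move=> /andP[]; rewrite jS => t1 t2.
  have -> : tau%:C - x = (tau - u)%:C by rewrite rmorphB /= [x in LHS]complexE -/u [complex.Im x]Kx mulr0 addr0.
  rewrite nm_real ltr_norml; move: j2 p0; rewrite jS -invr_gt0 => j2 p0.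
  by apply/andP; split; lra.
exists (N, k, j); split=> [|tau ti]; last by apply: (HE tau%:C) => //; exact: close.
have /close /inb /near1 /andP[_ /ltW] : j%:R / 2 ^+ k <= (j.+1%:R / 2 ^+ k : R) <= j.+1%:R / 2 ^+ k.
  by rewrite lexx andbT jS lerDl invr_ge0 ltW.
by [].
Qed.

(* Baire's theorem on the closed set of the points without local primitive. *)
Lemma local_primitive_portion z0 (r0 : R) : (forall y, nm (y - z0) < 4 * r0 -> D y) -> 0 < r0 ->
  ~ has_local_primitive F z0 ->
  exists c x (rho : R), [/\ ~ has_local_primitive F x, 0 < rho,
    forall w, nm (w - x) < rho -> nm (w - z0) < r0 &
    forall w, ~ has_local_primitive F w -> nm (w - x) < rho -> dyadic_slopes r0 w c].
Proof.
move=> HD r0p nz.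
have [y yz H [r r0' [P HP]]|n y yz Ky nE|y yz Ky|n [x [rho [Kx rho0 inb HE]]]] :=
  @baire_complex R (fun z => ~ has_local_primitive F z)
  (fun n z => exists2 c, unpickle n = Some c & dyadic_slopes r0 z c) z0 r0 nz r0p.
- have [w Kw wy] := H r r0'; apply: Kw.
  have [q0 Hq] := ball_inner wy; exists (r - nm (w - y)) => //; exists P => v vw.
  by apply: HP; exact: Hq.
(* Numbers that encode no triple, or an interval of slopes reaching beyond 2, give empty sets. *)
- case E : (unpickle n) => [[[N k] j]|]; last by exists 1 => // w _ _ [].
  have [j2|j2] := leP (j.+1%:R / 2 ^+ k : R) 2; last first.
    exists 1 => // w _ _ [c] [<-] [] /le_lt_trans /(_ j2); by rewrite ltxx.
  have [tau tI nS] : exists2 tau, j%:R / 2 ^+ k <= tau <= j.+1%:R / 2 ^+ k & ~ slope_bound r0 N y tau.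
    apply: contrapT => nT; apply: nE; exists (N, k, j) => //; split=> // tau tI.
    by apply: contrapT => nS; apply: nT; exists tau.
  have t02 : 0 <= tau <= 2.
    case/andP: tI => t1 t2; rewrite (le_trans t2 j2) andbT; apply: le_trans t1.
    by rewrite divr_ge0 // exprn_ge0.
  have [q q0 Hq] := slope_bound_closed HD yz (lexx r0) t02 nS.
  exists q => // w _ wy [c] [<-] [_ Hs].
  by apply: (Hq w tau) => //; rewrite ?subrr ?normr0 //; exact: Hs.
- have [c Hc] := dyadic_slopes_exists HD yz.
  by exists (pickle c); exists c => //; rewrite pickleK.
have xx : nm (x - x) < rho by rewrite subrr nm0.
have [c Ec _] := HE x Kx xx; exists c, x, rho; split=> // w Kw wx.
by have [c'] := HE w Kw wx; rewrite Ec => -[<-].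
Qed.

Fact small_sum (p q u v : R) : p <= 2^-1 * (3 * u) -> q <= 2^-1 * (3 * u) -> 8 * u <= v -> 0 < u ->
  p + q < v.
Proof. by move=> *; lra. Qed.

Lemma direction_combination (sg al be s t : R) :
  s%:C * (sg%:C * direction al) + t%:C * (sg%:C * direction be) =
  (sg * (s + t))%:C + 'i%C * (sg * (s * al + t * be))%:C.
Proof.
rewrite /direction !rmorphM /= !rmorphD /= !rmorphM /=.
by move: (s%:C) (t%:C) (sg%:C) (al%:C) (be%:C) => *; ring.
Qed.

(** The linear system for the coordinates is solved explicitly; it degenerates with [be - al], which
    explains the constant. The point [x] is the centre of the parallelogram. *)
Lemma parallelogram_coordinates (sg al be : R) x : 0 < sg -> 0 <= al -> al < be -> be <= 2 ->
  let d1 := sg%:C * direction al in let d2 := sg%:C * direction be in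
  let z1 := x - (d1 + d2) / 2 in
  exists (S T : R[i] -> R) (C : R), [/\ 0 < C, forall w, para z1 d1 d2 (S w) (T w) = w,
    forall w w', `|S w' - S w| <= C * nm (w' - w),
    forall w w', `|T w' - T w| <= C * nm (w' - w) & S x = 2^-1 /\ T x = 2^-1].
Proof.
move=> sg0 al0 ab be2 d1 d2 z1.
have ga0 : 0 < be - al by rewrite subr_gt0.
pose p w := complex.Re (w - z1) / sg; pose q w := complex.Im (w - z1) / sg.
pose T w := (q w - al * p w) / (be - al); pose S w := p w - T w.
have C00 : 0 < 1 + 3 / (be - al) by rewrite ltr_wpDr // divr_ge0 ?ltW.
have isg0 : 0 <= sg^-1 by rewrite invr_ge0 ltW.
exists S, T, ((1 + 3 / (be - al)) / sg).
have pB w w' : `|p w' - p w| <= nm (w' - w) / sg.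
  rewrite /p -mulrBl -raddfB /= normrM (ger0_norm isg0) ler_wpM2r //.
  by rewrite (le_trans (nm_le_Re _)) // (_ : w' - z1 - (w - z1) = w' - w) //; ring.
have qB w w' : `|q w' - q w| <= nm (w' - w) / sg.
  rewrite /q -mulrBl -raddfB /= normrM (ger0_norm isg0) ler_wpM2r //.
  by rewrite (le_trans (nm_le_Im _)) // (_ : w' - z1 - (w - z1) = w' - w) //; ring.
have TB w w' : `|T w' - T w| <= 3 / (be - al) * (nm (w' - w) / sg).
  have -> : T w' - T w = ((q w' - q w) - al * (p w' - p w)) / (be - al) by rewrite /T; ring.
  have iga0 : 0 <= (be - al)^-1 by rewrite invr_ge0 ltW.
  rewrite normrM (ger0_norm iga0) mulrAC ler_wpM2r //.
  apply: (le_trans (ler_normB _ _)); rewrite normrM (ger0_norm al0).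
  have h : al * `|p w' - p w| <= 2 * (nm (w' - w) / sg).
    by apply: ler_pM => //; apply: le_trans be2; exact: ltW.
  by move: (qB w w') h; move: (_ / sg) => *; lra.
have alg (g n : R) : (1 + g) / sg * n = n / sg + g * (n / sg) by ring.
split.
- by rewrite divr_gt0.
- move=> w; rewrite /para -addrA direction_combination.
  have -> : sg * (S w + T w) = complex.Re (w - z1) by rewrite /S subrK /p mulrC divfK ?gt_eqF.
  have -> : sg * (S w * al + T w * be) = complex.Im (w - z1).
    have -> : S w * al + T w * be = al * p w + T w * (be - al) by rewrite /S; ring.
    by rewrite /T divfK ?gt_eqF // addrC subrK /q mulrC divfK ?gt_eqF.
  by rewrite -complexE addrC subrK.
- move=> w w'; have -> : S w' - S w = (p w' - p w) - (T w' - T w) by rewrite /S; ring.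
  by rewrite alg (le_trans (ler_normB _ _)) // lerD // pB.
- move=> w w'; apply: (le_trans (TB w w')).
  by rewrite alg lerDr mulr_ge0 ?nm_ge0.
have xz : x - z1 = (sg)%:C + 'i%C * (sg * ((al + be) / 2))%:C.
  have := direction_combination sg al be 2^-1 2^-1.
  have -> : sg * (2^-1 + 2^-1) = sg by rewrite -[X in X + X]div1r -splitr mulr1.
  have -> : sg * (2^-1 * al + 2^-1 * be) = sg * ((al + be) / 2) by ring.
  move=> <-; rewrite /z1 /d1 /d2 fmorphV rmorph_nat.
  by move: (sg%:C * _) (sg%:C * _) => u v; field.
have px : p x = 1 by rewrite /p xz /= !mul0r !mul1r !subr0 addr0 divff ?gt_eqF.
have qx : q x = (al + be) / 2.
  by rewrite /q xz /= !mul0r !mul1r !add0r mulrAC divff ?gt_eqF // mul1r.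
have Tx : T x = 2^-1 by rewrite /T px qx; field; rewrite gt_eqF.
by rewrite /S px Tx; split => //; lra.
Qed.

(** In a small parallelogram about a point of the portion, with sides of slopes [al] and [be], every
    step to the upper right has a slope between these two, so the slope bounds become the cone
    estimate. The integrals then vanish, and a primitive appears at a point that was to have
    none. *)
Lemma gateaux_local_primitive z : D z -> has_local_primitive F z.
Proof.
move=> Dz; apply: contrapT => nz; have [r r_gt0 Hr] := oD Dz.
pose r0 := r / 4; have r00 : 0 < r0 by rewrite divr_gt0.
have HD y : nm (y - z) < 4 * r0 -> D y.
  by move=> yz; apply: Hr; move: yz; rewrite /r0 mulrC divfK.
have [[[N k] j] [x [rho [nx rho0 inb Hs]]]] := local_primitive_portion HD r00 nz.
have xx : nm (x - x) < rho by rewrite subrr nm0.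
have [j2 _] := Hs x nx xx; apply: nx.
have p0 : 0 < 2 ^+ k :> R by rewrite exprn_gt0.
pose al : R := j%:R / 2 ^+ k; pose be : R := j.+1%:R / 2 ^+ k.
have al0 : 0 <= al by rewrite divr_ge0 // ltW.
have ab : al < be by rewrite ltr_pM2r ?invr_gt0 // ltr_nat.
(* The first term keeps the parallelogram within the portion, the second keeps its steps in the
   range of [slope_bound]. *)
pose sg := Num.min (rho / 8) (r0 / N.+1%:R / 2).
have sg0 : 0 < sg by rewrite lt_min !divr_gt0.
have [sg1 sg2] : 8 * sg <= rho /\ 2 * sg <= r0 / N.+1%:R.
  by split; rewrite mulrC -ler_pdivlMr // ge_min lexx ?orbT.
have [S [T [C [C0 paraK lS lT [Sx Tx]]]]] := parallelogram_coordinates x sg0 al0 ab j2.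
set d1 := sg%:C * direction al in paraK *; set d2 := sg%:C * direction be in paraK *.
set z1 := x - (d1 + d2) / 2 in paraK.
have n1 : nm d1 <= 3 * sg.
  by rewrite /d1 nmM nm_real gtr0_norm // mulrC ler_wpM2r ?(ltW sg0) // nm_direction // al0 (le_trans (ltW ab)).
have n2 : nm d2 <= 3 * sg.
  by rewrite /d2 nmM nm_real gtr0_norm // mulrC ler_wpM2r ?(ltW sg0) // nm_direction // j2 (le_trans al0) ?ltW.
have d10 : d1 != 0.
  apply/eqP => /(congr1 (@complex.Re R)); rewrite /d1 /= !mul0r mulr0 !subr0 addr0 mulr1 => /eqP.
  by rewrite gt_eqF.
have d20 : d2 != 0.
  apply/eqP => /(congr1 (@complex.Re R)); rewrite /d2 /= !mul0r mulr0 !subr0 addr0 mulr1 => /eqP.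
  by rewrite gt_eqF.
have inR s t : 0 <= s <= 1 -> 0 <= t <= 1 -> nm (para z1 d1 d2 s t - x) < rho.
  move=> /andP[s0 s1] /andP[t0 t1].
  have -> : para z1 d1 d2 s t - x = (s - 2^-1)%:C * d1 + (t - 2^-1)%:C * d2.
    have alg (p q u v y : R[i]) : y - (u + v) / 2 + p * u + q * v - y = (p - 2^-1) * u + (q - 2^-1) * v.
      by field.
    by rewrite /para /z1 alg !rmorphB /= fmorphV rmorph_nat.
  apply: (le_lt_trans (nmD _ _)); rewrite (nmM _ d1) (nmM _ d2) !nm_real.
  have h (u : R) : 0 <= u -> u <= 1 -> `|u - 2^-1| <= 2^-1.
    by move=> u0 u1; rewrite ler_norml; apply/andP; split; lra.
  have h1 : `|s - 2^-1| * nm d1 <= 2^-1 * (3 * sg) by apply: ler_pM; rewrite ?nm_ge0 ?h.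
  have h2 : `|t - 2^-1| * nm d2 <= 2^-1 * (3 * sg) by apply: ler_pM; rewrite ?nm_ge0 ?h.
  apply: (small_sum h1 h2 sg1 sg0).
have Dp s t : 0 <= s <= 1 -> 0 <= t <= 1 -> D (para z1 d1 d2 s t).
  by move=> s01 t01; apply: HD; apply: lt_le_trans (inb _ (inR s t s01 t01)) _; rewrite ler_peMl ?(ltW r00) // ler1n.
have cP s t : 0 <= s <= 1 -> 0 <= t <= 1 -> cont_at F (para z1 d1 d2 s t).
  by move=> s01 t01; apply: cF; exact: Dp.
have cf := para_uniform cP.
pose K s t := ~ has_local_primitive F (para z1 d1 d2 s t).
have loc s t : 0 <= s <= 1 -> 0 <= t <= 1 -> ~ K s t ->
  exists2 r : R, 0 < r & forall a b c d, 0 <= a -> a <= b -> b <= 1 -> 0 <= c -> c <= d -> d <= 1 ->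
    `|a - s| < r -> `|b - s| < r -> `|c - t| < r -> `|d - t| < r ->
    rect (fun s t => F (para z1 d1 d2 s t)) d1 d2 a b c d = 0.
  by move=> s01 t01 /contrapT; exact: primitive_rect0.
have cone s t u v : K s t -> 0 <= s -> 0 <= t -> s <= u -> t <= v -> u <= 1 -> v <= 1 ->
  nm (F (para z1 d1 d2 u v) - F (para z1 d1 d2 s t)) <= N%:R * sg * ((u - s) + (v - t)).
  move=> Kst s0 t0 su tv u1 v1.
  have us0 : 0 <= u - s by rewrite subr_ge0.
  have vt0 : 0 <= v - t by rewrite subr_ge0.
  have s01 : 0 <= s <= 1 by rewrite s0 (le_trans su u1).
  have t01 : 0 <= t <= 1 by rewrite t0 (le_trans tv v1).
  have [_ slope] := Hs _ Kst (inR s t s01 t01).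
  pose h := sg * ((u - s) + (v - t)).
  have [z0|hz] := eqVneq ((u - s) + (v - t)) 0.
    have /eqP := z0; rewrite paddr_eq0 // !subr_eq0 => /andP[/eqP -> /eqP ->].
    by rewrite !subrr nm0 addr0 mulr0.
  have hp : 0 < (u - s) + (v - t) by rewrite lt_neqAle eq_sym hz addr_ge0.
  (* The slope of the step is the mean of [al] and [be] weighted by its coordinates. *)
  pose tau := ((u - s) * al + (v - t) * be) / ((u - s) + (v - t)).
  have tauI : al <= tau <= be.
    rewrite /tau ler_pdivlMr // ler_pdivrMr //; move: us0 vt0 ab.
    by move: (u - s) (v - t) => p q p0' q0 ab; apply/andP; split; nra.
  have := slope tau tauI h _; rewrite mulrA -/h.
  have -> : para z1 d1 d2 s t + h%:C * direction tau = para z1 d1 d2 u v.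
    have -> : para z1 d1 d2 u v = para z1 d1 d2 s t + (para z1 d1 d2 u v - para z1 d1 d2 s t).
      by rewrite addrC subrK.
    rewrite paraB direction_combination; congr (_ + _).
    rewrite /direction mulrDr mulr1 mulrA -rmorphM mulrC -/h; congr (_ + _ * _%:C).
    by rewrite /h /tau -mulrA [_ * (_ / _)]mulrC divfK.
  move=> /(_ _); apply; rewrite mulr_ge0 ?(ltW sg0) ?(ltW hp) //=.
  apply: le_trans sg2; rewrite /h mulrC ler_wpM2r ?(ltW sg0) //.
  by move: s0 t0 u1 v1; lra.
have gat s t : 0 <= s <= 1 -> 0 <= t <= 1 -> exists E : R[i],
  forall v1 v2 (e : R), 0 < e -> exists2 r : R, 0 < r & forall h, 0 < h -> h < r ->
    0 <= s + h * v1 <= 1 -> 0 <= t + h * v2 <= 1 ->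
    nm (F (para z1 d1 d2 (s + h * v1) (t + h * v2)) - F (para z1 d1 d2 s t)
      - h%:C * (v1%:C * d1 + v2%:C * d2) * E) <= e * h.
  move=> s01 t01; have [E HE] := gF (Dp s t s01 t01); exists E => v1 v2 e e0.
  have [q q0 Hq] := HE (v1%:C * d1 + v2%:C * d2) e e0; exists q => // h h0 hq _ _.
  have -> : para z1 d1 d2 (s + h * v1) (t + h * v2) =
     para z1 d1 d2 s t + h%:C * (v1%:C * d1 + v2%:C * d2).
    rewrite /para !rmorphD /= !rmorphM /=.
    by move: (s%:C) (t%:C) (h%:C) (v1%:C) (v2%:C) => *; ring.
  exact: Hq.
have L0 : 0 <= N%:R * sg by rewrite mulr_ge0 // ltW.
have sq0 (a c h : R) : 0 <= a -> 0 <= c -> 0 < h -> a + h <= 1 -> c + h <= 1 ->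
    rect (fun s t => F (para z1 d1 d2 s t)) d1 d2 a (a + h) c (c + h) = 0.
  by move=> a0 c0 h0 ah ch; apply: (square_integral0 cf loc L0 cone gat).
exact: (rect0_primitive cf (rect_all0 cf sq0) C0 paraK lS lT Sx Tx cP).
Qed.

Theorem gateaux_hol : hol D F.
Proof.
move=> z Dz; have [r r0 [P HP]] := gateaux_local_primitive Dz.
exact: (hol_of_primitive r0 HP).
Qed.

End Gateaux.

(** * The algebra *)

Section CartanAlgebra.
Variables (R : realType) (A : falgType R[i]) (m n : nat).
Variables (I : n.-tuple A) (Y : 'I_n -> 'I_n -> 'I_n -> R[i]) (us : 'I_n -> 'I_n).
Hypothesis mulAC : forall x y : A, x * y = y * x.
Hypothesis cartan : cartan_basis m I Y us.
Implicit Types (x y v J : A) (j k l q r s u : 'I_n).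

Lemma coord_sum v : v = \sum_k coord I k v *: tnth I k.
Proof.
have [bI _ _ _ _] := cartan; rewrite {1}(coord_basis bI (memvf v)).
by apply: eq_bigr => k _; rewrite (tnth_nth 0).
Qed.

Lemma coord_tnth j k : coord I j (tnth I k) = (k == j)%:R.
Proof.
have [bI _ _ _ _] := cartan.
by rewrite (tnth_nth 0) coord_free ?(basis_free bI).
Qed.

Lemma coord_inj x y : (forall k, coord I k x = coord I k y) -> x = y.
Proof. by move=> H; rewrite (coord_sum x) (coord_sum y); apply: eq_bigr => k _; rewrite H. Qed.

(* The index [u_s], extended by [u_r = r] to the indices of the idempotents. *)
Definition block k : 'I_n := if (k < m)%N then k else us k.

Lemma block_lt k : (block k < m)%N.
Proof.
have [_ _ _ H _] := cartan; rewrite /block; case: ifP => // /negbT.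
by rewrite -leqNgt => /H [].
Qed.

Lemma block_id u : (u < m)%N -> block u = u.
Proof. by rewrite /block => ->. Qed.

Lemma idempotent_mul u k : (u < m)%N ->
  tnth I u * tnth I k = if u == block k then tnth I k else 0.
Proof.
have [_ H1 _ H3 _] := cartan => um; rewrite /block; have [km|mk] := ltnP k m.
  by rewrite H1 //; have [->|] := eqVneq u k.
by have [_] := H3 k mk; apply.
Qed.

(** Multiplication by [tnth I r] fixes [tnth I s] if [r] is the idempotent of its block; otherwise
    it raises the index or gives 0. *)
Lemma coord_mul_basis j r s : (j <= s)%N ->
  coord I j (tnth I r * tnth I s) = ((r == block s) && (j == s))%:R.
Proof.
move=> js; have [_ _ H2 _ _] := cartan.
have [rm|mr] := ltnP r m.
  rewrite idempotent_mul //; case: eqP => _ /=; last by rewrite linear0.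
  by rewrite coord_tnth eq_sym.
have -> : (r == block s) = false.
  by apply/eqP => E; have := block_lt s; rewrite -E ltnNge mr.
have [sm|ms] := ltnP s m.
  rewrite mulAC idempotent_mul //; case: eqP => _ /=; last by rewrite linear0.
  rewrite coord_tnth; case: eqP => // rj.
  by move: (leq_ltn_trans js sm); rewrite -rj ltnNge mr.
rewrite H2 // linear_sum big1 //= => k; rewrite gtn_max => /andP[_ sk].
rewrite linearZ /= coord_tnth; case: eqP => [kj|]; last by rewrite mulr0.
by move: (leq_ltn_trans js sk); rewrite -kj ltnn.
Qed.

(* An ideal, because left multiplication is triangular in the basis. *)
Definition vanish_below (k : nat) v : Prop := forall j, (j < k)%N -> coord I j v = 0.

(** Of the factor [x], the leading coordinate of the product sees only the scalar of its block. This
    reduces the algebra derivative to a complex one, coordinate by coordinate. *)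
Lemma coord_mul_vanish (k : nat) x v j : vanish_below k v -> (j <= k)%N ->
  coord I j (x * v) = coord I (block j) x * coord I j v.
Proof.
move=> Wv jk; rewrite [in LHS](coord_sum v) mulr_sumr linear_sum (bigD1 j) //= -scalerAr linearZ /=.
rewrite [X in _ + X]big1 ?addr0 => [|s sj]; last first.
  rewrite -scalerAr linearZ /=; have [sk|ks] := ltnP s k; first by rewrite Wv ?mul0r.
  have js : (j < s)%N by rewrite ltn_neqAle eq_sym sj (leq_trans jk).
  rewrite {1}(coord_sum x) mulr_suml linear_sum big1 ?mulr0 //= => r _.
  by rewrite -scalerAl linearZ /= coord_mul_basis ?(ltnW js) // (eq_sym j) (negbTE sj) andbF mulr0.
rewrite mulrC; congr (_ * _); rewrite {1}(coord_sum x) mulr_suml linear_sum (bigD1 (block j)) //=.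
rewrite -scalerAl linearZ /= coord_mul_basis // !eqxx mulr1 big1 ?addr0 // => r rj.
by rewrite -scalerAl linearZ /= coord_mul_basis // (negbTE rj) mulr0.
Qed.

Lemma vanish_all v : vanish_below n v -> v = 0.
Proof. by move=> Wv; apply: coord_inj => k; rewrite linear0 Wv. Qed.

Lemma coord_one u : (u < m)%N -> coord I u 1 = 1.
Proof.
move=> um; have [_ _ _ _ ->] := cartan; rewrite linear_sum (bigD1 u) //= coord_tnth eqxx.
by rewrite big1 ?addr0 // => k /andP[_ ku]; rewrite coord_tnth (negbTE ku).
Qed.

Lemma coord_idempotent_mul u v k : (u < m)%N ->
  coord I k (tnth I u * v) = if u == block k then coord I k v else 0.
Proof.
move=> um; rewrite {1}(coord_sum v) mulr_sumr linear_sum (bigD1 k) //= -scalerAr linearZ /=.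
rewrite idempotent_mul // big1 ?addr0 => [|s sk].
  by case: ifP => _; rewrite ?coord_tnth ?eqxx ?mulr1 // linear0 mulr0.
rewrite -scalerAr linearZ /= idempotent_mul //; case: ifP => _; last by rewrite linear0 mulr0.
by rewrite coord_tnth (negbTE sk) mulr0.
Qed.

(** In block [q] the second factor has scalar 0 and kills the leading coordinate; in the other
    blocks the coordinates of [v] vanish anyway. *)
Lemma nilpotent_step q x v (k : nat) : (q < m)%N -> tnth I q * v = v -> vanish_below k v ->
  vanish_below k.+1 (v * (x - coord I q x *: 1)).
Proof.
move=> qm qv Wv j; rewrite ltnS => jk; rewrite mulAC (coord_mul_vanish _ Wv jk).
have [qj|qj] := eqVneq q (block j).
  by rewrite -qj linearB linearZ /= coord_one // mulr1 subrr mul0r.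
by rewrite -qv coord_idempotent_mul // (negbTE qj) mulr0.
Qed.

Lemma vanish_nilpotent q x v (k j : nat) : (q < m)%N -> tnth I q * v = v -> vanish_below k v ->
  vanish_below (k + j) (v * (x - coord I q x *: 1) ^+ j).
Proof.
move=> qm qv Wv; elim: j => [|j IH]; first by rewrite addn0 expr0 mulr1.
rewrite addnS exprSr mulrA; apply: (@nilpotent_step q x _ (k + j) qm) => //.
by rewrite mulrA qv.
Qed.

Lemma nilpotent q x J : (q < m)%N -> tnth I q * J = J -> J * (x - coord I q x *: 1) ^+ n = 0.
Proof.
move=> qm qJ; apply: vanish_all; rewrite -[n in vanish_below n]add0n.
by apply: vanish_nilpotent.
Qed.

Lemma tnth_block k : tnth I (block k) * tnth I k = tnth I k.
Proof. by rewrite idempotent_mul ?block_lt // eqxx. Qed.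

(** A finite geometric series: [t *: 1 - x] is a scalar minus an element [N] with [J * N ^+ n = 0],
    and the product telescopes. *)
Lemma geometric_resolvent q x J (t : R[i]) : (q < m)%N -> tnth I q * J = J -> t != coord I q x ->
  (t *: 1 - x) * (\sum_(j < n) ((t - coord I q x)^-1 ^+ j.+1) *: (J * (x - coord I q x *: 1) ^+ j)) = J.
Proof.
move=> qm qJ tx; have t0 : t - coord I q x != 0 by rewrite subr_eq0.
set N := x - _; set a := t - _ in t0 *.
have -> : t *: 1 - x = a *: 1 - N by rewrite /a /N scalerBl opprB addrA subrK.
pose w (j : nat) := a^-1 ^+ j *: (J * N ^+ j).
rewrite mulr_sumr (eq_bigr (fun j : 'I_n => w j - w j.+1)).
  rewrite -(big_mkord xpredT (fun j : nat => w j - w j.+1)).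
  have -> : \sum_(0 <= j < n) (w j - w j.+1) = - \sum_(0 <= j < n) (w j.+1 - w j).
    by rewrite -sumrN; apply: eq_bigr => j _; rewrite opprB.
  by rewrite telescope_sumr // /w nilpotent // scaler0 sub0r opprK !expr0 mulr1 scale1r.
move=> j _; rewrite mulrBl -scalerAl mul1r scalerA; congr (_ - _).
  by rewrite exprS mulrA divff // mul1r.
by rewrite /w -scalerAr (mulAC N) -mulrA -exprSr.
Qed.

Lemma resolvent x (t : R[i]) : (forall u, (u < m)%N -> t != coord I u x) ->
  (t *: 1 - x)^-1 = \sum_(u < n | (u < m)%N) \sum_(j < n)
     ((t - coord I u x)^-1 ^+ j.+1) *: (tnth I u * (x - coord I u x *: 1) ^+ j).
Proof.
move=> tx; set z := RHS; have [_ H1 _ _ one] := cartan.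
have yz : (t *: 1 - x) * z = 1.
  rewrite /z mulr_sumr [RHS]one; apply: eq_bigr => u um; apply: geometric_resolvent => //.
    by rewrite H1 // eqxx.
  exact: tx.
have Uy : (t *: 1 - x) \is a GRing.unit by apply/unitrP; exists z; rewrite mulAC.
by rewrite -[z in RHS](mulKr Uy) yz mulr1.
Qed.

Lemma cont_trace_resolvent (g : R -> R[i]) xi (k : nat) : (forall t, 0 <= t <= 1 -> g t != xi) ->
  cont_trace g (fun t => (t - xi)^-1 ^+ k).
Proof.
move=> off; elim: k => [|k IH]; first exact: cont_trace_cst.
rewrite (_ : (fun t => _) = fun t => (t - xi)^-1 * (t - xi)^-1 ^+ k); last first.
  by apply/funext => t; rewrite exprS.
apply: (cont_traceM _ IH); apply: cont_at_trace => t t01.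
have z0 : g t - xi != 0 by rewrite subr_eq0 off.
exact: sder_cont (sder_comp (sderB (sder_id _) (sder_cst _ _)) (sderV z0)).
Qed.

(** In the expansion of the resolvent, multiplication by [J] retains the terms of block [q], which
    are Cauchy's formulas for Taylor coefficients. The terms of the other blocks have to be
    integrable before they are killed; this is why the contour must avoid the other points
    [coord I l x]. *)
Lemma mul_cauchy_term (D : set R[i]) F g q J x : (q < m)%N -> tnth I q * J = J ->
  eopen D -> hol D F -> admissible_contour D g -> inside g (coord I q x) ->
  (forall l, (l < m)%N -> l != q -> ~ trace g (coord I l x)) ->
  J * cauchy_term I g F x =
  \sum_(j < n) coefficient F j (coord I q x) *: (J * (x - coord I q x *: 1) ^+ j).
Proof.
move=> qm qJ oD hF ag ins off; have [jg rg _ tD _] := ag.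
have [v cg] := closed_jordan_curve jg rg.
have offt u t : (u < m)%N -> 0 <= t <= 1 -> g t != coord I u x.
  move=> um; move: t; apply/traceP; have [->|uq] := eqVneq u q; first by have [] := ins.
  exact: off.
have cF : cont_trace g F.
  apply: cont_at_trace => t t01; apply: sder_cont (hol_derivative hF _).
  by apply: tD; exists t => //=; rewrite in_itv.
pose L u (j : 'I_n) := contour_integral g (fun t => F t * (t - coord I u x)^-1 ^+ j.+1).
pose N u (j : 'I_n) := tnth I u * (x - coord I u x *: 1) ^+ j.
have HL u j : (u < m)%N -> isint g (fun t => F t * (t - coord I u x)^-1 ^+ j.+1) (L u j).
  move=> um; apply: (isintP cg); apply: (cont_traceM cF).
  by apply: cont_trace_resolvent => t; exact: offt.
have Lq j : L q j = twopii R * coefficient F j (coord I q x).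
  exact: isint_unique (HL q j qm) (admissible_cauchy _ oD hF ag ins).
have intk k : contour_integral g (fun t => coord I k (F t *: (t *: 1 - x)^-1)) =
    \sum_(u < n) \sum_(j < n) (if (u < m)%N then L u j else 0) * coord I k (N u j).
  apply: isint_contour; apply: (@eq_isint _ g (fun t => \sum_(u < n) \sum_(j < n)
     coord I k (N u j) * (if (u < m)%N then F t * (t - coord I u x)^-1 ^+ j.+1 else 0))).
    move=> t t01; rewrite resolvent => [|u um]; last exact: offt.
    rewrite linearZ /= linear_sum [in RHS]big_mkcond mulr_sumr /=; apply: eq_bigr => u _.
    case: ifP => um; last by rewrite big1 ?mulr0 // => j _; rewrite mulr0.
    rewrite linear_sum mulr_sumr; apply: eq_bigr => j _.
    by rewrite linearZ /= mulrA mulrC.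
  apply: isint_sum => u; apply: isint_sum => j; rewrite mulrC.
  apply: isintZ; case: ifP => um; first exact: HL.
  exact: isint0.
have ctE : alg_contour_integral I g (fun t => F t *: (t *: 1 - x)^-1) =
    \sum_(u < n | (u < m)%N) \sum_(j < n) L u j *: N u j.
  apply: coord_inj => k; rewrite /alg_contour_integral linear_sum (bigD1 k) //=.
  rewrite linearZ /= coord_tnth eqxx mulr1 big1 ?addr0 => [|l lk]; last first.
    by rewrite linearZ /= coord_tnth (negbTE lk) mulr0.
  rewrite intk linear_sum [RHS]big_mkcond /=; apply: eq_bigr => u _.
  case: ifP => um; last by rewrite big1 // => j _; rewrite mul0r.
  by rewrite linear_sum; apply: eq_bigr => j _; rewrite linearZ.
rewrite /cauchy_term ctE -scalerAr mulr_sumr (bigD1 q) //= [X in _ *: (_ + X)]big1 ?addr0 => [|u /andP[um uq]]; last first.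
  rewrite mulr_sumr big1 // => j _; rewrite -scalerAr /N mulrA -qJ (mulAC (tnth I q)) -(mulrA J).
  by rewrite idempotent_mul // block_id // eq_sym (negbTE uq) mulr0 mul0r scaler0.
rewrite mulr_sumr scaler_sumr; apply: eq_bigr => j _.
rewrite -scalerAr /N mulrA -{1}qJ (mulAC (tnth I q)) -(mulrA J) idempotent_mul // block_id // eqxx.
rewrite (mulAC J) qJ scalerA Lq mulKf ?twopii_neq0 //.
Qed.

End CartanAlgebra.

(** * Monogenic functions *)

Section Limits.
Variable R : realType.

Lemma common_radius (T : finType) (Q : T -> R -> Prop) :
  (forall t r r', r' <= r -> Q t r -> Q t r') ->
  (forall t, exists2 r : R, 0 < r & Q t r) -> exists2 r : R, 0 < r & forall t, Q t r.
Proof.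
move=> anti H; suff [r r0 Hr] : exists2 r : R, 0 < r & forall t, t \in enum T -> Q t r.
  by exists r => // t; apply: Hr; rewrite mem_enum.
elim: (enum T) => [|t s [r r0 Hr]]; first by exists 1.
have [q q0 Hq] := H t; exists (Num.min r q); first by rewrite lt_min r0.
move=> u; rewrite inE => /orP[/eqP ->|us].
  by apply: anti Hq; rewrite ge_min lexx orbT.
by apply: anti (Hr u us); rewrite ge_min lexx.
Qed.

(* [B r] is the set of the arguments at distance less than [r] of the limit
   point. *)
Variables (T : Type) (B : R -> T -> Prop).
Hypothesis Bmono : forall r r' t, r' <= r -> B r' t -> B r t.
Implicit Types f : T -> R[i].

(** One notion covers both limits in the definition of monogenic functions: with [close_in] for [B]
    it is continuity within [Omega], with [small] the one-sided limit in the step. *)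
Definition limit f l := forall e : R, 0 < e -> exists2 r : R, 0 < r &
  forall t, B r t -> nm (f t - l) <= e.

Lemma limit_cst c : limit (fun=> c) c.
Proof. by move=> e e0; exists 1 => // t _; rewrite subrr nm0 ltW. Qed.

Lemma limitD f1 f2 l1 l2 : limit f1 l1 -> limit f2 l2 -> limit (fun t => f1 t + f2 t) (l1 + l2).
Proof.
move=> H1 H2 e e0; have e20 : 0 < e / 2 by rewrite divr_gt0.
have [r1 r10 Hr1] := H1 _ e20; have [r2 r20 Hr2] := H2 _ e20.
exists (Num.min r1 r2) => [|t Bt]; first by rewrite lt_min r10.
rewrite opprD addrACA (le_trans (nmD _ _)) // (splitr e) lerD //.
  by apply: Hr1; apply: Bmono Bt; rewrite ge_min lexx.
by apply: Hr2; apply: Bmono Bt; rewrite ge_min lexx orbT.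
Qed.

Lemma limitM f1 f2 l1 l2 : limit f1 l1 -> limit f2 l2 -> limit (fun t => f1 t * f2 t) (l1 * l2).
Proof.
move=> H1 H2 e e0; have [d d0 Hd] := prod_close l1 l2 e0.
have [r1 r10 Hr1] := H1 _ d0; have [r2 r20 Hr2] := H2 _ d0.
exists (Num.min r1 r2) => [|t Bt]; first by rewrite lt_min r10.
apply: Hd; [apply: Hr1|apply: Hr2]; apply: Bmono Bt; by rewrite ge_min lexx ?orbT.
Qed.

Lemma limit_sum (J : Type) (s : seq J) (f : J -> T -> R[i]) l :
  (forall j, limit (f j) (l j)) -> limit (fun t => \sum_(j <- s) f j t) (\sum_(j <- s) l j).
Proof.
move=> H; elim: s => [|j s IH].
  by rewrite big_nil; under eq_fun do rewrite big_nil; exact: limit_cst.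
by rewrite big_cons; under eq_fun do rewrite big_cons; exact: limitD.
Qed.

Lemma limit_comp f (F : R[i] -> R[i]) l : limit f l -> cont_at F l -> limit (fun t => F (f t)) (F l).
Proof.
move=> fl cF e e0; have [q q0 Hq] := cF e e0; have q20 : 0 < q / 2 by rewrite divr_gt0.
have [r r0 Hr] := fl _ q20; exists r => // t /Hr h; apply: Hq; apply: le_lt_trans h _.
by rewrite ltr_pdivrMr // mulr_natr mulr2n ltrDl.
Qed.

Lemma limit_eq f g l (r0 : R) : 0 < r0 -> (forall t, B r0 t -> f t = g t) -> limit f l -> limit g l.
Proof.
move=> r00 fg fl e e0; have [r rp Hr] := fl e e0; exists (Num.min r r0); first by rewrite lt_min rp.
move=> t Bt; rewrite -fg; last by apply: Bmono Bt; rewrite ge_min lexx orbT.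
by apply: Hr; apply: Bmono Bt; rewrite ge_min lexx.
Qed.

Lemma limit_unique f l l' : (forall r : R, 0 < r -> exists t, B r t) -> limit f l -> limit f l' -> l = l'.
Proof.
move=> ne H1 H2; apply/eqP; rewrite -subr_eq0; apply/eqP; apply: nm_eqP => e e0.
have e20 : 0 < e / 2 by rewrite divr_gt0.
have [r1 r10 Hr1] := H1 _ e20; have [r2 r20 Hr2] := H2 _ e20.
have [|t Bt] := ne (Num.min r1 r2); first by rewrite lt_min r10.
rewrite (le_trans (nm_triangle (f t) _ _)) // (splitr e) lerD //.
  by rewrite nmB; apply: Hr1; apply: Bmono Bt; rewrite ge_min lexx.
by apply: Hr2; apply: Bmono Bt; rewrite ge_min lexx orbT.
Qed.

Variables (A : falgType R[i]) (n : nat) (I : n.-tuple A).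
Hypothesis sumI : forall v : A, v = \sum_k coord I k v *: tnth I k.
Implicit Types P : T -> A.

Definition vlimit P v := forall k, limit (fun t => coord I k (P t)) (coord I k v).

Lemma vlimit_cst v : vlimit (fun=> v) v. Proof. by move=> k; exact: limit_cst. Qed.

Lemma vlimitD P1 P2 v1 v2 : vlimit P1 v1 -> vlimit P2 v2 -> vlimit (fun t => P1 t + P2 t) (v1 + v2).
Proof.
move=> H1 H2 k; rewrite linearD; under eq_fun do rewrite linearD.
exact: limitD (H1 k) (H2 k).
Qed.

Lemma vlimit_sum (J : Type) (s : seq J) (P : J -> T -> A) v :
  (forall j, vlimit (P j) (v j)) -> vlimit (fun t => \sum_(j <- s) P j t) (\sum_(j <- s) v j).
Proof.
move=> H k; rewrite linear_sum; under eq_fun do rewrite linear_sum.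
by apply: limit_sum => j; exact: H.
Qed.

Lemma vlimitZ f P l v : limit f l -> vlimit P v -> vlimit (fun t => f t *: P t) (l *: v).
Proof.
move=> fl Pv k; rewrite linearZ; under eq_fun do rewrite linearZ.
exact: limitM fl (Pv k).
Qed.

(** The product is bilinear in the coordinates, with the fixed vectors [tnth I r * tnth I s] as
    coefficients. *)
Lemma vlimitM P1 P2 v1 v2 : vlimit P1 v1 -> vlimit P2 v2 -> vlimit (fun t => P1 t * P2 t) (v1 * v2).
Proof.
move=> H1 H2; have E x y : x * y = \sum_r \sum_s (coord I r x * coord I s y) *: (tnth I r * tnth I s).
  rewrite {1}(sumI x) mulr_suml; apply: eq_bigr => r _.
  rewrite {1}(sumI y) mulr_sumr; apply: eq_bigr => s _.
  by rewrite -scalerAl -scalerAr scalerA.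
rewrite E; rewrite (_ : (fun t => P1 t * P2 t) = fun t =>
  \sum_r \sum_s (coord I r (P1 t) * coord I s (P2 t)) *: (tnth I r * tnth I s)); last first.
  by apply/funext => t; exact: E.
apply: vlimit_sum => r; apply: vlimit_sum => s; apply: vlimitZ; last exact: vlimit_cst.
exact: limitM (H1 r) (H2 s).
Qed.

Lemma vlimit_eq P Q v (r0 : R) : 0 < r0 -> (forall t, B r0 t -> P t = Q t) -> vlimit P v -> vlimit Q v.
Proof. by move=> r00 PQ H k; apply: (limit_eq r00 _ (H k)) => t Bt; rewrite PQ. Qed.

Lemma vlimitX P v (j : nat) : vlimit P v -> vlimit (fun t => P t ^+ j) (v ^+ j).
Proof.
move=> H; elim: j => [|j IH]; first exact: vlimit_cst.
rewrite exprS; under eq_fun do rewrite exprS.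
exact: vlimitM.
Qed.

Lemma vlimitP P v : (forall e : R, 0 < e -> exists2 r : R, 0 < r &
    forall t, B r t -> forall k, nm (coord I k (P t) - coord I k v) <= e) <-> vlimit P v.
Proof.
split=> [H k e e0|H e e0].
  by have [r r0 Hr] := H e e0; exists r => // t /Hr.
have [||r r0 Hr] := @common_radius 'I_n (fun k r => forall t, B r t -> nm (coord I k (P t) - coord I k v) <= e).
- by move=> k r r' rr Hr t Bt; apply: Hr; exact: Bmono Bt.
- by move=> k; exact: H.
by exists r => // t Bt k; exact: Hr.
Qed.

End Limits.

(** * Neighbourhoods in coordinates *)

Section Topology.
Variables (R : realType) (A : falgType R[i]) (n : nat) (I : n.-tuple A).

Lemma nbhs_algP (x : A) (U : set A) : nbhs (x : alg_top I) U <->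
  exists2 r : R, 0 < r & forall y, (forall k, nm (coord I k y - coord I k x) < r) -> U y.
Proof.
split=> [[_ [[V oV <-] Vx] VU]|[r r0 H]].
  have [P HP PV] : nbhs (coords I x) V by exact: (open_nbhs_nbhs (conj oV Vx)).
  have [|k|r r0 Hr] := @common_radius R 'I_n
    (fun k r => forall w, nm (w - coord I k x) < r -> P 0 k w).
  - by move=> k r r' rr H w wr; apply: H; exact: lt_le_trans wr rr.
  - by have := HP 0 k; rewrite mxE => /nbhs_nmP.
  exists r => // y yx; apply: VU; apply: PV => i k; rewrite ord1 /coords mxE; exact: Hr.
have : nbhs (coords I x) [set M | forall k, nm (M 0 k - coord I k x) < r].
  exists (fun _ k => [set w | nm (w - coord I k x) < r]).
    by move=> i k; rewrite mxE; apply/nbhs_nmP; exists r.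
  by move=> M HM k; exact: HM.
move=> /(@initial_continuous _ _ (coords I) x) Hx.
apply: (@filterS _ (nbhs (x : alg_top I)) _ _ _ _ Hx) => y Hy.
by apply: H => k; have := Hy k; rewrite mxE.
Qed.

Lemma nbhs_rowP (p : 'rV[R]_3) (U : set 'rV[R]_3) : nbhs p U <->
  exists2 r : R, 0 < r & forall p' : 'rV[R]_3, (forall j, `|p' 0 j - p 0 j| < r) -> U p'.
Proof.
split=> [[P HP PU]|[r r0 H]].
  have [|k|r r0 Hr] := @common_radius R 'I_3 (fun k r => forall w, `|w - p 0 k| < r -> P 0 k w).
  - by move=> k r r' rr H w wr; apply: H; exact: lt_le_trans wr rr.
  - have /nbhs_ballP [r /= r0 Hr] := HP 0 k; exists r => // w wr; apply: Hr.
    by rewrite /ball /= distrC.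
  by exists r => // y yx; apply: PU => i k; rewrite ord1; exact: Hr.
exists (fun _ k => [set w | `|w - p 0 k| < r]).
  move=> i k; rewrite ord1; apply/nbhs_ballP; exists r => //= w.
  by rewrite /ball /= distrC.
by move=> M HM; apply: H => k; exact: HM.
Qed.

End Topology.

(** * Directional derivatives and jets *)

Section Derivatives.
Variables (R : realType) (A : falgType R[i]) (m n : nat).
Variables (I : n.-tuple A) (Y : 'I_n -> 'I_n -> 'I_n -> R[i]) (us : 'I_n -> 'I_n).
Variables (a b : 'I_n -> R[i]) (Omega : set 'rV[R]_3).
Hypothesis mulAC : forall x y : A, x * y = y * x.
Hypothesis cartan : cartan_basis m I Y us.
Local Notation Z := (zeta I a b).
Implicit Types (p h : 'rV[R]_3) (Psi N : 'rV[R]_3 -> A) (v : A) (F : R[i] -> R[i]).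

Lemma zetaD p h : Z (p + h) = Z p + Z h.
Proof.
rewrite /zeta !mxE !rmorphD /= !scalerDl.
by rewrite [RHS]addrACA; congr (_ + _); exact: addrACA.
Qed.

Lemma zetaZ (s : R) p : Z (s *: p) = s%:C *: Z p.
Proof. by rewrite /zeta !mxE !rmorphM /= !scalerDr !scalerA. Qed.

Lemma zetaB p h : Z (p - h) = Z p - Z h.
Proof. by rewrite -scaleN1r zetaD zetaZ rmorphN1 scaleN1r. Qed.

Definition close_in p (r : R) p' := Omega p' /\ forall j, `|p' 0 j - p 0 j| < r.
Definition small (r e : R) := 0 < e /\ e < r.

Lemma close_mono p (r r' : R) p' : r' <= r -> close_in p r' p' -> close_in p r p'.
Proof. by move=> rr [Op H]; split=> // j; exact: lt_le_trans (H j) rr. Qed.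

Lemma small_mono (r r' e : R) : r' <= r -> small r' e -> small r e.
Proof. by move=> rr [e0 er]; split=> //; exact: lt_le_trans er rr. Qed.

Lemma small_nonempty (r : R) : 0 < r -> exists e, small r e.
Proof.
by move=> r0; exists (r / 2); rewrite /small divr_gt0 // ltr_pdivrMr // mulr_natr mulr2n ltrDl.
Qed.

Local Notation vlim := (@vlimit R _ _ A n I).
Let sumI := coord_sum cartan.

Definition dquot Psi p h (e : R) := (e^-1)%:C *: (Psi (p + e *: h) - Psi p).
Definition dder Psi p h v := vlimit small I (dquot Psi p h) v.

Lemma limit_small : limit small (fun e : R => e%:C) 0.
Proof.
move=> e e0; exists e => // t [t0 te]; rewrite subr0 nm_real gtr0_norm // ltW //.
Qed.

Lemma invCK (e : R) : 0 < e -> e%:C * (e^-1)%:C = 1.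
Proof. by move=> e0; rewrite -rmorphM divff ?gt_eqF. Qed.

Lemma dder_cont Psi p h v : dder Psi p h v -> vlimit small I (fun e => Psi (p + e *: h)) (Psi p).
Proof.
move=> H; have := vlimitD small_mono (vlimitZ small_mono limit_small H) (vlimit_cst small I (Psi p)).
rewrite scale0r add0r; apply: (vlimit_eq small_mono ltr01) => e [e0 _].
by rewrite /dquot scalerA invCK // scale1r subrK.
Qed.

Lemma dder_cst x p h : dder (fun=> x) p h 0.
Proof.
move=> k e e0; exists 1 => // t _.
by rewrite /dquot subrr scaler0 subrr nm0 ltW.
Qed.

Lemma dderD Psi1 Psi2 p h v1 v2 : dder Psi1 p h v1 -> dder Psi2 p h v2 ->
  dder (fun p => Psi1 p + Psi2 p) p h (v1 + v2).
Proof.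
move=> H1 H2; apply: (vlimit_eq small_mono ltr01) (vlimitD small_mono H1 H2) => e _.
by rewrite /dquot -scalerDr opprD addrACA.
Qed.

Lemma dder_sum (J : Type) (s : seq J) (Psi : J -> 'rV[R]_3 -> A) p h (v : J -> A) :
  (forall j, dder (Psi j) p h (v j)) ->
  dder (fun p => \sum_(j <- s) Psi j p) p h (\sum_(j <- s) v j).
Proof.
move=> H; elim: s => [|j s IH].
  by rewrite big_nil; under eq_fun do rewrite big_nil; exact: dder_cst.
by rewrite big_cons; under eq_fun do rewrite big_cons; exact: dderD.
Qed.

Lemma dderM Psi1 Psi2 p h v1 v2 : dder Psi1 p h v1 -> dder Psi2 p h v2 ->
  dder (fun p => Psi1 p * Psi2 p) p h (v1 * Psi2 p + Psi1 p * v2).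
Proof.
move=> H1 H2.
have := vlimitD small_mono (vlimitM small_mono sumI H1 (dder_cont H2))
  (vlimitM small_mono sumI (vlimit_cst small I (Psi1 p)) H2).
apply: (vlimit_eq small_mono ltr01) => e _; rewrite /dquot.
rewrite -scalerAl -scalerAr -scalerDr mulrBl mulrBr addrA; congr (_ *: (_ - _)).
by rewrite subrK.
Qed.

Lemma dder_sder F u p h d : sder F (coord I u (Z p)) d ->
  dder (fun p => F (coord I u (Z p)) *: 1) p h ((d * coord I u (Z h)) *: 1).
Proof.
move=> HF; have L : limit small (fun e : R => (e^-1)%:C * (F (coord I u (Z (p + e *: h))) - F (coord I u (Z p))))
    (d * coord I u (Z h)).
  move=> e e0; set c := coord I u (Z h); have c0 : 0 < nm c + 1 by rewrite ltr_wpDl ?nm_ge0.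
  have [r r0 Hr] := HF _ (divr_gt0 e0 c0).
  exists (r / (nm c + 1)) => [|t [t0]]; first by rewrite divr_gt0.
  rewrite ltr_pdivlMr // => tr.
  have E : coord I u (Z (p + t *: h)) - coord I u (Z p) = t%:C * c.
    by rewrite zetaD zetaZ linearD linearZ /= addrC addKr.
  have lt : nm (coord I u (Z (p + t *: h)) - coord I u (Z p)) < r.
    rewrite E nmM nm_real gtr0_norm //; apply: le_lt_trans tr.
    by rewrite ler_wpM2l ?(ltW t0) // lerDl.
  have xx : nm (coord I u (Z p) - coord I u (Z p)) < r by rewrite subrr nm0.
  have := Hr _ _ xx lt; rewrite E.
  have tC : t%:C != 0 by rewrite -nm_gt0 nm_real normr_gt0 gt_eqF.
  have -> : F (coord I u (Z (p + t *: h))) - F (coord I u (Z p)) - d * (t%:C * c) =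
    t%:C * ((t^-1)%:C * (F (coord I u (Z (p + t *: h))) - F (coord I u (Z p))) - d * c).
    by rewrite fmorphV; move: (F _) (F _) => *; field.
  rewrite nmM [X in _ <= _ * X]nmM nm_real (gtr0_norm t0) mulrCA ler_pM2l // => /le_trans; apply.
  by rewrite mulrAC ler_pdivrMr // ler_wpM2l ?(ltW e0) // lerDl.
apply: (vlimit_eq small_mono ltr01) (vlimitZ small_mono L (vlimit_cst small I 1)) => e _.
by rewrite /dquot -scalerBl scalerA.
Qed.

Lemma dderX N p h v (j : nat) : dder N p h v ->
  dder (fun p => N p ^+ j) p h (j%:R *: (N p ^+ j.-1 * v)).
Proof.
move=> H; elim: j => [|j IH]; first by rewrite scale0r; exact: dder_cst.
rewrite (_ : (fun p => _) = fun p => N p * N p ^+ j); last by apply/funext => q; rewrite exprS.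
have := dderM H IH; congr (dder _ _ _ _).
rewrite /= (mulAC v) -scalerAr mulrA -exprS.
case: j {IH} => [|j]; first by rewrite !scale0r addr0 scale1r.
by rewrite -[_ * v in X in X + _]scale1r -scalerDl nat1r.
Qed.

(** Monogenicity for functions of the real triple instead of [zeta], so that steps and directions
    are vectors of real space. *)
Definition mono Psi := forall p, Omega p ->
  vlimit (close_in p) I Psi (Psi p) /\ exists d, forall h, dder Psi p h (Z h * d).

Lemma monoB Psi1 Psi2 : mono Psi1 -> mono Psi2 -> mono (fun p => Psi1 p - Psi2 p).
Proof.
move=> H1 H2 p Op; have [c1 [d1 D1]] := H1 p Op; have [c2 [d2 D2]] := H2 p Op; split.
  have := vlimitD (@close_mono p) c1 (vlimitZ (@close_mono p) (limit_cst (close_in p) (-1)) c2).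
  by rewrite scaleN1r; under eq_fun do rewrite scaleN1r.
exists (d1 - d2) => h; rewrite mulrBr.
have := vlimitZ small_mono (limit_cst small (-1)) (D2 h); rewrite scaleN1r => K.
apply: (vlimit_eq small_mono ltr01) (vlimitD small_mono (D1 h) K) => e _.
rewrite /dquot scaleN1r -scalerBr; congr (_ *: _).
by rewrite !opprD !addrA; congr (_ + _); exact: addrAC.
Qed.

Lemma zeta_cont p : vlimit (close_in p) I Z (Z p).
Proof.
have C j : limit (close_in p) (fun p' => (p' 0 j)%:C) (p 0 j)%:C.
  move=> e e0; exists e => // p' [_ /(_ j) H]; rewrite -rmorphB nm_real ltW //.
by apply: (vlimitD (@close_mono p)); [apply: (vlimitD (@close_mono p))|];
  apply: (vlimitZ (@close_mono p)) => //; exact: vlimit_cst.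
Qed.

(** The Taylor series of [F] about [coord I u x], evaluated at [x] and multiplied by [J]. For [J] in
    the block of [u] it breaks off, since [nilpotent] annihilates the powers from [n] on. *)
Definition jet F u J x :=
  \sum_(j < n) coefficient F j (coord I u x) *: (J * (x - coord I u x *: 1) ^+ j).

(** Termwise differentiation yields one sum with the scalar part of [Z h] and one with its nilpotent
    part. A shift of index in the latter combines them into [Z h] times the jet of the derivative of
    [F], whose coefficients are [j.+1%:R * c j.+1]. *)
Lemma jet_mono F (u : 'I_n) J : (u < m)%N -> tnth I u * J = J ->
  hol (coord I u @` (Z @` Omega)) F -> mono (fun p => jet F u J (Z p)).
Proof.
move=> um uJ hF p Op.
have Dxi : (coord I u @` (Z @` Omega)) (coord I u (Z p)) by exists (Z p) => //; exists p.
have zc := zeta_cont p.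
split.
  apply: (vlimit_sum (@close_mono p)) => j; apply: (vlimitZ (@close_mono p)).
    by apply: limit_comp (zc u) _; exact: sder_cont (coefficient_sder j hF Dxi).
  apply: (vlimitM (@close_mono p) sumI); first exact: vlimit_cst.
  apply: (vlimitX (@close_mono p) sumI).
  have := vlimitD (@close_mono p) zc (vlimitZ (@close_mono p)
     (limitM (@close_mono p) (limit_cst (close_in p) (-1)) (zc u)) (vlimit_cst (close_in p) I 1)).
  by rewrite mulN1r scaleNr; under eq_fun do rewrite mulN1r scaleNr.
pose N x := x - coord I u x *: 1.
pose c j := coefficient F j (coord I u (Z p)).
exists (\sum_(j < n) (j.+1%:R * c j.+1) *: (J * N (Z p) ^+ j)) => h.
have dN : dder (fun p => N (Z p)) p h (N (Z h)).
  apply: (vlimit_eq small_mono ltr01) (vlimit_cst small I (N (Z h))) => e [e0 _]; rewrite /dquot.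
  have -> : N (Z (p + e *: h)) = N (Z p) + e%:C *: N (Z h).
    rewrite /N zetaD zetaZ; move: (Z p) (Z h) => x y.
    have -> : coord I u (x + e%:C *: y) = coord I u x + e%:C * coord I u y by rewrite linearD linearZ.
    rewrite scalerDl scalerBr (scalerA e%:C) opprD; exact: addrACA.
  have E x y : (x + y) - x = y :> A by rewrite addrC addKr.
  by rewrite E scalerA mulrC invCK // scale1r.
pose w (j : nat) := (j%:R * c j) *: (J * (N (Z p) ^+ j.-1 * N (Z h))).
have D (j : 'I_n) : dder (fun p => coefficient F j (coord I u (Z p)) *: (J * N (Z p) ^+ j)) p h
   ((j.+1%:R * c j.+1 * coord I u (Z h)) *: (J * N (Z p) ^+ j) + w j).
  have := dderM (dder_sder h (coefficient_sder j hF Dxi)) (dderM (dder_cst J p h) (dderX j dN)).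
  rewrite mul0r add0r => K; rewrite (_ : (fun p => _) = fun p =>
    (coefficient F j (coord I u (Z p)) *: 1) * (J * N (Z p) ^+ j)); last first.
    by apply/funext => q; rewrite -scalerAl mul1r.
  move: K; congr (dder _ _ _ _); rewrite -2!scalerAl !mul1r; congr (_ + _).
  by rewrite /w -scalerAr -scalerAl mul1r scalerA; congr (_ *: _); exact: mulrC.
have := dder_sum (index_enum 'I_n) D; congr (dder _ _ _ _).
rewrite big_split /= -(big_mkord xpredT w).
have -> : \sum_(0 <= j < n) w j = \sum_(0 <= j < n) w j.+1.
  (* The shift leaves over a term with [n.-1] nilpotent factors taken at [p] and one at [h];
     together these [n] factors kill [J]. *)
  have wn : w n = 0.
    have W0 : vanish_below I 0 J by [].
    have := @vanish_nilpotent _ _ _ _ _ _ _ mulAC cartan u (Z p) J 0 n.-1 um uJ W0; rewrite add0n => W1.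
    have uJN : tnth I u * (J * N (Z p) ^+ n.-1) = J * N (Z p) ^+ n.-1 by rewrite mulrA uJ.
    have := nilpotent_step mulAC cartan (Z h) um uJN W1.
    rewrite prednK ?(leq_ltn_trans (leq0n _) (ltn_ord u)) // => /(vanish_all cartan) E.
    by rewrite /w mulrA E scaler0.
  have w0 : w 0%N = 0 by rewrite /w mul0r scale0r.
  have e1 : \sum_(0 <= j < n.+1) w j = \sum_(0 <= j < n) w j + w n by rewrite big_nat_recr.
  by rewrite big_nat_recl // w0 wn add0r addr0 in e1.
rewrite big_mkord -big_split mulr_sumr /=; apply: eq_bigr => j _.
rewrite /w /= -scalerA -scalerDr -scalerAr; congr (_ *: _).
have -> : coord I u (Z h) *: (J * N (Z p) ^+ j) = J * N (Z p) ^+ j * (coord I u (Z h) *: 1).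
  by rewrite -scalerAr mulr1.
rewrite (mulrA J) -mulrDr; have -> : coord I u (Z h) *: 1 + N (Z h) = Z h by rewrite addrC subrK.
exact: mulAC.
Qed.

End Derivatives.

(** * The leading coordinate as a holomorphic function *)

Section Representation.
Variables (R : realType) (A : falgType R[i]) (m n : nat).
Variables (I : n.-tuple A) (Y : 'I_n -> 'I_n -> 'I_n -> R[i]) (us : 'I_n -> 'I_n).
Variables (a b : 'I_n -> R[i]) (Omega : set 'rV[R]_3).
Hypothesis mulAC : forall x y : A, x * y = y * x.
Hypothesis cartan : cartan_basis m I Y us.
Hypothesis oOmega : open Omega.
Hypothesis convOmega : forall u : 'I_n, (u < m)%N ->
  convex_in_direction Omega (line (a u) (b u)).
Hypothesis surj : forall u : 'I_n, (u < m)%N -> coord I u @` E3 I a b = [set: R[i]].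
Local Notation Z := (zeta I a b).
Local Notation xi u p := (coord I u (Z p)).
Local Notation D u := (coord I u @` (Z @` Omega)).
Local Notation mono := (mono I a b Omega).
Local Notation close_in := (close_in Omega).
Implicit Types (p h : 'rV[R]_3) (Psi : 'rV[R]_3 -> A) (d : A).

Lemma coord_zeta (u : 'I_n) p : (u < m)%N ->
  xi u p = (p 0 0)%:C + (p 0 1)%:C * a u + (p 0 2)%:C * b u.
Proof.
move=> um; have L c : coord I u (lincomb I c) = c u.
  rewrite /lincomb linear_sum (bigD1 u) //= linearZ /= (coord_tnth cartan) eqxx mulr1.
  by rewrite big1 ?addr0 // => k ku; rewrite linearZ /= (coord_tnth cartan) (negbTE ku) mulr0.
by rewrite /zeta !linearD !linearZ /= (coord_one cartan um) mulr1 !L.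
Qed.

Lemma coord_zetaD (u : 'I_n) p h : xi u (p + h) = xi u p + xi u h.
Proof. by rewrite zetaD; move: (Z p) (Z h) => x y; rewrite linearD. Qed.

Lemma coord_zetaZ (u : 'I_n) (e : R) h : xi u (e *: h) = e%:C * xi u h.
Proof. by rewrite zetaZ; move: (Z h) => x; rewrite linearZ. Qed.

Lemma coord_zeta_line (u : 'I_n) h : (u < m)%N -> xi u h = 0 -> line (a u) (b u) h.
Proof.
move=> um; rewrite coord_zeta // /line /=; case: (a u) => ar ai; case: (b u) => br bi E.
have := congr1 (@complex.Re R) E; have := congr1 (@complex.Im R) E; rewrite /= !mul0r !subr0 !addr0 add0r.
by [].
Qed.

Lemma Omega_near p : Omega p -> exists2 r : R, 0 < r & forall p', (forall j, `|p' 0 j - p 0 j| < r) -> Omega p'.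
Proof. by move=> Op; apply/nbhs_rowP; apply: open_nbhs_nbhs. Qed.

Lemma shift_close p h (rho : R) : Omega p -> 0 < rho -> exists2 r : R, 0 < r &
  forall t, `|t| < r -> close_in p rho (p + t *: h).
Proof.
move=> /Omega_near [q q0 Hq] rho0; have s0 : 0 < Num.min q rho by rewrite lt_min q0.
have [||r r0 Hr] := @common_radius R 'I_3 (fun j r => forall t, `|t| < r ->
    `|(p + t *: h) 0 j - p 0 j| < Num.min q rho).
- by move=> j r r' rr H t tr; apply: H; exact: lt_le_trans tr rr.
- move=> j; have c0 : 0 < `|h 0 j| + 1 by rewrite ltr_wpDl.
  exists (Num.min q rho / (`|h 0 j| + 1)); first by rewrite divr_gt0.
  move=> t; rewrite ltr_pdivlMr // !mxE addrC addKr normrM; apply: le_lt_trans.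
  by rewrite ler_wpM2l // lerDl.
exists r => // t tr; split=> [|j].
  by apply: Hq => j; apply: lt_le_trans (Hr j t tr) _; rewrite ge_min lexx.
by apply: lt_le_trans (Hr j t tr) _; rewrite ge_min lexx orbT.
Qed.

Lemma zeta_e1 : Z (delta_mx 0 0) = 1.
Proof. by rewrite /zeta !mxE /= rmorph1 rmorph0 !scale0r !addr0 scale1r. Qed.

(** In the direction of the unit the derivative is [d] itself, a limit of difference quotients of
    [Psi]. *)
Lemma derivative_vanish Psi (k : nat) p d : Omega p ->
  (forall p, Omega p -> vanish_below I k (Psi p)) ->
  (forall h, dder I Psi p h (Z h * d)) -> vanish_below I k d.
Proof.
move=> Op HW Hd j jk; have := Hd (delta_mx 0 0) j; rewrite zeta_e1 mul1r => Hj.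
apply: (limit_unique (@small_mono R) (@small_nonempty R) Hj).
have [r r0 Hr] := shift_close (delta_mx 0 0) Op ltr01.
apply: (limit_eq (@small_mono R) r0) (limit_cst _ 0) => e [e0 er].
have [|Oe _] := Hr e; first by rewrite gtr0_norm.
by rewrite /dquot linearZ linearB /= (HW _ Oe j jk) (HW _ Op j jk) subrr mulr0.
Qed.

Lemma derivative_coord Psi (k : 'I_n) p : Omega p -> mono Psi ->
  (forall p, Omega p -> vanish_below I k (Psi p)) ->
  exists c : R[i], forall h, limit (@small R) (fun e => coord I k (dquot Psi p h e)) (xi (block m us k) h * c).
Proof.
move=> Op mPsi HW; have [_ [d Hd]] := mPsi p Op; exists (coord I k d) => h.
by have := Hd h k; rewrite (coord_mul_vanish mulAC cartan (Z h) (derivative_vanish Op HW Hd)).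
Qed.

Lemma coordinate_constant Psi (k : 'I_n) p p' : mono Psi ->
  (forall p, Omega p -> vanish_below I k (Psi p)) -> Omega p -> Omega p' ->
  xi (block m us k) p = xi (block m us k) p' -> coord I k (Psi p) = coord I k (Psi p').
Proof.
move=> mPsi HW Op Op' E; have qm := block_lt cartan k; set q := block m us k in E qm.
pose h := p' - p; have h0 : xi q h = 0 by rewrite /h zetaB linearB /= E subrr.
have seg t : 0 <= t <= 1 -> Omega (p + t *: h).
  have -> : p + t *: h = (1 - t) *: p + t *: p'.
    by rewrite /h scalerBr scalerBl scale1r addrA addrAC.
  exact: (convOmega qm Op Op' (coord_zeta_line qm h0)).
pose J t := coord I k (Psi (p + t *: h)).
have shiftE s t : p + t *: h = p + s *: h + (t - s) *: h.
  by rewrite -addrA -scalerDl (addrC s) subrK.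
suff : J 1 = J 0 by rewrite /J scale0r addr0 scale1r /h addrC subrK => ->.
(* Continuity comes from [mono]; the derivative, [xi q h * c] with [xi q h = 0], is known from the
   right only. *)
apply: right_derivative0_cst => [s s01 e e0|s /andP[s0 s1] e e0].
  have [/(_ k) c _] := mPsi _ (seg s s01); have [r r0 Hr] := c e e0.
  have [r' r'0 Hr'] := shift_close h (seg s s01) r0; exists r' => // t t01 ts.
  by rewrite /J (shiftE s t); apply: Hr; exact: Hr'.
have s01 : 0 <= s <= 1 by rewrite s0 ltW.
have [c Hc] := derivative_coord (seg s s01) mPsi HW.
have := Hc h e e0; rewrite -/q h0 mul0r => -[r r0 Hr]; exists r => // t.
rewrite le_eqVlt => /orP[/eqP <- _ _|st tr t1]; first by rewrite !subrr nm0 mulr0.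
have ts : 0 < t - s by rewrite subr_gt0.
have := Hr (t - s); rewrite subr0 /dquot linearZ linearB /= -shiftE nmM nm_real.
rewrite ger0_norm ?invr_ge0 ?(ltW ts) // mulrC ler_pdivrMr //; apply.
by split=> //; rewrite ltrBlDl.
Qed.

Variable k : 'I_n.
Local Notation q := (block m us k).
Let qm : (q < m)%N := block_lt cartan k.

(** A real-linear right inverse of [xi q], sending 1 to the direction of the unit and the imaginary
    unit to a preimage given by [surj]. It lifts complex steps to steps in space. *)
Lemma section_exists : exists lam : R[i] -> 'rV[R]_3,
  (forall w, xi q (lam w) = w) /\
    (forall p (rho : R), Omega p -> 0 < rho -> exists2 r : R, 0 < r &
      forall w, nm w < r -> close_in p rho (p + lam w)).
Proof.
have [_ [p2 _ <-] E2] : (coord I q @` E3 I a b) 'i%C by rewrite surj.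
pose e1 : 'rV[R]_3 := delta_mx 0 0.
have E1 : xi q e1 = 1 by rewrite zeta_e1 (coord_one cartan qm).
exists (fun w => complex.Re w *: e1 + complex.Im w *: p2); split.
  move=> w; rewrite coord_zetaD !coord_zetaZ E1 E2 mulr1.
  by rewrite [RHS]complexE mulrC.
move=> p rho /Omega_near [s s0 Hs] rho0; have t0 : 0 < Num.min s rho by rewrite lt_min s0.
have [||r r0 Hr] := @common_radius R 'I_3 (fun j r => forall w, nm w < r ->
    `|(p + (complex.Re w *: e1 + complex.Im w *: p2)) 0 j - p 0 j| < Num.min s rho).
- by move=> j r r' rr H w wr; apply: H; exact: lt_le_trans wr rr.
- move=> j; have c0 : 0 < `|e1 0 j| + `|p2 0 j| + 1 by rewrite ltr_wpDl // addr_ge0.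
  exists (Num.min s rho / (`|e1 0 j| + `|p2 0 j| + 1)); first by rewrite divr_gt0.
  move=> w; rewrite ltr_pdivlMr // => H; rewrite [(p + _) 0 j]mxE addrC addKr.
  rewrite [(_ + _ : 'rV_3) 0 j]mxE [(_ *: e1) 0 j]mxE [(_ *: p2) 0 j]mxE.
  apply: le_lt_trans H; rewrite (le_trans (ler_normD _ _)) // !normrM.
  rewrite !mulrDr mulr1 ler_wpDr ?nm_ge0 // lerD // ler_wpM2r //; [exact: nm_le_Re|exact: nm_le_Im].
exists r => // w wr; split=> [|j].
  by apply: Hs => j; apply: lt_le_trans (Hr j w wr) _; rewrite ge_min lexx.
by apply: lt_le_trans (Hr j w wr) _; rewrite ge_min lexx orbT.
Qed.

Lemma shadow_open : eopen (D q).
Proof.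
have [lam [lamK near]] := section_exists.
move=> _ [_ [p Op <-] <-]; have [r r0 Hr] := near p 1 Op ltr01; exists r => // w wr.
have [Ow _] := Hr _ wr; exists (Z (p + lam (w - xi q p))); first by exists (p + lam (w - xi q p)).
by rewrite coord_zetaD lamK addrC subrK.
Qed.

Theorem coordinate_hol Psi : mono Psi -> (forall p, Omega p -> vanish_below I k (Psi p)) ->
  exists H, hol (D q) H /\ forall p, Omega p -> coord I k (Psi p) = H (xi q p).
Proof.
move=> mPsi HW; have [lam [lamK near]] := section_exists.
(* Arbitrary preimages. By [coordinate_constant] the value of [H] does not depend on them, so near
   [w0] the point [P w0 + lam (w - w0)] may be used instead of [P w]. *)
have [P HP] : exists P : R[i] -> 'rV[R]_3, forall w, D q w -> Omega (P w) /\ xi q (P w) = w.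
  suff ex w : exists p, D q w -> Omega p /\ xi q p = w by have [P HP] := choice ex; exists P.
  have [[_ [p Op <-] E]|nD] := pselect (D q w); first by exists p.
  by exists 0 => /nD.
pose H w := coord I k (Psi (P w)).
have HE p : Omega p -> coord I k (Psi p) = H (xi q p).
  move=> Op; have [|OP xP] := HP (xi q p); first by exists (Z p) => //; exists p.
  by apply: coordinate_constant.
exists H; split=> //; apply: gateaux_hol; first exact: shadow_open.
- move=> w0 /HP [Op xP] e e0; have [/(_ k) c _] := mPsi _ Op; have [r r0 Hr] := c e e0.
  have [r' r'0 Hr'] := near _ r Op r0; exists r' => // w /Hr' cl; have [Ow _] := cl.
  have := Hr _ cl; rewrite (HE _ Ow) (HE _ Op) coord_zetaD lamK xP (addrC w0) subrK; exact.
move=> w0 /HP [Op xP]; have [c Hc] := derivative_coord Op mPsi HW; exists c => v e e0.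
have [r r0 Hr] := Hc (lam v) e e0; have [r' r'0 Hr'] := shift_close (lam v) Op ltr01.
exists (Num.min r r'); first by rewrite lt_min r0.
move=> h h0; rewrite lt_min => /andP[hr hr'].
have [|Oh _] := Hr' h; first by rewrite gtr0_norm.
have := Hr h (conj h0 hr); rewrite lamK /dquot linearZ linearB /= (HE _ Oh) (HE _ Op).
have -> : xi q (P w0 + h *: lam v) = w0 + h%:C * v by rewrite coord_zetaD coord_zetaZ lamK xP.
rewrite xP; move: (H (w0 + _)) (H w0) => H1 H2.
have hC : h%:C != 0 by rewrite -nm_gt0 nm_real normr_gt0 gt_eqF.
have -> : H1 - H2 - h%:C * v * c = h%:C * ((h^-1)%:C * (H1 - H2) - v * c).
  by rewrite fmorphV mulrBr mulrA divff // mul1r mulrA.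
by rewrite (nmM h%:C) nm_real gtr0_norm // [h * _]mulrC ler_pM2r.
Qed.

End Representation.

(** * Expansion into jets; existence of contours *)

Section Expansion.
Variables (R : realType) (A : falgType R[i]) (m n : nat).
Variables (I : n.-tuple A) (Y : 'I_n -> 'I_n -> 'I_n -> R[i]) (us : 'I_n -> 'I_n).
Variables (a b : 'I_n -> R[i]) (Omega : set 'rV[R]_3).
Hypothesis mulAC : forall x y : A, x * y = y * x.
Hypothesis cartan : cartan_basis m I Y us.
Hypothesis oOmega : open Omega.
Hypothesis convOmega : forall u : 'I_n, (u < m)%N ->
  convex_in_direction Omega (line (a u) (b u)).
Hypothesis surj : forall u : 'I_n, (u < m)%N -> coord I u @` E3 I a b = [set: R[i]].
Local Notation Z := (zeta I a b).
Local Notation D u := (coord I u @` (Z @` Omega)).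
Local Notation block := (block m us).

Lemma monogenic_mono Phi : monogenic I a b (Z @` Omega) Phi ->
  mono I a b Omega (fun p => Phi (Z p)).
Proof.
have nbU (x : A) (e : R) : 0 < e -> nbhs (x : alg_top I) [set y | forall k, nm (coord I k y - coord I k x) < e].
  by move=> e0; apply/nbhs_algP; exists e.
move=> [/subspace_continuousP cPhi dPhi] p Op; have Ax : (Z @` Omega) (Z p) by exists p.
split.
  apply/(vlimitP (@close_mono R Omega p)) => e e0.
  have := cPhi _ Ax _ (nbU _ e e0); rewrite /nbhs /= => /nbhs_algP [r r0 Hr].
  have r20 : 0 < r / 2 by rewrite divr_gt0.
  have [r' r'0 Hr'] := (vlimitP (@close_mono R Omega p) I Z (Z p)).2 (zeta_cont I a b Omega p) _ r20.
  exists r' => // p' cl k; have [Op' _] := cl.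
  apply: ltW; apply: (Hr (Z p')) => [l|]; last by exists p'.
  apply: le_lt_trans (Hr' _ cl l) _; by rewrite ltr_pdivrMr // mulr_natr mulr2n ltrDl.
have [d Hd] := dPhi _ Ax; exists d => h.
apply/(vlimitP (@small_mono R)) => e e0.
have Eh : E3 I a b (Z h) by exists h.
have := Hd _ Eh _ (nbU _ e e0); rewrite /nbhs /= => /nbhs_ballP [r /= r0 Hr].
exists r => // t [t0 tr] k; have : ball (0 : R) r t by rewrite /ball /= sub0r normrN gtr0_norm.
by move=> /Hr /(_ t0) /(_ k); rewrite /dquot zetaD zetaZ => /ltW.
Qed.

(** The i-th term of the jet vanishes below index [k + i], so up to index [k] only the term of order
    0 is visible. *)
Lemma coord_jet F (k j : 'I_n) x : (j <= k)%N ->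
  coord I j (jet I F (block k) (tnth I k) x) = F (coord I (block k) x) * (k == j)%:R.
Proof.
move=> jk; have n0 : (0 < n)%N := leq_ltn_trans (leq0n _) (ltn_ord k).
have Wk : vanish_below I k (tnth I k).
  move=> l lk; rewrite (coord_tnth cartan); case: eqP => // kl.
  by move: lk; rewrite -kl ltnn.
rewrite /jet linear_sum (bigD1 (Ordinal n0)) //= linearZ /= expr0 mulr1 (coord_tnth cartan).
rewrite big1 ?addr0 // => i i0; rewrite linearZ /=.
have := @vanish_nilpotent _ _ _ _ _ _ _ mulAC cartan (block k) x (tnth I k) k i
  (block_lt cartan k) (tnth_block cartan k) Wk => ->; first by rewrite mulr0.
have : (0 < i)%N by rewrite lt0n; apply: contra i0 => /eqP i0; apply/eqP; exact: val_inj.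
by move=> ip; rewrite (leq_ltn_trans jk) // -[X in (X < _)%N]addn0 ltn_add2l.
Qed.

Lemma jet_expansion Psi : mono I a b Omega Psi -> exists H : 'I_n -> R[i] -> R[i],
  (forall l, hol (D (block l)) (H l)) /\
  forall p, Omega p -> Psi p = \sum_(l < n) jet I (H l) (block l) (tnth I l) (Z p).
Proof.
move=> mPsi.
pose rest (H : 'I_n -> R[i] -> R[i]) k p :=
  Psi p - \sum_(l < n | (l < k)%N) jet I (H l) (block l) (tnth I l) (Z p).
suff step k : (k <= n)%N -> exists H, [/\ forall l : 'I_n, (l < k)%N -> hol (D (block l)) (H l),
    mono I a b Omega (rest H k) & forall p, Omega p -> vanish_below I k (rest H k p)].
  have [H [hH _ HW]] := step n (leqnn n); exists H; split=> [l|p Op]; first exact: hH (ltn_ord l).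
  have /eqP := vanish_all cartan (HW p Op); rewrite /rest subr_eq0 => /eqP ->.
  by apply: eq_bigl => l; rewrite ltn_ord.
elim: k => [_|k IH kn].
  exists (fun=> fun=> 0); split=> // p; have E : rest (fun=> fun=> 0) 0%N = Psi.
    by apply/funext => q; rewrite /rest big_pred0 ?subr0.
  by rewrite E; exact: mPsi.
have [H [hH mH HW]] := IH (ltnW kn); pose kk : 'I_n := Ordinal kn.
have [F [hF HF]] := coordinate_hol mulAC cartan oOmega convOmega surj (k := kk) mH HW.
pose H' l := if l == kk then F else H l.
have E p : rest H' k.+1 p = rest H k p - jet I F (block kk) (tnth I kk) (Z p).
  rewrite /rest (bigD1 kk) //= [in H' kk]/H' eqxx opprD addrCA addrC; congr (_ - _ - _).
  apply: eq_big => [l|l /andP[_ lk]]; last by rewrite /H' (negbTE lk).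
  by rewrite ltnS ltn_neqAle andbC.
exists H'; split.
- move=> l; rewrite ltnS leq_eqVlt /H'; have [->|lk] := eqVneq l kk; first by [].
  by case/orP => [/eqP E'|/hH //]; case/eqP: lk; exact: val_inj.
- rewrite (_ : rest H' k.+1 = fun p => rest H k p - jet I F (block kk) (tnth I kk) (Z p)); last exact/funext.
  apply: monoB => //; apply: (jet_mono mulAC cartan) => //; first exact: block_lt cartan kk.
  exact: tnth_block cartan kk.
move=> p Op j; rewrite ltnS => jk; rewrite E linearB /= coord_jet // -HF //.
have [jE|jN] := eqVneq kk j; first by rewrite -jE mulr1 subrr.
rewrite mulr0 subr0; apply: HW => //; rewrite ltn_neqAle jk andbT.
by apply: contra jN => /eqP jE; apply/eqP; apply: val_inj.
Qed.

(** A circle whose radius is less than the distance from its centre to every other value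
    [coord I l x]. Values that coincide with the centre are off the trace as well. *)
Lemma contour_exists (q : 'I_n) x : eopen (D q) -> D q (coord I q x) -> exists g,
  [/\ admissible_contour (D q) g, inside g (coord I q x) &
      forall l : 'I_n, (l < m)%N -> l != q -> ~ trace g (coord I l x)].
Proof.
move=> oD Dx; have [r r0 Hr] := oD _ Dx.
have [||s s0 Hs] := @common_radius R 'I_n (fun l s => coord I l x != coord I q x ->
   s <= nm (coord I l x - coord I q x)).
- by move=> l s s' ss H lq; exact: le_trans ss (H lq).
- move=> l; have [E|N] := eqVneq (coord I l x) (coord I q x); first by exists 1.
  by exists (nm (coord I l x - coord I q x)) => //; rewrite nm_gt0 subr_eq0.
have rs0 : 0 < Num.min r s by rewrite lt_min r0.
pose rho := Num.min r s / 2; have rho0 : 0 < rho by rewrite divr_gt0.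
have rhol : rho < Num.min r s by rewrite ltr_pdivrMr // mulr_natr mulr2n ltrDl.
exists (circle (coord I q x) rho); split.
- apply: circle_admissible => // w wr; apply: Hr; apply: le_lt_trans wr _.
  by apply: lt_le_trans rhol _; rewrite ge_min lexx.
- by apply/circle_inside => //; rewrite subrr nm0.
move=> l _ _; apply/traceP => t _; apply/eqP => E.
have := circle_dist (coord I q x) t rho0; rewrite E => d.
have [E2|N2] := eqVneq (coord I l x) (coord I q x).
  by move: d; rewrite E2 subrr nm0 => d; rewrite d ltxx in rho0.
have := Hs l N2; rewrite d leNgt => /negP; apply; apply: lt_le_trans rhol _.
by rewrite ge_min lexx orbT.
Qed.

End Expansion.

Unset Implicit Arguments.
Local Close Scope complex_scope.

Theorem theorem1 (R : realType) (A : falgType R[i]) (m n : nat)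
    (I : n.-tuple A) (Y : 'I_n -> 'I_n -> 'I_n -> R[i]) (us : 'I_n -> 'I_n)
    (a b : 'I_n -> R[i]) (Omega : set 'rV[R]_3) (Phi : A -> A)
    (mn : (m <= n)%N)
    (mulAC : forall x y : A, x * y = y * x)
    (cartan : cartan_basis m I Y us)
    (indep : lin_indep I a b)
    (domOmega : domain Omega)
    (convOmega : forall u : 'I_n, (u < m)%N ->
       convex_in_direction Omega (line (a u) (b u)))
    (surj : forall u : 'I_n, (u < m)%N -> coord I u @` E3 I a b = [set: R[i]])
    (monoPhi : monogenic I a b (zeta I a b @` Omega) Phi) :
  let Omega_zeta := zeta I a b @` Omega in
  let D (u : 'I_n) := coord I u @` Omega_zeta in
  exists F G : 'I_n -> R[i] -> R[i],
  [/\ forall u : 'I_n, (u < m)%N -> holomorphic_on (D u) (F u),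
      forall s : 'I_n, (m <= s)%N -> holomorphic_on (D (us s)) (G s) &
      forall x : A, Omega_zeta x ->
      let contour_at (q : 'I_n) (g : R -> R[i]) :=
        [/\ admissible_contour (D q) g, inside g (coord I q x) &
            forall l : 'I_n, (l < m)%N -> l != q -> ~ trace g (coord I l x)] in
      (forall q : 'I_n, (q < m)%N -> exists g, contour_at q g) /\
      forall Gamma : 'I_n -> R -> R[i],
      (forall q : 'I_n, (q < m)%N -> contour_at q (Gamma q)) ->
      Phi x =
        \sum_(u < n | (u < m)%N)
           tnth I u * cauchy_term I (Gamma u) (F u) x +
        \sum_(s < n | (m <= s)%N)
           tnth I s * cauchy_term I (Gamma (us s)) (G s) x].
Proof.
move=> Omega_zeta D; have [oOmega _ _] := domOmega.
have [H [hH HE]] := jet_expansion mulAC cartan oOmega convOmega surj (monogenic_mono monoPhi).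
have holD l : holomorphic_on (D (block m us l)) (H l).
  by move=> z Dz; exact: sder_derivable (hol_derivative (hH l) Dz).
have block_us (s : 'I_n) : (m <= s)%N -> block m us s = us s by rewrite /block ltnNge => ->.
have oD (q : 'I_n) : (q < m)%N -> eopen (D q).
  by move=> qm; have := shadow_open cartan oOmega surj (k := q); rewrite block_id.
(* The jet expansion supplies one function per basis element: it is read as [F] at the idempotents
   and as [G] at the nilpotent elements. *)
exists H, H; split=> [u um|s ms|x xO contour_at].
- by rewrite -[u in D u](block_id us um).
- by rewrite -block_us.
split=> [q qm|Gamma HG].
  by apply: contour_exists; [exact: oD|exists x].
have [p Op px] := xO; rewrite -[in LHS]px HE // px (bigID (fun l : 'I_n => (l < m)%N)) /=.
have term l : jet I (H l) (block m us l) (tnth I l) x =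
    tnth I l * cauchy_term I (Gamma (block m us l)) (H l) x.
  have qm := block_lt cartan l; have [ag ins off] := HG _ qm.
  by rewrite (mul_cauchy_term mulAC cartan qm (tnth_block cartan l) (oD _ qm) (hH l) ag ins off).
congr (_ + _).
  by apply: eq_bigr => u um; rewrite term block_id.
by apply: eq_big => s; rewrite -leqNgt // => ms; rewrite term block_us.
Qed.
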